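(* Let $D=\{z\in\mathbb{C}:|z|<1\}$ and $n\in\mathbb{Z}_{\geq1}\cup\{\infty\}$, and consider the orbifold $(D/(1-\frac1n)\{0\})$. Then its orbifold Kobayashi pseudo-distance and classical orbifold Kobayashi pseudo-distance coincide, and both equal the pseudo-distance induced by the metric $$\omega=\frac{4\,dz\,d\bar z}{n^2|z|^{2-\frac2n}(1-|z|^{\frac2n})^2}$$ (for $n=\infty$ this is interpreted as $\omega=\frac{4\,dz\,d\bar z}{|z|^2(\log|z|^2)^2}$ on $D\setminus\{0\}$).
   Context: For an orbifold $(X/\Delta)$, $\Delta=\sum_i(1-\frac1{m_i})Z_i$ ($m_i\in\mathbb{Z}_{\ge1}\cup\{\infty\}$), let $\Delta_1$ be the union of the $Z_i$ with $m_i=\infty$. A holomorphic map $h:D\to X$ is an orbifold morphism (resp. classical orbifold morphism) to $(X/\Delta)$ if $h(D)\not\subset\operatorname{supp}\Delta$ and for all $i$ and all $x\in D$ with $h(x)\in Z_i$ the multiplicity of $h^*Z_i$ at $x$ is $\geq m_i$ (resp. is a multiple of $m_i$); if $m_i=\infty$ one requires $h(D)\cap Z_i=\emptyset$. The orbifold Kobayashi pseudo-distance $d_{(X/\Delta)}$ (resp. classical $d^*_{(X/\Delta)}$) is the largest pseudo-distance on $X\setminus\Delta_1$ such that $g^*d\leq d_P$ for every orbifold morphism (resp. classical orbifold morphism) $g:D\to(X/\Delta)$, where $d_P$ is the Poincaré distance on $D$, induced by $\frac{4\,dz\,d\bar z}{(1-|z|^2)^2}$. *)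

(* Defs.v *)
From Stdlib Require Import Reals.
Open Scope R_scope.

Definition Cx := (R * R)%type.
Definition C0 : Cx := (0, 0).
Definition Cadd (z w : Cx) : Cx := (fst z + fst w, snd z + snd w).
Definition Csub (z w : Cx) : Cx := (fst z - fst w, snd z - snd w).
Definition Cmul (z w : Cx) : Cx :=
  (fst z * fst w - snd z * snd w, fst z * snd w + snd z * fst w).
Fixpoint Cpow (z : Cx) (k : nat) : Cx :=
  match k with O => (1, 0) | S k' => Cmul z (Cpow z k') end.
Definition Cnorm (z : Cx) : R := sqrt (fst z ^ 2 + snd z ^ 2).

Definition in_disc (z : Cx) : Prop := Cnorm z < 1.

Definition C_differentiable_at (f : Cx -> Cx) (z : Cx) : Prop :=
  exists l : Cx, forall eps, 0 < eps -> exists delta, 0 < delta /\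
    forall w, Cnorm (Csub w z) < delta ->
      Cnorm (Csub (Csub (f w) (f z)) (Cmul l (Csub w z))) <= eps * Cnorm (Csub w z).

Definition holomorphic_on (U : Cx -> Prop) (f : Cx -> Cx) : Prop :=
  forall z, U z -> C_differentiable_at f z.

Definition vanishing_order (h : Cx -> Cx) (x : Cx) (k : nat) : Prop :=
  exists (r : R) (g : Cx -> Cx), 0 < r /\
    holomorphic_on (fun w => Cnorm (Csub w x) < r) g /\ g x <> C0 /\
    forall w, Cnorm (Csub w x) < r -> h w = Cmul (Cpow (Csub w x) k) (g w).

(** * The orbifold (D / (1 - 1/n) {0}), n : option nat, None = infinity *)

Definition orb_dom (n : option nat) (z : Cx) : Prop :=
  in_disc z /\ (n = None -> z <> C0).

Definition orbifold_morphism (classical : bool) (n : option nat) (h : Cx -> Cx) : Prop :=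
  holomorphic_on in_disc h /\
  (forall x, in_disc x -> in_disc (h x)) /\
  (* h(D) not contained in supp Delta (supp Delta = {0} unless n = 1) *)
  (n = Some 1%nat \/ exists x, in_disc x /\ h x <> C0) /\
  match n with
  | None => forall x, in_disc x -> h x <> C0
  | Some m => forall x, in_disc x -> h x = C0 ->
      exists k, vanishing_order h x k /\
        (if classical then exists j, k = (j * m)%nat else (m <= k)%nat)
  end.

Definition C1_curve (U : Cx -> Prop) (gam gam' : R -> Cx) (p q : Cx) : Prop :=
  (forall t, derivable_pt_lim (fun s => fst (gam s)) t (fst (gam' t))) /\
  (forall t, derivable_pt_lim (fun s => snd (gam s)) t (snd (gam' t))) /\
  continuity (fun t => fst (gam' t)) /\ continuity (fun t => snd (gam' t)) /\
  gam 0 = p /\ gam 1 = q /\ (forall t, 0 <= t <= 1 -> U (gam t)).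

(** Length of the curve w.r.t. the metric [coef] is <= L.  The metric is
    finite on [reg] and +infinity elsewhere (with the convention inf*0 = 0);
    the length (integral of sqrt(coef(gam t)) |gam' t| dt, a lower
    semicontinuous [0,+inf]-valued function) is the supremum of integrals of
    step functions lying below the integrand. *)
Definition length_le (reg : Cx -> Prop) (coef : Cx -> R) (gam gam' : R -> Cx) (L : R) : Prop :=
  forall phi : StepFun 0 1,
    (forall t, 0 <= t <= 1 ->
       (gam' t = C0 -> phi t <= 0) /\
       (reg (gam t) -> phi t <= sqrt (coef (gam t)) * Cnorm (gam' t))) ->
    RiemannInt_SF phi <= L.

Definition length_set (reg : Cx -> Prop) (coef : Cx -> R) (U : Cx -> Prop) (p q : Cx) (L : R) : Prop :=
  exists gam gam', C1_curve U gam gam' p q /\ length_le reg coef gam gam' L.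

Definition is_glb (E : R -> Prop) (m : R) : Prop :=
  (forall x, E x -> m <= x) /\ (forall m', (forall x, E x -> m' <= x) -> m' <= m).

Definition induced_distance (reg : Cx -> Prop) (coef : Cx -> R) (U : Cx -> Prop)
  (d : Cx -> Cx -> R) : Prop :=
  forall p q, U p -> U q -> is_glb (length_set reg coef U p q) (d p q).

Definition poincare_coef (z : Cx) : R := 4 / (1 - Cnorm z ^ 2) ^ 2.

Definition poincare_le (a b : Cx) (L : R) : Prop :=
  length_set in_disc poincare_coef in_disc a b L.

Definition rpow (x y : R) : R :=
  if Req_dec_T x 0 then (if Req_dec_T y 0 then 1 else 0) else Rpower x y.

Definition omega_coef (n : option nat) (z : Cx) : R :=
  match n with
  | Some m => 4 / (INR m ^ 2 * rpow (Cnorm z) (2 - 2 / INR m)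
                   * (1 - rpow (Cnorm z) (2 / INR m)) ^ 2)
  | None => 4 / (Cnorm z ^ 2 * (ln (Cnorm z ^ 2)) ^ 2)
  end.

(** where omega is finite *)
Definition omega_reg (n : option nat) (z : Cx) : Prop :=
  in_disc z /\ (z <> C0 \/ n = Some 1%nat).

Definition pseudo_distance_on (U : Cx -> Prop) (d : Cx -> Cx -> R) : Prop :=
  forall p q r, U p -> U q -> U r ->
    d p p = 0 /\ d p q = d q p /\ d p r <= d p q + d q r.

Definition contracted (classical : bool) (n : option nat) (d : Cx -> Cx -> R) : Prop :=
  forall g, orbifold_morphism classical n g ->
    forall a b L, in_disc a -> in_disc b -> poincare_le a b L -> d (g a) (g b) <= L.

Definition is_orbifold_kobayashi (classical : bool) (n : option nat) (d : Cx -> Cx -> R) : Prop :=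
  pseudo_distance_on (orb_dom n) d /\ contracted classical n d /\
  forall d', pseudo_distance_on (orb_dom n) d' -> contracted classical n d' ->
    forall p q, orb_dom n p -> orb_dom n q -> d' p q <= d p q.

(* Main.v *)
From Stdlib Require Import Reals Lra Lia Psatz ClassicalEpsilon List.
From Coquelicot Require Import Coquelicot.
Require Import Defs.
Open Scope R_scope.

(** The metric may be infinite at [0], and lengths are suprema over step functions, so curves
    through [0] are awkward to integrate, reverse or concatenate directly. Both halves of the proof
    therefore meet in the relation [chain], generated by Poincare curves transported by the single
    map [cover]. A curve of length [L] gives a chain of cost [L + e] for every [e > 0]. A chain
    gives back a [rest_curve] of the same cost, where the Poincare density carried over from the
    disc is a continuous majorant even at [0]. This round trip yields symmetry and the triangle
    inequality for the infimum [d]. Since [cover] is a classical morphism, hence also a morphism,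
    chain costs bound every contracted pseudo-distance of either kind, while the Schwarz-Pick
    inequality is proved for all morphisms. One argument thus serves both distances. *)

(** By the orbifold Schwarz-Pick inequality every orbifold morphism [h] from the disc contracts the
    Poincare metric to [omega].  If [h] has finitely many zeros, each of order at least [m], write
    [h] as a product of powers [b_a ^ k] of Blaschke factors and a nonvanishing function of modulus
    at most 1.  The logarithmic derivative of the latter is bounded by the Schwarz lemma applied to
    its logarithm, each factor contributes [k sinh s <= m sinh (k s / m)] with [s = - log |b_a|], and
    superadditivity of [sinh] adds up the contributions.  Finiteness of the zeros is obtained by
    passing to [z -> h (R z)] and letting [R] tend to 1.

    Conversely the covers [z -> z ^ m] and [z -> exp ((z + 1) / (z - 1))] are classical orbifold
    morphisms and local isometries away from [0], so a curve avoiding [0] lifts to the disc without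
    changing its length.  A curve through [0] is cut at its first and last zeros, where a short
    radial curve replaces the missing end of each arc.

    Goursat's theorem is proved by bisection.  Pulled back by [exp], it says that the circle means of
    a function holomorphic on a punctured disc do not depend on the radius, whence the mean value
    property, the maximum principle, and the continuity of complex derivatives. *)

(** * Complex derivatives *)

Lemma Cpow_eq (z : C) (k : nat) : Defs.Cpow z k = (z ^ k)%C.
Proof. induction k as [|k IH]; simpl; [reflexivity|]. rewrite IH. reflexivity. Qed.

Definition Ccont (f : C -> C) (z : C) : Prop :=
  forall eps, 0 < eps -> exists delta, 0 < delta /\
    forall w, Cmod (w - z) < delta -> Cmod (f w - f z) < eps.

(** This is convertible to the body of [C_differentiable_at], so hypotheses of the form
    [holomorphic_on] can be destructed directly into the vocabulary of Coquelicot. *)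
Definition Cderiv (f : C -> C) (z l : C) : Prop :=
  forall eps, 0 < eps -> exists delta, 0 < delta /\
    forall w, Cmod (w - z) < delta ->
      Cmod (f w - f z - l * (w - z)) <= eps * Cmod (w - z).

Lemma Cmod_minus_sym (a b : C) : Cmod (a - b) = Cmod (b - a).
Proof. rewrite <- Cmod_opp. f_equal. ring. Qed.

Lemma Cmod_triangle_sub (a b c : C) : Cmod (a - c) <= Cmod (a - b) + Cmod (b - c).
Proof. replace (a - c)%C with ((a - b) + (b - c))%C by ring. apply Cmod_triangle. Qed.

Lemma Cmod_rev_triangle (a b : C) : Cmod a - Cmod b <= Cmod (a - b).
Proof.
  pose proof (Cmod_triangle (a - b) b) as H.
  replace (a - b + b)%C with a in H by ring. lra.
Qed.

Lemma Cmod_self (a : C) : Cmod (a - a) = 0.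
Proof. replace (a - a)%C with (RtoC 0) by ring. apply Cmod_0. Qed.

Lemma Cmod_pos (a : C) : a <> 0 -> 0 < Cmod a.
Proof. apply Cmod_gt_0. Qed.

Lemma Cminus_neq_0 (a b : C) : a <> b -> (a - b)%C <> 0.
Proof. intros H E. apply H. replace a with (a - b + b)%C by ring. rewrite E. ring. Qed.

Lemma Cmod_eq (a : C) : Cmod a = sqrt (fst a ^ 2 + snd a ^ 2).
Proof. reflexivity. Qed.

Lemma Cmod_sqr (a : C) : Cmod a ^ 2 = fst a ^ 2 + snd a ^ 2.
Proof. rewrite Cmod_eq, pow2_sqrt; [reflexivity | nra]. Qed.

Lemma Rabs_fst_le (a : C) : Rabs (fst a) <= Cmod a.
Proof. apply Rle_trans with (2 := Rmax_Cmod a). apply Rmax_l. Qed.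
Lemma Rabs_snd_le (a : C) : Rabs (snd a) <= Cmod a.
Proof. apply Rle_trans with (2 := Rmax_Cmod a). apply Rmax_r. Qed.
Lemma Cmod_le_sum (a : C) : Cmod a <= Rabs (fst a) + Rabs (snd a).
Proof.
  pose proof (Cmod_sqr a) as H. pose proof (Cmod_ge_0 a).
  pose proof (Rabs_pos (fst a)). pose proof (Rabs_pos (snd a)).
  rewrite <- (pow2_abs (fst a)), <- (pow2_abs (snd a)) in H.
  apply Rnot_lt_le; intro; nra.
Qed.

Lemma Ccont_const (k z : C) : Ccont (fun _ => k) z.
Proof. intros e He. exists 1. split; [lra|]. intros w _. now rewrite Cmod_self. Qed.
Lemma Ccont_id (z : C) : Ccont (fun w => w) z.
Proof. intros e He. exists e. auto. Qed.

Lemma Ccont_ext_loc (f g : C -> C) (z : C) (r : R) : 0 < r ->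
  (forall w, Cmod (w - z) < r -> f w = g w) -> Ccont f z -> Ccont g z.
Proof.
  intros Hr H Hf e He. destruct (Hf e He) as [d [Hd H1]].
  exists (Rmin d r). split; [apply Rmin_pos; auto|]. intros w Hw.
  rewrite <- !H; [apply H1 | rewrite Cmod_self; lra |];
  eapply Rlt_le_trans; eauto; [apply Rmin_l | apply Rmin_r].
Qed.

Lemma Ccont_add (f g : C -> C) (z : C) : Ccont f z -> Ccont g z -> Ccont (fun w => f w + g w)%C z.
Proof.
  intros Hf Hg e He. destruct (Hf (e/2)) as [d1 [Hd1 H1]]; [lra|].
  destruct (Hg (e/2)) as [d2 [Hd2 H2]]; [lra|].
  exists (Rmin d1 d2). split; [apply Rmin_pos; auto|]. intros w Hw.
  assert (A := H1 w ltac:(eapply Rlt_le_trans; eauto; apply Rmin_l)).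
  assert (B := H2 w ltac:(eapply Rlt_le_trans; eauto; apply Rmin_r)).
  replace (f w + g w - (f z + g z))%C with ((f w - f z) + (g w - g z))%C by ring.
  eapply Rle_lt_trans; [apply Cmod_triangle|]. lra.
Qed.

Lemma Ccont_mul (f g : C -> C) (z : C) : Ccont f z -> Ccont g z -> Ccont (fun w => f w * g w)%C z.
Proof.
  intros Hf Hg e He.
  pose proof (Cmod_ge_0 (f z)) as Pf. pose proof (Cmod_ge_0 (g z)) as Pg.
  set (M := Cmod (f z) + Cmod (g z) + 1).
  assert (HM : 0 < e / (2 * M)) by (apply Rdiv_lt_0_compat; unfold M; lra).
  destruct (Hf _ HM) as [d1 [Hd1 H1]].
  destruct (Hg (Rmin 1 (e / (2 * M)))) as [d2 [Hd2 H2]]; [apply Rmin_pos; lra|].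
  exists (Rmin d1 d2). split; [apply Rmin_pos; auto|]. intros w Hw.
  assert (A := H1 w ltac:(eapply Rlt_le_trans; eauto; apply Rmin_l)).
  assert (B := H2 w ltac:(eapply Rlt_le_trans; eauto; apply Rmin_r)).
  pose proof (Rmin_l 1 (e / (2 * M))). pose proof (Rmin_r 1 (e / (2 * M))).
  replace (f w * g w - (f z * g z))%C with ((f w - f z) * g w + f z * (g w - g z))%C by ring.
  assert (Hgw : Cmod (g w) <= M).
  { pose proof (Cmod_rev_triangle (g w) (g z)). unfold M; lra. }
  eapply Rle_lt_trans; [apply Cmod_triangle|]. rewrite !Cmod_mult.
  pose proof (Cmod_ge_0 (f w - f z)). pose proof (Cmod_ge_0 (g w - g z)).
  pose proof (Cmod_ge_0 (g w)).
  assert (E1 : Cmod (f w - f z) * Cmod (g w) <= Cmod (f w - f z) * M) by nra.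
  assert (E2 : Cmod (f w - f z) * M < e / (2 * M) * M) by (apply Rmult_lt_compat_r; unfold M in *; lra).
  assert (E3 : Cmod (f z) * Cmod (g w - g z) <= M * (e / (2 * M))).
  { apply Rmult_le_compat; try lra. unfold M; lra. }
  assert (E4 : e / (2 * M) * M = e / 2) by (field; unfold M; lra).
  lra.
Qed.

Lemma Ccont_inv (f : C -> C) (z : C) : Ccont f z -> f z <> 0 -> Ccont (fun w => / f w)%C z.
Proof.
  intros Hf Hz e He. pose proof (Cmod_pos _ Hz) as P. set (m := Cmod (f z)) in *.
  destruct (Hf (Rmin (m / 2) (e * (m * m) / 2))) as [d [Hd H]].
  { apply Rmin_pos; [lra|]. apply Rdiv_lt_0_compat; [|lra]. apply Rmult_lt_0_compat; nra. }
  exists d. split; auto. intros w Hw. specialize (H w Hw).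
  pose proof (Rmin_l (m / 2) (e * (m * m) / 2)). pose proof (Rmin_r (m / 2) (e * (m * m) / 2)).
  assert (Hm : m / 2 < Cmod (f w)).
  { pose proof (Cmod_rev_triangle (f z) (f w)). rewrite Cmod_minus_sym in H2. fold m in H2. lra. }
  assert (Hw0 : f w <> 0). { intro E. rewrite E, Cmod_0 in Hm. lra. }
  replace (/ f w - / f z)%C with ((f z - f w) / (f w * f z))%C by (field; auto).
  rewrite Cmod_div by (apply Cmult_neq_0; auto). rewrite Cmod_mult, Cmod_minus_sym. fold m.
  apply Rlt_div_l; [nra|].
  apply Rlt_le_trans with (e * (m * m) / 2); [lra|].
  assert (m * m / 2 <= Cmod (f w) * m) by nra. nra.
Qed.

Lemma Ccont_comp (f g : C -> C) (z : C) : Ccont g z -> Ccont f (g z) -> Ccont (fun w => f (g w)) z.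
Proof.
  intros Hg Hf e He. destruct (Hf e He) as [d1 [Hd1 H1]].
  destruct (Hg d1 Hd1) as [d2 [Hd2 H2]]. exists d2. auto.
Qed.

(** Caratheodory's form of the derivative: the slope [phi] is continuous at [z]. It reduces the sum,
    product, inverse and chain rules to ring identities between continuous slopes. *)
Lemma Cderiv_iff (f : C -> C) (z l : C) :
  Cderiv f z l <-> exists phi r, 0 < r /\ Ccont phi z /\ phi z = l /\
    forall w, Cmod (w - z) < r -> f w = (f z + phi w * (w - z))%C.
Proof.
  split.
  - intro H.
    exists (fun w => if Ceq_dec w z then l else (f w - f z) / (w - z))%C, 1.
    repeat split; try lra.
    + intros e He. destruct (H (e/2)) as [d [Hd H1]]; [lra|]. exists d. split; auto.
      intros w Hw. destruct (Ceq_dec z z) as [_|E]; [|congruence].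
      destruct (Ceq_dec w z) as [->|Hn]; [now rewrite Cmod_self|].
      specialize (H1 w Hw). pose proof (Cminus_neq_0 _ _ Hn) as Hn'.
      replace ((f w - f z) / (w - z) - l)%C with ((f w - f z - l * (w - z)) / (w - z))%C by (field; auto).
      rewrite Cmod_div by auto. apply Cmod_pos in Hn'. apply Rlt_div_l; [auto|]. nra.
    + now destruct (Ceq_dec z z).
    + intros w _. destruct (Ceq_dec w z) as [->|Hn]; [ring|].
      field. now apply Cminus_neq_0.
  - intros (phi & r & Hr & Hc & <- & H) e He.
    destruct (Hc e He) as [d [Hd H1]].
    exists (Rmin d r). split; [apply Rmin_pos; auto|]. intros w Hw.
    assert (A := H1 w ltac:(eapply Rlt_le_trans; eauto; apply Rmin_l)).
    rewrite H by (eapply Rlt_le_trans; eauto; apply Rmin_r).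
    replace (f z + phi w * (w - z) - f z - phi z * (w - z))%C with ((phi w - phi z) * (w - z))%C by ring.
    rewrite Cmod_mult. apply Rmult_le_compat_r; [apply Cmod_ge_0 | lra].
Qed.

Lemma Cderiv_Ccont (f : C -> C) (z l : C) : Cderiv f z l -> Ccont f z.
Proof.
  intro H. apply Cderiv_iff in H. destruct H as (phi & r & Hr & Hc & _ & H).
  apply Ccont_ext_loc with (r := r) (f := fun w => (f z + phi w * (w - z))%C); auto.
  - intros. symmetry; auto.
  - apply Ccont_add; [apply Ccont_const|]. apply Ccont_mul; auto.
    apply Ccont_add; [apply Ccont_id | apply Ccont_const].
Qed.

Lemma Cderiv_ext_loc (f g : C -> C) (z l : C) (r : R) : 0 < r ->
  (forall w, Cmod (w - z) < r -> f w = g w) -> Cderiv f z l -> Cderiv g z l.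
Proof.
  intros Hr H Hf e He. destruct (Hf e He) as [d [Hd H1]].
  exists (Rmin d r). split; [apply Rmin_pos; auto|]. intros w Hw.
  rewrite <- !H; [apply H1 | rewrite Cmod_self; lra |];
  eapply Rlt_le_trans; eauto; [apply Rmin_l | apply Rmin_r].
Qed.

Lemma Cderiv_eq (f : C -> C) (z l l' : C) : l = l' -> Cderiv f z l -> Cderiv f z l'.
Proof. now intros ->. Qed.

Lemma Cderiv_const (k z : C) : Cderiv (fun _ => k) z 0.
Proof.
  intros e He. exists 1. split; [lra|]. intros w _.
  replace (k - k - 0 * (w - z))%C with (RtoC 0) by ring. rewrite Cmod_0.
  pose proof (Cmod_ge_0 (w - z)). nra.
Qed.
Lemma Cderiv_id (z : C) : Cderiv (fun w => w) z 1.
Proof.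
  intros e He. exists 1. split; [lra|]. intros w _.
  replace (w - z - 1 * (w - z))%C with (RtoC 0) by ring. rewrite Cmod_0.
  pose proof (Cmod_ge_0 (w - z)). nra.
Qed.

Lemma Cderiv_add (f g : C -> C) (z l m : C) :
  Cderiv f z l -> Cderiv g z m -> Cderiv (fun w => f w + g w)%C z (l + m).
Proof.
  rewrite !Cderiv_iff. intros (p & r & Hr & Hp & <- & Ef) (q & s & Hs & Hq & <- & Eg).
  exists (fun w => p w + q w)%C, (Rmin r s). repeat split.
  - apply Rmin_pos; auto.
  - now apply Ccont_add.
  - intros w Hw. rewrite Ef, Eg; [ring | |]; eapply Rlt_le_trans; eauto; [apply Rmin_r | apply Rmin_l].
Qed.

Lemma Cderiv_mul (f g : C -> C) (z l m : C) :
  Cderiv f z l -> Cderiv g z m -> Cderiv (fun w => f w * g w)%C z (l * g z + f z * m).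
Proof.
  intros Hf Hg. pose proof (Cderiv_Ccont _ _ _ Hg) as Cg.
  revert Hf Hg.
  rewrite !Cderiv_iff. intros (p & r & Hr & Hp & <- & Ef) (q & s & Hs & Hq & <- & Eg).
  exists (fun w => p w * g w + f z * q w)%C, (Rmin r s). repeat split.
  - apply Rmin_pos; auto.
  - apply Ccont_add; apply Ccont_mul; auto. apply Ccont_const.
  - intros w Hw. rewrite Ef, Eg; [ring | |]; eapply Rlt_le_trans; eauto; [apply Rmin_r | apply Rmin_l].
Qed.

Lemma Cderiv_scal (k : C) (f : C -> C) (z l : C) :
  Cderiv f z l -> Cderiv (fun w => k * f w)%C z (k * l).
Proof.
  intro H. eapply Cderiv_eq; [| apply (Cderiv_mul _ _ z _ _ (Cderiv_const k z) H)]. ring.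
Qed.

Lemma Cderiv_sub (f g : C -> C) (z l m : C) :
  Cderiv f z l -> Cderiv g z m -> Cderiv (fun w => f w - g w)%C z (l - m).
Proof.
  intros Hf Hg. apply (Cderiv_scal (-(1))) in Hg.
  apply Cderiv_ext_loc with (r := 1) (f := fun w => (f w + -(1) * g w)%C); [lra | intros; ring |].
  eapply Cderiv_eq; [| apply (Cderiv_add _ _ z _ _ Hf Hg)]. ring.
Qed.

Lemma Cderiv_comp (f g : C -> C) (z l m : C) :
  Cderiv g z m -> Cderiv f (g z) l -> Cderiv (fun w => f (g w)) z (l * m).
Proof.
  intros Hg Hf. pose proof (Cderiv_Ccont _ _ _ Hg) as Cg.
  revert Hg Hf.
  rewrite !Cderiv_iff. intros (q & s & Hs & Hq & <- & Eg) (p & r & Hr & Hp & <- & Ef).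
  destruct (Cg r Hr) as [d [Hd H]].
  exists (fun w => p (g w) * q w)%C, (Rmin s d). repeat split.
  - apply Rmin_pos; auto.
  - apply Ccont_mul; auto. now apply (Ccont_comp p g).
  - intros w Hw. rewrite Ef by (apply H; eapply Rlt_le_trans; eauto; apply Rmin_r).
    assert (E := Eg w ltac:(eapply Rlt_le_trans; eauto; apply Rmin_l)).
    replace (g w - g z)%C with (q w * (w - z))%C by (rewrite E; ring). ring.
Qed.

Lemma Ccont_neq (f : C -> C) (z : C) : Ccont f z -> f z <> 0 ->
  exists r, 0 < r /\ forall w, Cmod (w - z) < r -> f w <> 0.
Proof.
  intros H Hz. destruct (H (Cmod (f z)) (Cmod_pos _ Hz)) as [d [Hd H1]].
  exists d. split; auto. intros w Hw E. specialize (H1 w Hw).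
  rewrite E, Cmod_minus_sym in H1. replace (f z - 0)%C with (f z) in H1 by ring. lra.
Qed.

Lemma Cderiv_inv (f : C -> C) (z l : C) :
  Cderiv f z l -> f z <> 0 -> Cderiv (fun w => / f w)%C z (- l / (f z * f z)).
Proof.
  intros Hf Hz. pose proof (Cderiv_Ccont _ _ _ Hf) as Cf.
  destruct (Ccont_neq _ _ Cf Hz) as (d & Hd & Hn).
  revert Hf. rewrite !Cderiv_iff. intros (p & r & Hr & Hp & <- & Ef).
  exists (fun w => - (1) * p w * / (f w * f z))%C, (Rmin r d). repeat split.
  - apply Rmin_pos; auto.
  - apply Ccont_mul; [apply Ccont_mul; auto; apply Ccont_const|].
    apply (Ccont_inv (fun w => f w * f z)%C); [apply Ccont_mul; auto; apply Ccont_const | now apply Cmult_neq_0].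
  - field; auto.
  - intros w Hw.
    assert (Hw0 : f w <> 0) by (apply Hn; eapply Rlt_le_trans; eauto; apply Rmin_r).
    assert (E := Ef w ltac:(eapply Rlt_le_trans; eauto; apply Rmin_l)).
    assert (E' : (p w * (w - z) = f w - f z)%C) by (rewrite E; ring).
    replace (/ f z + - (1) * p w * / (f w * f z) * (w - z))%C
      with (/ f z - / (f w * f z) * (p w * (w - z)))%C by ring.
    rewrite E'. field; auto.
Qed.

Lemma Cderiv_div (f g : C -> C) (z l m : C) :
  Cderiv f z l -> Cderiv g z m -> g z <> 0 ->
  Cderiv (fun w => f w / g w)%C z ((l * g z - f z * m) / (g z * g z)).
Proof.
  intros Hf Hg Hz. eapply Cderiv_eq; [|apply (Cderiv_mul _ _ z _ _ Hf (Cderiv_inv _ _ _ Hg Hz))].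
  field; auto.
Qed.

Lemma Cderiv_pow (f : C -> C) (z l : C) (k : nat) :
  Cderiv f z l -> Cderiv (fun w => f w ^ k)%C z (INR k * f z ^ (k - 1) * l).
Proof.
  intro H. induction k as [|k IH].
  - eapply Cderiv_eq; [|apply (Cderiv_const 1)]. simpl. ring.
  - eapply Cderiv_eq; [|apply (Cderiv_mul _ _ z _ _ H IH)].
    rewrite S_INR, RtoC_plus. destruct k as [|k]; [simpl; ring|].
    replace (S (S k) - 1)%nat with (S k) by lia. replace (S k - 1)%nat with k by lia.
    simpl Complex.Cpow. ring.
Qed.

Lemma Cderiv_unique (f : C -> C) (z l m : C) : Cderiv f z l -> Cderiv f z m -> l = m.
Proof.
  intros H1 H2. destruct (Ceq_dec l m) as [|Hn]; auto. exfalso.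
  apply Cminus_neq_0, Cmod_pos in Hn. set (e := Cmod (l - m)) in *.
  destruct (H1 (e/4)) as [d1 [P1 D1]]; [lra|]. destruct (H2 (e/4)) as [d2 [P2 D2]]; [lra|].
  set (h := Rmin d1 d2 / 2). assert (Hh : 0 < h) by (pose proof (Rmin_pos _ _ P1 P2); unfold h; lra).
  pose proof (Rmin_l d1 d2). pose proof (Rmin_r d1 d2).
  assert (Hm : Cmod (z + h - z) = h).
  { replace (z + h - z)%C with (RtoC h) by ring. rewrite Cmod_R, Rabs_pos_eq; lra. }
  specialize (D1 (z + h)%C). specialize (D2 (z + h)%C). rewrite Hm in D1, D2.
  assert (A := D1 ltac:(unfold h; lra)). assert (B := D2 ltac:(unfold h; lra)).
  pose proof (Cmod_triangle_sub (f (z + h)%C - f z - m * (z + h - z)) 0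
     (f (z + h)%C - f z - l * (z + h - z))) as T.
  replace (f (z + h)%C - f z - m * (z + h - z) - (f (z + h)%C - f z - l * (z + h - z)))%C
    with ((l - m) * h)%C in T by ring.
  rewrite Cmod_mult, Cmod_R, (Rabs_pos_eq h) in T by lra. fold e in T.
  replace (0 - (f (z + h)%C - f z - l * (z + h - z)))%C
    with (-(f (z + h)%C - f z - l * (z + h - z)))%C in T by ring.
  replace (f (z + h)%C - f z - m * (z + h - z) - 0)%C
    with (f (z + h)%C - f z - m * (z + h - z))%C in T by ring.
  rewrite Cmod_opp in T. nra.
Qed.

(** * The complex exponential *)

Definition Cexp (z : C) : C := (exp (fst z) * cos (snd z), exp (fst z) * sin (snd z)).

Lemma Cexp_add (z w : C) : Cexp (z + w) = (Cexp z * Cexp w)%C.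
Proof.
  unfold Cexp, Cmult; simpl. rewrite exp_plus, cos_plus, sin_plus. f_equal; ring.
Qed.
Lemma Cexp_0 : Cexp 0 = 1.
Proof. unfold Cexp; simpl. rewrite exp_0, cos_0, sin_0. unfold RtoC. f_equal; ring. Qed.
Lemma Cmod_Cexp (z : C) : Cmod (Cexp z) = exp (fst z).
Proof.
  rewrite Cmod_eq. unfold Cexp; simpl fst; simpl snd.
  replace ((exp (fst z) * cos (snd z)) ^ 2 + (exp (fst z) * sin (snd z)) ^ 2)
    with (exp (fst z) ^ 2 * ((sin (snd z))^2 + (cos (snd z))^2)) by ring.
  pose proof (sin2_cos2 (snd z)) as H. unfold Rsqr in H.
  replace ((sin (snd z))^2 + (cos (snd z))^2) with 1 by lra.
  rewrite Rmult_1_r, sqrt_pow2; auto. left; apply exp_pos.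
Qed.
Lemma Cexp_neq_0 (z : C) : Cexp z <> 0.
Proof. intro E. pose proof (Cmod_Cexp z) as H. rewrite E, Cmod_0 in H. pose proof (exp_pos (fst z)). lra. Qed.
Lemma Cexp_opp (z : C) : Cexp (- z) = (/ Cexp z)%C.
Proof.
  assert (H : (Cexp (- z) * Cexp z = 1)%C).
  { rewrite <- Cexp_add. replace (- z + z)%C with (RtoC 0) by ring. apply Cexp_0. }
  pose proof (Cexp_neq_0 z). replace (Cexp (-z)) with (Cexp (-z) * Cexp z / Cexp z)%C by (field; auto).
  rewrite H. field; auto.
Qed.
Lemma Cexp_nat (z : C) (k : nat) : Cexp (INR k * z) = (Cexp z ^ k)%C.
Proof.
  induction k as [|k IH].
  - simpl. rewrite <- Cexp_0. f_equal. ring.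
  - rewrite S_INR, RtoC_plus. replace ((INR k + 1) * z)%C with (z + INR k * z)%C by ring.
    rewrite Cexp_add, IH. reflexivity.
Qed.

Lemma derivable_pt_lim_abs_le (f : R -> R) (l : R) : derivable_pt_lim f 0 l ->
  forall eps, 0 < eps -> exists d, 0 < d /\ forall x, Rabs x < d -> Rabs (f x - f 0 - l * x) <= eps * Rabs x.
Proof.
  intros H e He. destruct (H e He) as [d Hd]. exists d. split; [apply cond_pos|].
  intros x Hx. destruct (Req_dec x 0) as [->|Hn].
  { replace (f 0 - f 0 - l * 0) with 0 by ring. rewrite Rabs_R0. lra. }
  specialize (Hd x Hn Hx). rewrite Rplus_0_l in Hd.
  replace (f x - f 0 - l * x) with (((f x - f 0) / x - l) * x) by (field; auto).
  rewrite Rabs_mult. apply Rmult_le_compat_r; [apply Rabs_pos | lra].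
Qed.

Lemma Cderiv_Cexp_0 : Cderiv Cexp 0 1.
Proof.
  intros e He.
  pose proof (derivable_pt_lim_exp 0) as He0. rewrite exp_0 in He0.
  pose proof (derivable_pt_lim_sin 0) as Hs0. rewrite cos_0 in Hs0.
  pose proof (derivable_pt_lim_cos 0) as Hc0. rewrite sin_0 in Hc0.
  (* The terms estimated below add up to at most [7 * q * m], three from the real part and four from
     the imaginary part. The bound [q <= 1] controls the factors [|1 + x|] and [|sin y|]. *)
  set (q := Rmin (e / 8) 1). assert (Hq : 0 < q) by (apply Rmin_pos; lra).
  assert (Q1 := Rmin_l (e/8) 1). assert (Q2 := Rmin_r (e/8) 1). fold q in Q1, Q2. clearbody q.
  destruct (derivable_pt_lim_abs_le _ _ He0 q Hq) as [d1 [P1 D1]].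
  destruct (derivable_pt_lim_abs_le _ _ Hs0 q Hq) as [d2 [P2 D2]].
  destruct (derivable_pt_lim_abs_le _ _ Hc0 q Hq) as [d3 [P3 D3]].
  exists (Rmin (Rmin d1 d2) (Rmin d3 q)).
  split; [repeat apply Rmin_pos; auto|]. intros [x y] Hw.
  replace ((x, y) - 0)%C with (x, y) in * by (unfold Cminus, Cplus, Copp; simpl; f_equal; ring).
  pose proof (Rabs_fst_le (x,y)) as Hx. pose proof (Rabs_snd_le (x,y)) as Hy. simpl in Hx, Hy.
  set (m := Cmod (x, y)) in *.
  assert (B : m < d1 /\ m < d2 /\ m < d3 /\ m < q).
  { pose proof (Rmin_l (Rmin d1 d2) (Rmin d3 q)). pose proof (Rmin_r (Rmin d1 d2) (Rmin d3 q)).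
    pose proof (Rmin_l d1 d2). pose proof (Rmin_r d1 d2). pose proof (Rmin_l d3 q). pose proof (Rmin_r d3 q).
    repeat split; lra. }
  destruct B as (B1 & B2 & B3 & B4).
  assert (D1x := D1 x ltac:(lra)). assert (D2y := D2 y ltac:(lra)). assert (D3y := D3 y ltac:(lra)). clear D1 D2 D3. rename D1x into D1, D2y into D2, D3y into D3.
  rewrite exp_0 in D1. rewrite sin_0 in D2. rewrite cos_0 in D3.
  apply Rle_trans with (1 := Cmod_le_sum _).
  rewrite Cexp_0. unfold Cexp, Cmult, Cminus, Cplus, Copp, RtoC; simpl.
  replace (exp x * cos y + - (1) + - (1 * x - 0 * y)) with
    ((exp x - 1 - 1 * x) * cos y + (1 + x) * (cos y - 1 - -0 * y)) by ring.
  replace (exp x * sin y + - 0 + - (1 * y + 0 * x)) with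
    ((exp x - 1 - 1 * x) * sin y + x * sin y + (sin y - 0 - 1 * y)) by ring.
  assert (Cb : Rabs (cos y) <= 1) by (apply Rabs_le; apply COS_bound).
  assert (Sb : Rabs (sin y) <= 1) by (apply Rabs_le; apply SIN_bound).
  assert (Sb2 : Rabs (sin y) <= 2 * Rabs y).
  { replace (sin y) with ((sin y - 0 - 1 * y) + y) by ring.
    eapply Rle_trans; [apply Rabs_triang|]. pose proof (Rabs_pos y). nra. }
  assert (A1 := Rabs_triang ((exp x - 1 - 1 * x) * cos y) ((1 + x) * (cos y - 1 - -0 * y))).
  assert (A2 := Rabs_triang ((exp x - 1 - 1 * x) * sin y + x * sin y) (sin y - 0 - 1 * y)).
  assert (A3 := Rabs_triang ((exp x - 1 - 1 * x) * sin y) (x * sin y)).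
  assert (A4 := Rabs_triang 1 x). rewrite Rabs_R1 in A4.
  rewrite !Rabs_mult in *.
  pose proof (Rabs_pos x). pose proof (Rabs_pos y).
  pose proof (Rabs_pos (exp x - 1 - 1 * x)). pose proof (Rabs_pos (cos y - 1 - -0 * y)).
  pose proof (Rabs_pos (cos y)). pose proof (Rabs_pos (sin y)). pose proof (Rabs_pos (1+x)).
  assert (U : q * Rabs x <= q * m) by nra. assert (V : q * Rabs y <= q * m) by nra.
  assert (T1 : Rabs (exp x - 1 - 1 * x) * Rabs (cos y) <= q * m) by nra.
  assert (T2 : Rabs (1 + x) * Rabs (cos y - 1 - -0 * y) <= 2 * (q * m)) by nra.
  assert (T3 : Rabs (exp x - 1 - 1 * x) * Rabs (sin y) <= q * m) by nra.
  assert (T4 : Rabs x * Rabs (sin y) <= 2 * (q * m)) by nra.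
  assert (0 <= m) by lra.
  assert (q * m <= e / 8 * m) by nra. lra.
Qed.

Lemma Cderiv_Cexp (z : C) : Cderiv Cexp z (Cexp z).
Proof.
  apply Cderiv_ext_loc with (r := 1) (f := fun w => (Cexp z * Cexp (w - z))%C); [lra| |].
  { intros w _. rewrite <- Cexp_add. f_equal. ring. }
  eapply Cderiv_eq; [| apply Cderiv_scal, (Cderiv_comp Cexp (fun w => w - z)%C z 1 1)].
  - ring.
  - eapply Cderiv_eq; [| apply Cderiv_sub; [apply Cderiv_id | apply Cderiv_const]]. ring.
  - replace (z - z)%C with (RtoC 0) by ring. apply Cderiv_Cexp_0.
Qed.

Lemma polar (z : C) : z <> 0 -> exists c, Cexp c = z.
Proof.
  intro Hz. pose proof (Cmod_pos _ Hz) as P. set (m := Cmod z) in *.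
  pose proof (Cmod_sqr z) as E. fold m in E. destruct z as [x y]; simpl in E.
  assert (Hb : -1 <= x / m <= 1).
  { pose proof (Rabs_fst_le (x,y)) as H. simpl in H. fold m in H.
    assert (-m <= x <= m) by (apply Rabs_le_between; exact H).
    split; [apply Rle_div_r | apply Rle_div_l]; lra. }
  assert (Hs : sin (acos (x / m)) = Rabs y / m).
  { rewrite sin_acos by auto. unfold Rsqr.
    replace (1 - x / m * (x / m)) with ((Rabs y / m) ^ 2).
    { apply sqrt_pow2. apply Rdiv_le_0_compat; [apply Rabs_pos | auto]. }
    unfold Rdiv at 1. rewrite Rpow_mult_distr, pow2_abs.
    replace (y ^ 2) with (m ^ 2 - x ^ 2) by lra. field. lra. }
  destruct (Rle_dec 0 y) as [Hy|Hy].
  - exists (ln m, acos (x / m)). unfold Cexp; simpl. rewrite exp_ln, cos_acos, Hs by auto.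
    rewrite Rabs_pos_eq by auto. f_equal; field; lra.
  - exists (ln m, - acos (x / m)). unfold Cexp; simpl. rewrite exp_ln, cos_neg, sin_neg, cos_acos, Hs by auto.
    rewrite Rabs_left by lra. f_equal; field; lra.
Qed.

(** * Goursat's theorem on rectangles *)

(** The left ends increase while the right ends [x n + a * (1/2) ^ n] decrease, so the supremum of
    the left ends lies in all the intervals. *)
Lemma nested_sup (x : nat -> R) (a : R) : 0 <= a ->
  (forall n, x n <= x (S n) <= x n + a * (1/2) ^ (S n)) ->
  exists u, forall n, x n <= u <= x n + a * (1/2) ^ n.
Proof.
  intros Ha H.
  assert (Hpow : forall n, 0 < (1/2) ^ n) by (intro; apply pow_lt; lra).
  assert (Hup : forall n k, x n <= x (n + k)%nat /\
     x (n + k)%nat + a * (1/2) ^ (n + k) <= x n + a * (1/2) ^ n).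
  { intros n k. induction k as [|k [IH1 IH2]].
    - rewrite Nat.add_0_r. lra.
    - rewrite Nat.add_succ_r. destruct (H (n + k)%nat) as [A B]. split; [lra|].
      simpl pow in *. lra. }
  assert (Hle : forall n m, x m <= x n + a * (1/2) ^ n).
  { intros n m. destruct (Nat.le_gt_cases n m) as [L|L].
    - destruct (Hup n (m - n)%nat) as [_ B]. replace (n + (m - n))%nat with m in B by lia.
      pose proof (Hpow m). nra.
    - destruct (Hup m (n - m)%nat) as [A _]. replace (m + (n - m))%nat with n in A by lia.
      pose proof (Hpow n). nra. }
  destruct (completeness (fun r => exists m, r = x m)) as [u [U1 U2]].
  - exists (x 0%nat + a * (1/2)^0). intros r [m ->]. apply Hle.
  - exists (x 0%nat), 0%nat. reflexivity.
  - exists u. intro n. split.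
    + apply U1. now exists n.
    + apply U2. intros r [m ->]. apply Hle.
Qed.

(** A compactness principle by bisection, where [P x y t] speaks of the rectangle with lower left
    corner [(x, y)] and sides [a * t], [b * t]. Goursat's theorem, the existence of maxima, uniform
    continuity and the finiteness of zeros are all instances. *)
Lemma Cousin (a b x0 y0 : R) (P : R -> R -> R -> Prop) :
  0 <= a -> 0 <= b ->
  (forall x y t, 0 < t -> P x y (t/2) -> P (x + a * (t/2)) y (t/2) ->
     P x (y + b * (t/2)) (t/2) -> P (x + a * (t/2)) (y + b * (t/2)) (t/2) -> P x y t) ->
  (forall u v, x0 <= u <= x0 + a -> y0 <= v <= y0 + b ->
     exists d, 0 < d /\ forall x y t, 0 < t < d ->
       x <= u <= x + a * t -> y <= v <= y + b * t -> P x y t) ->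
  P x0 y0 1.
Proof.
  intros Ha Hb H1 H2. destruct (classic (P x0 y0 1)) as [|Hbad]; auto. exfalso.
  (* One moves to a quarter on which [P] fails. If it holds on three quarters, it must fail on the
     fourth, which is therefore taken without a test. *)
  set (step := fun (n : nat) (p : R * R) => let h := (1/2) ^ (S n) in let (x, y) := p in
    if excluded_middle_informative (P x y h) then
    if excluded_middle_informative (P (x + a * h) y h) then
    if excluded_middle_informative (P x (y + b * h) h) then (x + a * h, y + b * h)
    else (x, y + b * h) else (x + a * h, y) else (x, y)).
  set (s := fix s n := match n with O => (x0, y0) | S k => step k (s k) end).
  assert (Hpow : forall n, 0 < (1/2) ^ n) by (intro; apply pow_lt; lra).
  assert (Hstep : forall n, fst (s n) <= fst (s (S n)) <= fst (s n) + a * (1/2) ^ (S n) /\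
            snd (s n) <= snd (s (S n)) <= snd (s n) + b * (1/2) ^ (S n)).
  { intro n. change (s (S n)) with (step n (s n)). destruct (s n) as [x y].
    pose proof (Hpow (S n)) as Hh. unfold step. set (h := (1/2) ^ (S n)) in *.
    assert (0 <= a * h) by nra. assert (0 <= b * h) by nra.
    repeat destruct (excluded_middle_informative _); simpl; lra. }
  assert (Hnot : forall n, ~ P (fst (s n)) (snd (s n)) ((1/2) ^ n)).
  { induction n as [|n IH]; [exact Hbad|]. intro HP. apply IH. clear IH.
    revert HP. change (s (S n)) with (step n (s n)). destruct (s n) as [x y]. simpl fst; simpl snd.
    unfold step. set (h := (1/2) ^ (S n)) in *. 
    assert (Eh : (1/2) ^ n / 2 = h) by (unfold h; simpl; lra).
    intro HP. apply H1; [apply Hpow | ..]; rewrite Eh;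
    repeat destruct (excluded_middle_informative _); simpl in HP; tauto. }
  destruct (nested_sup (fun n => fst (s n)) a Ha) as [u Hu]; [intro n; apply (Hstep n)|].
  destruct (nested_sup (fun n => snd (s n)) b Hb) as [v Hv]; [intro n; apply (Hstep n)|].
  destruct (H2 u v) as [d [Hd HP]].
  - specialize (Hu 0%nat). simpl in Hu. lra.
  - specialize (Hv 0%nat). simpl in Hv. lra.
  - destruct (pow_lt_1_zero (1/2)) with (y := d) as [N HN]; auto.
    { rewrite Rabs_pos_eq; lra. }
    specialize (HN N (Nat.le_refl N)). rewrite Rabs_pos_eq in HN by (left; apply Hpow).
    apply (Hnot N). apply HP; auto.
Qed.

(** The real part of the integral of [f dz] around the rectangle, counterclockwise. The imaginary
    part is reached by applying results on the real part to a multiple of [f] by [Ci]. *)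
Definition rect_int (f : C -> C) (x y w h : R) : R :=
  RInt (fun s => fst (f (s, y))) x (x + w) - RInt (fun s => fst (f (s, y + h))) x (x + w)
  - (RInt (fun s => snd (f (x + w, s))) y (y + h) - RInt (fun s => snd (f (x, s))) y (y + h)).

Definition curve_cont (c : R -> C) (t : R) : Prop :=
  continuous (fun s => fst (c s)) t /\ continuous (fun s => snd (c s)) t.

Lemma curve_cont_iff (c : R -> C) (t : R) : curve_cont c t <->
  forall e, 0 < e -> exists d, 0 < d /\ forall s, Rabs (s - t) < d -> Cmod (c s - c t) < e.
Proof.
  split.
  - intros [H1 H2] e He.
    assert (He2 : 0 < e / 2) by lra.
    apply filterlim_locally with (eps := mkposreal _ He2) in H1.
    apply filterlim_locally with (eps := mkposreal _ He2) in H2.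
    destruct H1 as [d1 H1]. destruct H2 as [d2 H2].
    exists (Rmin d1 d2). split; [apply Rmin_pos; apply cond_pos|]. intros s Hs.
    eapply Rle_lt_trans; [apply Cmod_le_sum|].
    assert (A := H1 s ltac:(eapply Rlt_le_trans; [exact Hs | apply Rmin_l])).
    assert (B := H2 s ltac:(eapply Rlt_le_trans; [exact Hs | apply Rmin_r])).
    unfold ball in A, B; simpl in A, B; unfold AbsRing_ball, abs, minus, plus, opp in A, B; simpl in A, B.
    simpl. lra.
  - intro H. split; apply filterlim_locally; intro e; destruct (H e (cond_pos e)) as [d [Hd H1]];
      exists (mkposreal d Hd); intros s Hs; specialize (H1 s Hs);
      unfold ball; simpl; unfold AbsRing_ball, abs, minus, plus, opp; simpl;
      eapply Rle_lt_trans; try exact H1.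
    + apply (Rabs_fst_le (c s - c t)).
    + apply (Rabs_snd_le (c s - c t)).
Qed.

Lemma curve_cont_comp (f : C -> C) (c : R -> C) (t : R) :
  curve_cont c t -> Ccont f (c t) -> curve_cont (fun s => f (c s)) t.
Proof.
  rewrite !curve_cont_iff. intros Hc Hf e He. destruct (Hf e He) as [d1 [Hd1 H1]].
  destruct (Hc d1 Hd1) as [d2 [Hd2 H2]]. exists d2. auto.
Qed.

Lemma ex_RInt_seg_h (f : C -> C) (a b y : R) : a <= b ->
  (forall s, a <= s <= b -> Ccont f (s, y)) ->
  ex_RInt (fun s => fst (f (s, y))) a b /\ ex_RInt (fun s => snd (f (s, y))) a b.
Proof.
  intros Hab H.
  assert (G : forall s, a <= s <= b -> continuous (fun s => fst (f (s, y))) s /\ continuous (fun s => snd (f (s, y))) s).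
  { intros s Hs. apply (curve_cont_comp f (fun s => (s, y)) s); [|auto].
    split; simpl; [apply continuous_id | apply continuous_const]. }
  split; apply (@ex_RInt_continuous R_CompleteNormedModule); intros s; rewrite Rmin_left, Rmax_right by auto; apply G.
Qed.
Lemma ex_RInt_seg_v (f : C -> C) (a b x : R) : a <= b ->
  (forall s, a <= s <= b -> Ccont f (x, s)) ->
  ex_RInt (fun s => fst (f (x, s))) a b /\ ex_RInt (fun s => snd (f (x, s))) a b.
Proof.
  intros Hab H.
  assert (G : forall s, a <= s <= b -> continuous (fun s => fst (f (x, s))) s /\ continuous (fun s => snd (f (x, s))) s).
  { intros s Hs. apply (curve_cont_comp f (fun s => (x, s)) s); [|auto].
    split; simpl; [apply continuous_const | apply continuous_id]. }
  split; apply (@ex_RInt_continuous R_CompleteNormedModule); intros s; rewrite Rmin_left, Rmax_right by auto; apply G.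
Qed.

Lemma rect_int_split (f : C -> C) (x y w h : R) : 0 <= w -> 0 <= h ->
  (forall u v, x <= u <= x + 2 * w -> y <= v <= y + 2 * h -> Ccont f (u, v)) ->
  rect_int f x y (2 * w) (2 * h) = rect_int f x y w h + rect_int f (x + w) y w h
    + rect_int f x (y + h) w h + rect_int f (x + w) (y + h) w h.
Proof.
  intros Hw Hh H. unfold rect_int.
  replace (x + w + w) with (x + 2 * w) by ring. replace (y + h + h) with (y + 2 * h) by ring.
  assert (CH : forall v, y <= v <= y + 2 * h ->
    RInt (fun s => fst (f (s, v))) x (x + w) + RInt (fun s => fst (f (s, v))) (x + w) (x + 2 * w)
    = RInt (fun s => fst (f (s, v))) x (x + 2 * w)).
  { intros v Hv. apply (@RInt_Chasles R_CompleteNormedModule (fun s => fst (f (s, v)))); refine (proj1 (ex_RInt_seg_h f _ _ v _ _)); try lra; intros; apply H; lra. }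
  assert (CV : forall u, x <= u <= x + 2 * w ->
    RInt (fun s => snd (f (u, s))) y (y + h) + RInt (fun s => snd (f (u, s))) (y + h) (y + 2 * h)
    = RInt (fun s => snd (f (u, s))) y (y + 2 * h)).
  { intros v Hv. apply (@RInt_Chasles R_CompleteNormedModule (fun s => snd (f (v, s)))); refine (proj2 (ex_RInt_seg_v f _ _ v _ _)); try lra; intros; apply H; lra. }
  rewrite <- (CH y), <- (CH (y + 2 * h)), <- (CV x), <- (CV (x + 2 * w)) by lra. ring.
Qed.

(** The affine part [f z + l * (. - z)] integrates to zero: between opposite sides it differs by the
    constants [be * h] and [be * w], whose integrals over the lengths [w] and [h] cancel. What
    remains is at most [2 * e] on each pair of sides. *)
Lemma rect_int_small (f : C -> C) (x y w h : R) (z l : C) (e : R) : 0 <= w -> 0 <= h -> 0 <= e ->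
  (forall u v, x <= u <= x + w -> y <= v <= y + h -> Ccont f (u, v)) ->
  (forall u v, x <= u <= x + w -> y <= v <= y + h ->
    Cmod (f (u, v) - f z - l * ((u, v) - z)) <= e) ->
  Rabs (rect_int f x y w h) <= 2 * e * (w + h).
Proof.
  intros Hw Hh He Hc Hb. unfold rect_int.
  destruct l as [al be]. destruct z as [zx zy].
  set (U := fun s => fst (f (s, y)) - fst (f (s, y + h)) - be * h).
  set (V := fun s => snd (f (x + w, s)) - snd (f (x, s)) - be * w).
  assert (I1 : ex_RInt (fun s => fst (f (s, y))) x (x + w)) by (refine (proj1 (ex_RInt_seg_h f _ _ _ _ _)); [lra | intros; apply Hc; lra]).
  assert (I2 : ex_RInt (fun s => fst (f (s, y + h))) x (x + w)) by (refine (proj1 (ex_RInt_seg_h f _ _ _ _ _)); [lra | intros; apply Hc; lra]).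
  assert (I3 : ex_RInt (fun s => snd (f (x + w, s))) y (y + h)) by (refine (proj2 (ex_RInt_seg_v f _ _ _ _ _)); [lra | intros; apply Hc; lra]).
  assert (I4 : ex_RInt (fun s => snd (f (x, s))) y (y + h)) by (refine (proj2 (ex_RInt_seg_v f _ _ _ _ _)); [lra | intros; apply Hc; lra]).
  assert (IU : is_RInt U x (x + w) (RInt (fun s => fst (f (s, y))) x (x + w) - RInt (fun s => fst (f (s, y + h))) x (x + w) - w * (be * h))).
  { apply (is_RInt_minus (fun s => fst (f (s, y)) - fst (f (s, y + h))) (fun _ => be * h)).
    - apply (is_RInt_minus (fun s => fst (f (s, y))) (fun s => fst (f (s, y + h)))); apply (RInt_correct (V := R_CompleteNormedModule)); auto.
    - replace (w * (be * h)) with (scal (x + w - x) (be * h)) by (unfold scal; simpl; unfold mult; simpl; ring).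
      apply (@is_RInt_const R_NormedModule). }
  assert (IV : is_RInt V y (y + h) (RInt (fun s => snd (f (x + w, s))) y (y + h) - RInt (fun s => snd (f (x, s))) y (y + h) - h * (be * w))).
  { apply (is_RInt_minus (fun s => snd (f (x + w, s)) - snd (f (x, s))) (fun _ => be * w)).
    - apply (is_RInt_minus (fun s => snd (f (x + w, s))) (fun s => snd (f (x, s)))); apply (RInt_correct (V := R_CompleteNormedModule)); auto.
    - replace (h * (be * w)) with (scal (y + h - y) (be * w)) by (unfold scal; simpl; unfold mult; simpl; ring).
      apply (@is_RInt_const R_NormedModule). }
  assert (BU : Rabs (RInt U x (x + w)) <= (x + w - x) * (2 * e)).
  { apply abs_RInt_le_const; [lra | now eexists; apply IU |]. intros t Ht. unfold U.
    assert (B1 := Hb t y ltac:(lra) ltac:(lra)). assert (B2 := Hb t (y + h) ltac:(lra) ltac:(lra)).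
    apply Rle_trans with (1 := Rabs_fst_le _) in B1. apply Rle_trans with (1 := Rabs_fst_le _) in B2.
    simpl in B1, B2. apply Rabs_le. apply Rabs_le_between in B1. apply Rabs_le_between in B2. lra. }
  assert (BV : Rabs (RInt V y (y + h)) <= (y + h - y) * (2 * e)).
  { apply abs_RInt_le_const; [lra | now eexists; apply IV |]. intros t Ht. unfold V.
    assert (B1 := Hb x t ltac:(lra) ltac:(lra)). assert (B2 := Hb (x + w) t ltac:(lra) ltac:(lra)).
    apply Rle_trans with (1 := Rabs_snd_le _) in B1. apply Rle_trans with (1 := Rabs_snd_le _) in B2.
    simpl in B1, B2. apply Rabs_le. apply Rabs_le_between in B1. apply Rabs_le_between in B2. lra. }
  apply (@is_RInt_unique R_CompleteNormedModule) in IU. apply (@is_RInt_unique R_CompleteNormedModule) in IV. rewrite IU in BU. rewrite IV in BV.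
  apply Rabs_le. apply Rabs_le_between in BU. apply Rabs_le_between in BV. lra.
Qed.

(** The bound [e * t ^ 2] scales like the area, so it is stable under quartering. On small
    rectangles around a point of differentiability it holds because the perimeter and the deviation
    from the affine part both scale with [t]. *)
Lemma Goursat (f : C -> C) (x0 y0 a b : R) : 0 <= a -> 0 <= b ->
  (forall u v, x0 <= u <= x0 + a -> y0 <= v <= y0 + b -> exists l, Cderiv f (u, v) l) ->
  rect_int f x0 y0 a b = 0.
Proof.
  intros Ha Hb H.
  assert (Hc : forall u v, x0 <= u <= x0 + a -> y0 <= v <= y0 + b -> Ccont f (u, v)).
  { intros u v Hu Hv. destruct (H u v Hu Hv) as [l Hl]. now apply Cderiv_Ccont in Hl. }
  assert (Hs : forall e, 0 < e -> Rabs (rect_int f x0 y0 a b) <= e).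
  { intros e He.
    set (q := e / (2 * (a + b + 1) * (a + b + 1))).
    assert (Hq : 0 < q) by (apply Rdiv_lt_0_compat; nra).
    pose (P := fun x y t => x0 <= x -> x + a * t <= x0 + a -> y0 <= y -> y + b * t <= y0 + b ->
       Rabs (rect_int f x y (a * t) (b * t)) <= e * t ^ 2).
    assert (HP : P x0 y0 1).
    { apply (Cousin a b); auto.
      - intros x y t Ht P1 P2 P3 P4 Q1 Q2 Q3 Q4. 
        assert (0 <= a * t) by nra. assert (0 <= b * t) by nra.
        replace (a * t) with (2 * (a * (t/2))) by field. replace (b * t) with (2 * (b * (t/2))) by field.
        rewrite rect_int_split; try nra; [| intros; apply Hc; nra].
        specialize (P1 ltac:(lra) ltac:(lra) ltac:(lra) ltac:(lra)).
        specialize (P2 ltac:(lra) ltac:(lra) ltac:(lra) ltac:(lra)).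
        specialize (P3 ltac:(lra) ltac:(lra) ltac:(lra) ltac:(lra)).
        specialize (P4 ltac:(lra) ltac:(lra) ltac:(lra) ltac:(lra)).
        apply Rabs_le. apply Rabs_le_between in P1. apply Rabs_le_between in P2.
        apply Rabs_le_between in P3. apply Rabs_le_between in P4. simpl in *. lra.
      - intros u v Hu Hv. destruct (H u v Hu Hv) as [l Hl]. destruct (Hl q Hq) as [d [Hd Hf]].
        exists (d / (a + b + 1)). split; [apply Rdiv_lt_0_compat; lra|].
        intros x y t [Ht Htd] Hx Hy Q1 Q2 Q3 Q4.
        assert (Htd' : t * (a + b + 1) < d) by (apply Rlt_div_r; lra).
        assert (0 <= a * t) by nra. assert (0 <= b * t) by nra.
        assert (Hsm : forall p r, x <= p <= x + a * t -> y <= r <= y + b * t ->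
           Cmod ((p, r) - (u, v)) <= (a + b) * t).
        { intros p r Hp Hr. eapply Rle_trans; [apply Cmod_le_sum|]. simpl.
          assert (Rabs (p + - u) <= a * t) by (apply Rabs_le; lra).
          assert (Rabs (r + - v) <= b * t) by (apply Rabs_le; lra). lra. }
        apply Rle_trans with (2 * (q * ((a + b) * t)) * (a * t + b * t)).
        + apply rect_int_small with (z := (u, v)) (l := l); auto.
          * apply Rmult_le_pos; nra.
          * intros; apply Hc; lra.
          * intros p r Hp Hr. specialize (Hsm p r Hp Hr).
            eapply Rle_trans; [apply Hf; nra|]. apply Rmult_le_compat_l; lra.
        + replace (2 * (q * ((a + b) * t)) * (a * t + b * t)) with (q * (2 * (a + b) * (a + b)) * t ^ 2) by ring.
          apply Rmult_le_compat_r; [nra|]. unfold q. 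
          replace (e / (2 * (a + b + 1) * (a + b + 1)) * (2 * (a + b) * (a + b)))
            with (e * ((a + b) * (a + b) / ((a + b + 1) * (a + b + 1)))) by (field; lra).
          rewrite <- (Rmult_1_r e) at 2. apply Rmult_le_compat_l; [lra|].
          apply Rle_div_l; nra. }
    specialize (HP ltac:(lra) ltac:(lra) ltac:(lra) ltac:(lra)).
    rewrite !Rmult_1_r in HP. simpl in HP. lra. }
  apply Rabs_eq_0. pose proof (Rabs_pos (rect_int f x0 y0 a b)).
  apply Rle_antisym; [|auto]. apply le_epsilon; intros; rewrite Rplus_0_l; auto.
Qed.

(** * Mean values and the maximum principle *)

Definition circ (a : C) (r t : R) : C := (a + r * (cos t, sin t))%C.

Lemma circ_minus (a : C) (r t : R) : (circ a r t - a)%C = (r * (cos t, sin t))%C.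
Proof. unfold circ. ring. Qed.

Lemma Cmod_cis (t : R) : Cmod (cos t, sin t) = 1.
Proof.
  rewrite <- (Rmult_1_l (cos t)), <- (Rmult_1_l (sin t)), <- exp_0.
  change (Cmod (Cexp (0, t)) = exp 0). apply Cmod_Cexp.
Qed.

Lemma Cmod_circ (a : C) (r t : R) : 0 <= r -> Cmod (circ a r t - a) = r.
Proof. intro Hr. rewrite circ_minus, Cmod_mult, Cmod_cis, Cmod_R, Rabs_pos_eq; lra. Qed.

Lemma circ_exp (a : C) (s t : R) : circ a (exp s) t = (a + Cexp (s, t))%C.
Proof. unfold circ, Cexp, Cplus, Cmult, RtoC; simpl. f_equal; ring. Qed.

Lemma curve_cont_circ (a : C) (r t : R) : curve_cont (circ a r) t.
Proof.
  unfold circ, Cplus, Cmult; split; simpl;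
    (apply (@ex_derive_continuous R_AbsRing R_NormedModule)); auto_derive; auto.
Qed.

Lemma ex_RInt_circ (f : C -> C) (a : C) (r : R) : 0 <= r ->
  (forall w, Cmod (w - a) = r -> Ccont f w) ->
  ex_RInt (fun t => fst (f (circ a r t))) 0 (2 * PI) /\
  ex_RInt (fun t => snd (f (circ a r t))) 0 (2 * PI).
Proof.
  intros Hr H.
  assert (G : forall t, curve_cont (fun t => f (circ a r t)) t).
  { intro t. apply curve_cont_comp; [apply curve_cont_circ | apply H; now apply Cmod_circ]. }
  split; apply (@ex_RInt_continuous R_CompleteNormedModule); intros t _; apply G.
Qed.

(** The rectangle has sides [[s0, s1]] and [[0, 2 * PI]]. By periodicity of [Cexp] its horizontal
    sides cancel, so Goursat's theorem equates the integrals over the vertical ones. *)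
Lemma circ_mean_const (f : C -> C) (a : C) (R0 s0 s1 : R) : s0 <= s1 -> exp s1 < R0 ->
  (forall w, 0 < Cmod (w - a) < R0 -> exists l, Cderiv f w l) ->
  RInt (fun t => snd (f (circ a (exp s1) t))) 0 (2 * PI) =
  RInt (fun t => snd (f (circ a (exp s0) t))) 0 (2 * PI).
Proof.
  intros Hs H1 H.
  set (g := fun z => f (a + Cexp z)%C).
  assert (HPI := PI_RGT_0).
  assert (G : rect_int g s0 0 (s1 - s0) (2 * PI) = 0).
  { apply Goursat; try lra. intros u v Hu Hv.
    destruct (H (a + Cexp (u, v))%C) as [l Hl].
    - replace (a + Cexp (u, v) - a)%C with (Cexp (u, v)) by ring. rewrite Cmod_Cexp. simpl.
      split; [apply exp_pos|]. apply Rle_lt_trans with (exp s1); auto.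
      destruct (Req_dec u s1) as [->|]; [lra|]. left. apply exp_increasing; lra.
    - eexists. apply (Cderiv_comp f (fun z => a + Cexp z)%C); [|exact Hl].
      apply Cderiv_add; [apply Cderiv_const | apply Cderiv_Cexp]. }
  unfold rect_int in G. replace (s0 + (s1 - s0)) with s1 in G by ring. rewrite Rplus_0_l in G.
  assert (E : forall s, g (s, 2 * PI) = g (s, 0)).
  { intro s. unfold g, Cexp; simpl fst; simpl snd. now rewrite cos_2PI, sin_2PI, cos_0, sin_0. }
  rewrite (RInt_ext (fun s => fst (g (s, 2 * PI))) (fun s => fst (g (s, 0)))) in G.
  2:{ intros x _. now rewrite E. }
  rewrite (RInt_ext (fun t => snd (f (circ a (exp s1) t))) (fun t => snd (g (s1, t)))).
  2:{ intros x _. now rewrite circ_exp. }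
  rewrite (RInt_ext (fun t => snd (f (circ a (exp s0) t))) (fun t => snd (g (s0, t)))).
  2:{ intros x _. now rewrite circ_exp. }
  simpl in *. lra.
Qed.

(** The radius is shrunk until continuity at [a] controls the mean. Asking only for continuity at
    the centre makes the result applicable to the difference quotients [dquot]. *)
Lemma mean_value_snd (f : C -> C) (a : C) (R0 r : R) : 0 < r < R0 -> Ccont f a ->
  (forall w, 0 < Cmod (w - a) < R0 -> exists l, Cderiv f w l) ->
  RInt (fun t => snd (f (circ a r t))) 0 (2 * PI) = 2 * PI * snd (f a).
Proof.
  intros [Hr HR] Ha H. assert (HPI := PI_RGT_0).
  apply Rminus_diag_uniq. apply Rabs_eq_0.
  apply Rle_antisym; [|apply Rabs_pos]. apply le_epsilon. intros e He. rewrite Rplus_0_l.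
  destruct (Ha (e / (2 * PI))) as [d [Hd Hf]]; [apply Rdiv_lt_0_compat; lra|].
  set (q := Rmin (d / 2) r). assert (Hq : 0 < q) by (apply Rmin_pos; lra).
  assert (Q1 := Rmin_l (d / 2) r). assert (Q2 := Rmin_r (d / 2) r). fold q in Q1, Q2. clearbody q.
  rewrite <- (exp_ln r), <- (exp_ln q) in Q2 by auto. 
  rewrite <- (exp_ln r) by auto.
  rewrite (circ_mean_const f a R0 (ln q) (ln r)); auto.
  2:{ destruct (Req_dec (ln q) (ln r)); [lra|]. left. apply exp_lt_inv.
      destruct Q2 as [|Q2]; auto. apply exp_inv in Q2. lra. }
  2:{ now rewrite exp_ln. }
  rewrite !exp_ln in * by auto.
  assert (I : ex_RInt (fun t => snd (f (circ a q t))) 0 (2 * PI)).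
  { apply (ex_RInt_circ f a q); [lra|]. intros w Hw. destruct (H w) as [l Hl]; [lra|]. 
    now apply Cderiv_Ccont in Hl. }
  assert (I' : is_RInt (fun t => snd (f (circ a q t)) - snd (f a)) 0 (2 * PI)
      (RInt (fun t => snd (f (circ a q t))) 0 (2 * PI) - 2 * PI * snd (f a))).
  { apply (is_RInt_minus (fun t => snd (f (circ a q t))) (fun _ => snd (f a))).
    - apply (RInt_correct (V := R_CompleteNormedModule)); auto.
    - replace (2 * PI * snd (f a)) with (scal (2 * PI - 0) (snd (f a))) by (unfold scal; simpl; unfold mult; simpl; ring).
      apply (@is_RInt_const R_NormedModule). }
  rewrite <- (@is_RInt_unique R_CompleteNormedModule _ _ _ _ I').
  replace e with ((2 * PI - 0) * (e / (2 * PI))) at 1 by (field; lra).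
  apply abs_RInt_le_const; [lra | now eexists; apply I' |].
  intros t _. apply Rle_trans with (1 := Rabs_snd_le (f (circ a q t) - f a)).
  left. apply Hf. rewrite Cmod_circ; lra.
Qed.

Lemma mean_value (f : C -> C) (a : C) (R0 r : R) : 0 < r < R0 -> Ccont f a ->
  (forall w, 0 < Cmod (w - a) < R0 -> exists l, Cderiv f w l) ->
  is_RInt (fun t => fst (f (circ a r t))) 0 (2 * PI) (2 * PI * fst (f a)) /\
  is_RInt (fun t => snd (f (circ a r t))) 0 (2 * PI) (2 * PI * snd (f a)).
Proof.
  intros Hr Ha H.
  assert (I := ex_RInt_circ f a r ltac:(lra)).
  destruct I as [I1 I2].
  { intros w Hw. destruct (H w) as [l Hl]; [lra|]. now apply Cderiv_Ccont in Hl. }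
  split.
  - rewrite <- (Ropp_involutive (fst (f a))).
    (* Since [snd (Ci * w) = fst w], the result on imaginary parts yields the one on real parts. *)
    assert (E : RInt (fun t => snd (Ci * f (circ a r t))%C) 0 (2 * PI) = 2 * PI * snd (Ci * f a)%C).
    { apply (mean_value_snd (fun w => Ci * f w)%C a R0 r); auto.
      - apply Ccont_mul; auto. apply Ccont_const.
      - intros w Hw. destruct (H w Hw) as [l Hl]. eexists. apply Cderiv_scal, Hl. }
    rewrite (RInt_ext _ (fun t => fst (f (circ a r t)))) in E.
    2:{ intros x _. unfold Cmult, Ci; simpl. ring. }
    replace (snd (Ci * f a)%C) with (- - fst (f a)) in E by (unfold Cmult, Ci; simpl; ring).
    rewrite <- E. apply (RInt_correct (V := R_CompleteNormedModule)); auto.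
  - rewrite <- (mean_value_snd f a R0 r) by auto. apply (RInt_correct (V := R_CompleteNormedModule)); auto.
Qed.

Definition Rcont2 (N : C -> R) (z : C) : Prop :=
  forall eps, 0 < eps -> exists d, 0 < d /\ forall w, Cmod (w - z) < d -> Rabs (N w - N z) < eps.

Lemma Cousin_disc (c : C) (r : R) (P : R -> R -> R -> Prop) : 0 < r ->
  (forall x y t, 0 < t -> P x y (t/2) -> P (x + 2 * r * (t/2)) y (t/2) ->
     P x (y + 2 * r * (t/2)) (t/2) -> P (x + 2 * r * (t/2)) (y + 2 * r * (t/2)) (t/2) -> P x y t) ->
  (forall z, exists d, 0 < d /\ forall x y t, 0 < t ->
       (forall w, x <= fst w <= x + 2 * r * t -> y <= snd w <= y + 2 * r * t -> Cmod (w - z) < d) -> P x y t) ->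
  P (fst c - r) (snd c - r) 1.
Proof.
  intros Hr H1 H2. apply (Cousin (2 * r) (2 * r)); try lra; auto.
  intros u v _ _. destruct (H2 (u, v)) as [d [Hd H]].
  exists (d / (4 * r + 1)). split; [apply Rdiv_lt_0_compat; lra|].
  intros x y t [Ht Htd] Hx Hy. apply H; auto.
  intros [p q] Hp Hq. simpl in Hp, Hq.
  assert (Htd' : t * (4 * r + 1) < d) by (apply Rlt_div_r; lra).
  eapply Rle_lt_trans; [apply Cmod_le_sum|]. simpl.
  assert (Rabs (p + - u) <= 2 * r * t) by (apply Rabs_le; lra).
  assert (Rabs (q + - v) <= 2 * r * t) by (apply Rabs_le; lra). nra.
Qed.

Lemma disc_in_square (c w : C) (r : R) : Cmod (w - c) <= r ->
  fst c - r <= fst w <= fst c - r + 2 * r * 1 /\ snd c - r <= snd w <= snd c - r + 2 * r * 1.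
Proof.
  intro H. pose proof (Rabs_fst_le (w - c)) as A. pose proof (Rabs_snd_le (w - c)) as B.
  apply Rle_trans with (2 := H) in A. apply Rle_trans with (2 := H) in B. simpl in A, B.
  apply Rabs_le_between in A. apply Rabs_le_between in B. lra.
Qed.

Lemma rect_quarters (x y h t : R) (p q : R) : x <= p <= x + h * t -> y <= q <= y + h * t ->
  (x <= p <= x + h * (t/2) /\ y <= q <= y + h * (t/2)) \/
  (x + h * (t/2) <= p <= x + h * (t/2) + h * (t/2) /\ y <= q <= y + h * (t/2)) \/
  (x <= p <= x + h * (t/2) /\ y + h * (t/2) <= q <= y + h * (t/2) + h * (t/2)) \/
  (x + h * (t/2) <= p <= x + h * (t/2) + h * (t/2) /\ y + h * (t/2) <= q <= y + h * (t/2) + h * (t/2)).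
Proof.
  intros. replace (h * t) with (h * (t/2) + h * (t/2)) in * by field.
  destruct (Rle_dec p (x + h * (t/2))); destruct (Rle_dec q (y + h * (t/2))); lra.
Qed.

(** Here [P] says that one point of the disc dominates [N] on the part of the square inside the
    disc. Near a point that is not a maximiser, a point of strictly larger value does so by
    continuity; a maximiser does so by itself; and far squares do not meet the disc. *)
Lemma max_on_disc (N : C -> R) (c : C) (r : R) : 0 < r ->
  (forall z, Cmod (z - c) <= r -> Rcont2 N z) ->
  exists m, Cmod (m - c) <= r /\ forall w, Cmod (w - c) <= r -> N w <= N m.
Proof.
  intros Hr HN.
  pose (P := fun x y t => exists m, Cmod (m - c) <= r /\
    forall w, x <= fst w <= x + 2 * r * t -> y <= snd w <= y + 2 * r * t -> Cmod (w - c) <= r -> N w <= N m).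
  assert (HP : P (fst c - r) (snd c - r) 1).
  { assert (Hmax : forall a b, Cmod (a - c) <= r -> Cmod (b - c) <= r ->
       exists m, Cmod (m - c) <= r /\ N a <= N m /\ N b <= N m).
    { intros a b Ha Hb. destruct (Rle_dec (N a) (N b)); [exists b | exists a]; repeat split; auto; lra. }
    apply (Cousin_disc c r); auto.
    - intros x y t Ht [m1 [A1 B1]] [m2 [A2 B2]] [m3 [A3 B3]] [m4 [A4 B4]].
      destruct (Hmax m1 m2 A1 A2) as (n1 & C1 & D1 & E1).
      destruct (Hmax m3 m4 A3 A4) as (n2 & C2 & D2 & E2).
      destruct (Hmax n1 n2 C1 C2) as (n & C3 & D3 & E3).
      exists n. split; auto. intros w Hx Hy Hw.
      destruct (rect_quarters _ _ _ _ _ _ Hx Hy) as [[U V]|[[U V]|[[U V]|[U V]]]].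
      + specialize (B1 w U V Hw). lra.
      + specialize (B2 w U V Hw). lra.
      + specialize (B3 w U V Hw). lra.
      + specialize (B4 w U V Hw). lra.
    - intro z. destruct (Rle_dec (Cmod (z - c)) r) as [Hz|Hz].
      + destruct (classic (exists m, Cmod (m - c) <= r /\ N z < N m)) as [[m [Hm Hlt]]|Hno].
        * destruct (HN z Hz (N m - N z)) as [d [Hd H]]; [lra|].
          exists d. split; auto. intros x y t Ht Hall. exists m. split; auto.
          intros w Hx Hy _. specialize (H w (Hall w Hx Hy)). apply Rabs_def2 in H. lra.
        * exists 1. split; [lra|]. intros x y t _ _. exists z. split; auto.
          intros w _ _ Hw. apply Rnot_lt_le. intro. apply Hno. now exists w.
      + exists (Cmod (z - c) - r). split; [lra|]. intros x y t _ Hall. exists c. rewrite Cmod_self.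
        split; [lra|]. intros w Hx Hy Hw. specialize (Hall w Hx Hy).
        pose proof (Cmod_triangle_sub z w c). rewrite (Cmod_minus_sym z w) in H. lra. }
  destruct HP as [m [Hm H]]. exists m. split; auto. intros w Hw.
  destruct (disc_in_square _ _ _ Hw). auto.
Qed.

Lemma unif_cont_disc (f : C -> C) (c : C) (r : R) : 0 < r ->
  (forall z, Cmod (z - c) <= r -> Ccont f z) ->
  forall e, 0 < e -> exists d, 0 < d /\ forall z w, Cmod (z - c) <= r -> Cmod (w - z) < d ->
    Cmod (f w - f z) < e.
Proof.
  intros Hr Hf e He.
  pose (P := fun x y t => exists d, 0 < d /\ forall z w, x <= fst z <= x + 2 * r * t -> y <= snd z <= y + 2 * r * t ->
    Cmod (z - c) <= r -> Cmod (w - z) < d -> Cmod (f w - f z) < e).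
  assert (HP : P (fst c - r) (snd c - r) 1).
  { apply (Cousin_disc c r); auto.
    - intros x y t Ht [m1 [A1 B1]] [m2 [A2 B2]] [m3 [A3 B3]] [m4 [A4 B4]].
      exists (Rmin (Rmin m1 m2) (Rmin m3 m4)).
      split; [repeat apply Rmin_pos; auto|]. intros z w Hx Hy Hz Hw.
      pose proof (Rmin_l (Rmin m1 m2) (Rmin m3 m4)). pose proof (Rmin_r (Rmin m1 m2) (Rmin m3 m4)).
      pose proof (Rmin_l m1 m2). pose proof (Rmin_r m1 m2). pose proof (Rmin_l m3 m4). pose proof (Rmin_r m3 m4).
      destruct (rect_quarters _ _ _ _ _ _ Hx Hy) as [[U V]|[[U V]|[[U V]|[U V]]]].
      + apply (B1 z w U V Hz). lra.
      + apply (B2 z w U V Hz). lra.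
      + apply (B3 z w U V Hz). lra.
      + apply (B4 z w U V Hz). lra.
    - intro p. destruct (Rle_dec (Cmod (p - c)) r) as [Hp|Hp].
      + destruct (Hf p Hp (e / 2)) as [d [Hd H]]; [lra|].
        exists (d / 2). split; [lra|]. intros x y t _ Hall. exists (d / 2). split; [lra|].
        intros z w Hx Hy Hz Hw. specialize (Hall z Hx Hy).
        pose proof (Cmod_triangle_sub w z p).
        assert (A := H w ltac:(lra)). assert (B := H z ltac:(lra)).
        pose proof (Cmod_triangle_sub (f w) (f p) (f z)) as T. rewrite (Cmod_minus_sym (f p)) in T. lra.
      + exists (Cmod (p - c) - r). split; [lra|]. intros x y t _ Hall. exists 1. split; [lra|].
        intros z w Hx Hy Hz _. specialize (Hall z Hx Hy).
        pose proof (Cmod_triangle_sub p z c). rewrite (Cmod_minus_sym p z) in H. lra. }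
  destruct HP as [d [Hd H]]. exists d. split; auto. intros z w Hz. 
  destruct (disc_in_square _ _ _ Hz). apply H; auto.
Qed.

(** The term [eta |z|^2] makes the maximum of [|F|^2] over the closed disc strict, so that it is
    attained on the boundary. *)
Lemma max_principle (F : C -> C) (r M : R) : 0 < r -> 0 <= M ->
  (forall z, Cmod z <= r -> Ccont F z) ->
  (forall z, Cmod z < r -> exists d, 0 < d /\ forall w, 0 < Cmod (w - z) < d -> exists l, Cderiv F w l) ->
  (forall z, Cmod z = r -> Cmod (F z) <= M) ->
  forall z, Cmod z <= r -> Cmod (F z) <= M.
Proof.
  intros Hr HM Hc Hd Hb z0 Hz0.
  assert (C0 : forall z, (z - 0)%C = z) by (intro; ring).
  assert (Key : forall eta, 0 < eta -> Cmod (F z0) ^ 2 <= M ^ 2 + eta * r ^ 2).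
  { intros eta He. set (N := fun z => Cmod (F z) ^ 2 + eta * Cmod z ^ 2).
    destruct (max_on_disc N 0 r Hr) as [m [Hm Hmax]].
    { intros z Hz. rewrite C0 in Hz. intros e Hep.
      assert (Sq : forall G, Ccont G z -> exists d, 0 < d /\ forall w, Cmod (w - z) < d ->
         Rabs (Cmod (G w) ^ 2 - Cmod (G z) ^ 2) < e / (2 * (eta + 1))).
      { intros G HG. set (q := e / (2 * (eta + 1))). 
        assert (Hq : 0 < q) by (apply Rdiv_lt_0_compat; lra).
        set (B := 2 * Cmod (G z) + 1). pose proof (Cmod_ge_0 (G z)).
        assert (HB : 0 < q / B) by (apply Rdiv_lt_0_compat; unfold B; lra).
        destruct (HG (Rmin 1 (q / B))) as [d [P Q]]; [apply Rmin_pos; lra|].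
        exists d. split; auto. intros w Hw. specialize (Q w Hw).
        pose proof (Rmin_l 1 (q / B)). pose proof (Rmin_r 1 (q / B)).
        pose proof (Cmod_rev_triangle (G w) (G z)) as T1.
        pose proof (Cmod_rev_triangle (G z) (G w)) as T2. rewrite Cmod_minus_sym in T2.
        assert (Ha : Rabs (Cmod (G w) - Cmod (G z)) < q / B) by (apply Rabs_def1; lra).
        replace (Cmod (G w) ^ 2 - Cmod (G z) ^ 2) with
          ((Cmod (G w) - Cmod (G z)) * (Cmod (G w) + Cmod (G z))) by ring.
        rewrite Rabs_mult. pose proof (Cmod_ge_0 (G w)).
        rewrite (Rabs_pos_eq (Cmod (G w) + Cmod (G z))) by lra.
        apply Rle_lt_trans with (Rabs (Cmod (G w) - Cmod (G z)) * B).
        - apply Rmult_le_compat_l; [apply Rabs_pos | unfold B; lra].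
        - apply Rlt_le_trans with (q / B * B); [apply Rmult_lt_compat_r; unfold B in *; lra|].
          right. field. unfold B; lra. }
      destruct (Sq F (Hc z Hz)) as [d1 [P1 Q1]]. destruct (Sq (fun z => z) (Ccont_id z)) as [d2 [P2 Q2]].
      exists (Rmin d1 d2). split; [apply Rmin_pos; auto|]. intros w Hw.
      assert (A := Q1 w ltac:(eapply Rlt_le_trans; [exact Hw | apply Rmin_l])).
      assert (B := Q2 w ltac:(eapply Rlt_le_trans; [exact Hw | apply Rmin_r])).
      set (q := e / (2 * (eta + 1))) in *.
      assert (Eq : e = 2 * (q * (eta + 1))) by (unfold q; field; lra).
      assert (0 < q) by (apply Rdiv_lt_0_compat; lra).
      unfold N. apply Rabs_def2 in A. apply Rabs_def2 in B. apply Rabs_def1; nra. }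
    rewrite C0 in Hm.
    assert (Hbd : N m <= M ^ 2 + eta * r ^ 2).
    { destruct Hm as [Hm|Hm].
      2:{ unfold N. specialize (Hb m Hm). rewrite Hm. pose proof (Cmod_ge_0 (F m)). nra. }
      exfalso. destruct (Hd m Hm) as [d [Pd Qd]].
      set (p := Rmin (d / 2) ((r - Cmod m) / 2)).
      assert (Hp : 0 < p) by (apply Rmin_pos; lra).
      assert (Hp1 := Rmin_l (d / 2) ((r - Cmod m) / 2)). assert (Hp2 := Rmin_r (d / 2) ((r - Cmod m) / 2)).
      fold p in Hp1, Hp2. clearbody p.
      destruct (mean_value F m d p) as [I1 I2]; [lra | apply Hc; lra | auto |].
      destruct (mean_value (fun z => z) m d p) as [J1 J2]; [lra | apply Ccont_id | intros w _; eexists; apply Cderiv_id |].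
      set (A1 := fst (F m)) in *. set (A2 := snd (F m)) in *.
      (* [K] is [Re (conj (F m) * F w) + eta * Re (conj m * w)] on the circle of radius [p] about an
         interior maximiser [m]. Its mean is [N m] by the mean value property. Polarisation and
         [N w <= N m] bound it pointwise by [N m - eta * p ^ 2 / 2], a contradiction. *)
      set (K := fun t => A1 * fst (F (circ m p t)) + A2 * snd (F (circ m p t))
          + eta * (fst m * fst (circ m p t) + snd m * snd (circ m p t))).
      assert (IK : is_RInt K 0 (2 * PI) (A1 * (2 * PI * A1) + A2 * (2 * PI * A2)
          + eta * (fst m * (2 * PI * fst m) + snd m * (2 * PI * snd m)))).
      { apply (is_RInt_plus (V := R_NormedModule)).
        - apply (is_RInt_plus (V := R_NormedModule)); apply (is_RInt_scal (V := R_NormedModule)); auto.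
        - apply (is_RInt_scal (V := R_NormedModule)).
          apply (is_RInt_plus (V := R_NormedModule)); apply (is_RInt_scal (V := R_NormedModule)); auto. }
      assert (HPI := PI_RGT_0).
      assert (LK : RInt K 0 (2 * PI) <= RInt (fun _ => A1 ^ 2 + A2 ^ 2 + eta * Cmod m ^ 2 - eta * p ^ 2 / 2) 0 (2 * PI)).
      { apply RInt_le; [lra | now eexists; apply IK | apply ex_RInt_const |].
        intros t _. unfold K.
        assert (Hin : Cmod (circ m p t) <= r).
        { pose proof (Cmod_triangle_sub (circ m p t) m 0) as T. rewrite Cmod_circ, !C0 in T by lra. lra. }
        specialize (Hmax (circ m p t)). rewrite C0 in Hmax. specialize (Hmax Hin). unfold N in Hmax.
        pose proof (Cmod_circ m p t ltac:(lra)) as HE.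
        pose proof (Cmod_sqr (circ m p t - m)) as HE2. rewrite HE in HE2.
        rewrite !Cmod_sqr in Hmax. rewrite Cmod_sqr. fold A1 A2 in Hmax.
        change (fst (circ m p t - m)%C) with (fst (circ m p t) - fst m) in HE2.
        change (snd (circ m p t - m)%C) with (snd (circ m p t) - snd m) in HE2.
        set (f1 := fst (F (circ m p t))) in *. set (f2 := snd (F (circ m p t))) in *.
        set (c1 := fst (circ m p t)) in *. set (c2 := snd (circ m p t)) in *.
        set (m1 := fst m) in *. set (m2 := snd m) in *.
        pose proof (pow2_ge_0 (f1 - A1)). pose proof (pow2_ge_0 (f2 - A2)).
        assert (E : eta * p^2 = eta * ((c1 - m1) ^ 2 + (c2 - m2) ^ 2)) by (now rewrite HE2).
        nra. }
      rewrite RInt_const in LK. rewrite (@is_RInt_unique R_CompleteNormedModule _ _ _ _ IK) in LK.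
      unfold scal in LK; simpl in LK; unfold mult in LK; simpl in LK.
      assert (Sm := Cmod_sqr m).
      assert (X : 0 < PI * eta * p ^ 2).
      { apply Rmult_lt_0_compat; [nra|]. nra. }
      simpl in Sm. simpl in X. rewrite Sm in LK. nra. }
    specialize (Hmax z0). rewrite C0 in Hmax. specialize (Hmax Hz0).
    unfold N in Hmax at 1. assert (0 <= Cmod z0 ^ 2) by (apply pow2_ge_0). nra. }
  apply Rnot_lt_le. intro Hlt.
  (* This [eta] makes the perturbation [eta * r ^ 2] half of the supposed excess over [M ^ 2]. *)
  specialize (Key ((Cmod (F z0) ^ 2 - M ^ 2) / (2 * r ^ 2))).
  assert (D : 0 < Cmod (F z0) ^ 2 - M ^ 2) by nra.
  specialize (Key ltac:(apply Rdiv_lt_0_compat; nra)).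
  replace ((Cmod (F z0) ^ 2 - M ^ 2) / (2 * r ^ 2) * r ^ 2) with ((Cmod (F z0) ^ 2 - M ^ 2) / 2) in Key by (field; lra).
  lra.
Qed.

(** * Blaschke factors and the Schwarz lemma *)

Definition blaschke (a z : C) : C := ((z - a) / (1 - Cconj a * z))%C.

Lemma blaschke_den_neq_0 (a z : C) : Cmod a < 1 -> Cmod z <= 1 -> (1 - Cconj a * z)%C <> 0.
Proof.
  intros Ha Hz E. assert (H : Cmod (Cconj a * z) = 1).
  { rewrite <- Cmod_1. f_equal. replace (Cconj a * z)%C with (1 - (1 - Cconj a * z))%C by ring.
    rewrite E. ring. }
  rewrite Cmod_mult, Cmod_conj in H. pose proof (Cmod_ge_0 a). pose proof (Cmod_ge_0 z). nra.
Qed.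

Lemma blaschke_norm_identity (a z : C) :
  Cmod (1 - Cconj a * z) ^ 2 - Cmod (z - a) ^ 2 = (1 - Cmod a ^ 2) * (1 - Cmod z ^ 2).
Proof.
  rewrite !Cmod_sqr. destruct a as [a1 a2], z as [z1 z2]. simpl. ring.
Qed.

(** A quantitative form of [|b_a| -> 1] at the unit circle, from the norm identity and
    [|1 - conj a * z| >= 1 - |a|]. *)
Lemma Cmod_blaschke_lower (a z : C) : Cmod a < 1 -> Cmod z < 1 ->
  1 - (1 + Cmod a) / (1 - Cmod a) * (1 - Cmod z ^ 2) <= Cmod (blaschke a z) ^ 2.
Proof.
  intros Ha Hz. pose proof (Cmod_ge_0 a). pose proof (Cmod_ge_0 z).
  unfold blaschke. rewrite Cmod_div by (apply blaschke_den_neq_0; lra).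
  pose proof (blaschke_norm_identity a z) as E.
  pose proof (Cmod_rev_triangle 1 (Cconj a * z)) as T.
  rewrite Cmod_1, Cmod_mult, Cmod_conj in T.
  set (m := Cmod (1 - Cconj a * z)) in *.
  assert (Hm : 1 - Cmod a <= m) by nra.
  unfold Rdiv at 2. rewrite Rpow_mult_distr, pow_inv.
  replace (Cmod (z - a) ^ 2) with (m ^ 2 - (1 - Cmod a ^ 2) * (1 - Cmod z ^ 2)) by lra.
  replace ((m ^ 2 - (1 - Cmod a ^ 2) * (1 - Cmod z ^ 2)) * / m ^ 2)
    with (1 - (1 - Cmod a ^ 2) / m ^ 2 * (1 - Cmod z ^ 2)) by (field; lra).
  apply Rplus_le_compat_l, Ropp_le_contravar. apply Rmult_le_compat_r; [nra|].
  replace ((1 + Cmod a) / (1 - Cmod a)) with ((1 - Cmod a ^ 2) / (1 - Cmod a) ^ 2) by (field; lra).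
  apply Rmult_le_compat_l; [nra|]. apply Rinv_le_contravar; nra.
Qed.

Lemma Bernoulli_minus (s : R) (k : nat) : 0 <= s <= 1 -> 1 - INR k * s <= (1 - s) ^ k.
Proof.
  intro Hs. induction k as [|k IH]; [simpl; lra|]. rewrite S_INR. simpl.
  pose proof (pos_INR k). nra.
Qed.

(** This permits division by [b_a ^ k] without losing the bound [1]. On circles of radius near [1]
    the factor has modulus near [1], so [|F|] is nearly bounded by [1] there, and the maximum
    principle carries this inside. *)
Lemma max_principle_blaschke (F : C -> C) (a : C) (k : nat) : Cmod a < 1 ->
  (forall z, Cmod z < 1 -> Ccont F z) ->
  (forall z, Cmod z < 1 -> exists d, 0 < d /\ forall w, 0 < Cmod (w - z) < d -> exists l, Cderiv F w l) ->
  (forall z, Cmod z < 1 -> Cmod (F z) * Cmod (blaschke a z) ^ k <= 1) ->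
  forall z, Cmod z < 1 -> Cmod (F z) <= 1.
Proof.
  intros Ha Hc Hd Hb z0 Hz0. apply Rnot_lt_le. intro Hy. set (y := Cmod (F z0)) in *.
  set (K := (1 + Cmod a) / (1 - Cmod a)). pose proof (Cmod_ge_0 a). pose proof (Cmod_ge_0 z0).
  assert (HK : 0 < K) by (apply Rdiv_lt_0_compat; lra).
  pose proof (pos_INR k) as Hk.
  (* With [r > 1 - t] one gets [k * s < 1 - / y], hence [q ^ k > / y] by Bernoulli. The maximum
     principle then gives [y ^ 2 <= / q ^ k < y], against [y > 1]. *)
  set (t := (1 - / y) / (2 * K * (INR k + 1))).
  assert (Hiy : 0 < / y < 1).
  { split; [apply Rinv_0_lt_compat; lra|]. rewrite <- Rinv_1. apply Rinv_lt_contravar; lra. }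
  assert (Ht : 0 < t) by (apply Rdiv_lt_0_compat; [lra | nra]).
  set (r := 1 - Rmin (t / 2) ((1 - Cmod z0) / 2)).
  assert (Hr1 : r < 1) by (assert (0 < Rmin (t / 2) ((1 - Cmod z0) / 2)) by (apply Rmin_pos; lra); unfold r; lra).
  assert (Hr2 : Cmod z0 < r /\ 1 - t < r).
  { pose proof (Rmin_l (t / 2) ((1 - Cmod z0) / 2)). pose proof (Rmin_r (t / 2) ((1 - Cmod z0) / 2)).
    unfold r; lra. }
  set (s := K * (1 - r ^ 2)).
  assert (Hs0 : 0 <= s) by (unfold s; apply Rmult_le_pos; nra).
  assert (Hs1 : s * (INR k + 1) < 1 - / y).
  { apply Rlt_le_trans with (2 * K * t * (INR k + 1)).
    - apply Rmult_lt_compat_r; [lra|]. unfold s. rewrite (Rmult_comm 2 K), Rmult_assoc.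
      apply Rmult_lt_compat_l; nra.
    - right. unfold t. field. repeat split; lra. }
  assert (Hs2 : s < 1) by nra.
  set (q := 1 - s).
  assert (Hqk : / y < q ^ k).
  { apply Rlt_le_trans with (2 := Bernoulli_minus s k ltac:(lra)). nra. }
  assert (Hbd : forall z, Cmod z = r -> Cmod (F z) ^ 2 * q ^ k <= 1).
  { intros z Hz. assert (Hz1 : Cmod z < 1) by lra. specialize (Hb z Hz1).
    pose proof (Cmod_blaschke_lower a z Ha Hz1) as HL. rewrite Hz in HL. fold K in HL. fold s q in HL.
    set (b := Cmod (blaschke a z)) in *. pose proof (Cmod_ge_0 (blaschke a z)) as Hb0. fold b in Hb0.
    pose proof (Cmod_ge_0 (F z)) as Hf0.
    apply Rle_trans with (Cmod (F z) ^ 2 * (b ^ 2) ^ k).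
    - apply Rmult_le_compat_l; [nra|]. apply pow_incr. unfold q in *; lra.
    - rewrite <- pow_mult, Nat.mul_comm, pow_mult, <- Rpow_mult_distr.
      assert (0 <= Cmod (F z) * b ^ k) by (apply Rmult_le_pos; auto; now apply pow_le). nra. }
  assert (Hq0 : 0 < q ^ k) by lra.
  assert (Hmain : y <= sqrt (/ q ^ k)).
  { apply (max_principle F r); try lra.
    - apply sqrt_pos.
    - intros; apply Hc; lra.
    - intros; apply Hd; lra.
    - intros z Hz. rewrite <- (sqrt_pow2 (Cmod (F z))) by apply Cmod_ge_0.
      apply sqrt_le_1_alt. specialize (Hbd z Hz).
      apply Rmult_le_reg_r with (q ^ k); [auto|]. rewrite Rinv_l by lra. exact Hbd. }
  assert (Hy2 : y ^ 2 <= / q ^ k).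
  { rewrite <- (pow2_sqrt (/ q ^ k)) by (left; now apply Rinv_0_lt_compat). apply pow_incr. lra. }
  assert (/ q ^ k < y).
  { rewrite <- (Rinv_inv y). apply Rinv_lt_contravar; [|lra]. apply Rmult_lt_0_compat; lra. }
  nra.
Qed.

(** For [l] the derivative at [z], the filled-in value makes the quotient continuous at [z], which
    is what the mean value property and the maximum principle require of a removable singularity. *)
Definition dquot (f : C -> C) (z l w : C) : C :=
  if Ceq_dec w z then l else ((f w - f z) / (w - z))%C.

Lemma dquot_eq (f : C -> C) (z l : C) : dquot f z l z = l.
Proof. unfold dquot. now destruct (Ceq_dec z z). Qed.
Lemma dquot_neq (f : C -> C) (z l w : C) : w <> z -> dquot f z l w = ((f w - f z) / (w - z))%C.
Proof. intro. unfold dquot. now destruct (Ceq_dec w z). Qed.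

Lemma Ccont_dquot (f : C -> C) (z l : C) : Cderiv f z l -> Ccont (dquot f z l) z.
Proof.
  intros H e He. destruct (H (e/2)) as [d [Hd H1]]; [lra|]. exists d. split; auto.
  intros w Hw. rewrite dquot_eq.
  destruct (Ceq_dec w z) as [->|Hn]; [now rewrite dquot_eq, Cmod_self|]. rewrite dquot_neq by auto.
  specialize (H1 w Hw). pose proof (Cminus_neq_0 _ _ Hn) as Hn'.
  replace ((f w - f z) / (w - z) - l)%C with ((f w - f z - l * (w - z)) / (w - z))%C by (field; auto).
  rewrite Cmod_div by auto. apply Cmod_pos in Hn'. apply Rlt_div_l; [auto|]. nra.
Qed.

Lemma Cmod_sub_pos (w z : C) : 0 < Cmod (w - z) -> w <> z.
Proof. intros H E. rewrite E, Cmod_self in H. lra. Qed.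

Lemma Cderiv_dquot (f : C -> C) (z l w m : C) : w <> z -> Cderiv f w m ->
  exists l', Cderiv (dquot f z l) w l'.
Proof.
  intros Hn Hm. eexists.
  apply (Cderiv_ext_loc (fun w => (f w - f z) / (w - z))%C) with (r := Cmod (w - z)).
  - apply Cmod_pos. now apply Cminus_neq_0.
  - intros v Hv. rewrite dquot_neq; auto. intros ->. rewrite Cmod_minus_sym in Hv. lra.
  - apply Cderiv_div.
    + apply Cderiv_sub; [exact Hm | apply Cderiv_const].
    + apply Cderiv_sub; [apply Cderiv_id | apply Cderiv_const].
    + now apply Cminus_neq_0.
Qed.

Lemma disc_open (z w : C) : Cmod z < 1 -> Cmod (w - z) < 1 - Cmod z -> Cmod w < 1.
Proof. intros Hz H. pose proof (Cmod_rev_triangle w z). lra. Qed.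

Lemma holo_Ccont (f : C -> C) (z : C) : holomorphic_on in_disc f -> Cmod z < 1 -> Ccont f z.
Proof. intros H Hz. destruct (H z Hz) as [l Hl]. exact (Cderiv_Ccont f z l Hl). Qed.

(** The function [F] is [f / b_x] with its singularity filled in; it is bounded by [1], and its
    value at [x] is [l * (1 - |x| ^ 2)]. *)
Lemma Schwarz_at (f : C -> C) (x l : C) : holomorphic_on in_disc f ->
  (forall z, Cmod z < 1 -> Cmod (f z) <= 1) -> Cmod x < 1 -> f x = 0 -> Cderiv f x l ->
  Cmod l * (1 - Cmod x ^ 2) <= 1.
Proof.
  intros Hf Hb Hx Hfx Hl.
  set (F := fun z => (dquot f x l z * (1 - Cconj x * z))%C).
  assert (HD : forall w, exists m, Cderiv (fun z => 1 - Cconj x * z)%C w m).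
  { intro w. eexists. apply Cderiv_sub; [apply Cderiv_const | apply Cderiv_scal, Cderiv_id]. }
  assert (HF : Cmod (F x) <= 1).
  { apply (max_principle_blaschke F x 1); auto.
    - intros z Hz. apply Ccont_mul.
      + destruct (Ceq_dec z x) as [->|Hn]; [now apply Ccont_dquot|].
        destruct (Hf z Hz) as [m Hm]. destruct (Cderiv_dquot f x l z m Hn Hm) as [l' Hl'].
        exact (Cderiv_Ccont _ _ _ Hl').
      + destruct (HD z) as [m Hm]. exact (Cderiv_Ccont _ _ _ Hm).
    - intros z Hz.
      assert (Hsep : exists d, 0 < d /\ forall w, 0 < Cmod (w - z) < d -> w <> x).
      { destruct (Ceq_dec z x) as [->|Hn].
        - exists 1. split; [lra|]. intros w [Hw _]. now apply Cmod_sub_pos.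
        - exists (Cmod (z - x)). split; [now apply Cmod_pos, Cminus_neq_0|].
          intros w [_ Hw] ->. rewrite Cmod_minus_sym in Hw. lra. }
      destruct Hsep as [d [Pd Qd]]. exists (Rmin d (1 - Cmod z)).
      split; [apply Rmin_pos; lra|]. intros w [Hw1 Hw2].
      pose proof (Rmin_l d (1 - Cmod z)). pose proof (Rmin_r d (1 - Cmod z)).
      destruct (Hf w) as [m Hm]; [apply (disc_open z); lra|].
      destruct (Cderiv_dquot f x l w m) as [l' Hl']; [apply Qd; lra | exact Hm |].
      destruct (HD w) as [m' Hm']. eexists. apply Cderiv_mul; eauto.
    - intros z Hz. rewrite pow_1, <- Cmod_mult. destruct (Ceq_dec z x) as [->|Hn].
      + unfold blaschke. replace (F x * ((x - x) / (1 - Cconj x * x)))%C with (RtoC 0) by (unfold Cdiv; ring).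
        rewrite Cmod_0. lra.
      + unfold F, blaschke. rewrite dquot_neq, Hfx by auto.
        replace ((f z - 0) / (z - x) * (1 - Cconj x * z) * ((z - x) / (1 - Cconj x * z)))%C with (f z); [auto|].
        field. split; [apply blaschke_den_neq_0; lra | now apply Cminus_neq_0]. }
  unfold F in HF. rewrite dquot_eq, Cmod_mult in HF.
  replace (1 - Cconj x * x)%C with (RtoC (1 - Cmod x ^ 2)) in HF.
  - rewrite Cmod_R, Rabs_pos_eq in HF; auto. pose proof (Cmod_ge_0 x). nra.
  - rewrite Cmod_sqr. destruct x as [x1 x2]. unfold RtoC, Cconj, Cminus, Cplus, Copp, Cmult; simpl. f_equal; ring.
Qed.

(** Choice makes the derivative a function of the point, so that its continuity can be stated and it
    can be integrated along curves. *)
Definition Cder (f : C -> C) (z : C) : C := epsilon (inhabits (RtoC 0)) (fun l => Cderiv f z l).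

Lemma Cder_spec (f : C -> C) (z : C) : (exists l, Cderiv f z l) -> Cderiv f z (Cder f z).
Proof. intro H. exact (epsilon_spec _ (fun l => Cderiv f z l) H). Qed.

Lemma holo_Cder (f : C -> C) (z : C) : holomorphic_on in_disc f -> Cmod z < 1 -> Cderiv f z (Cder f z).
Proof. intros H Hz. apply Cder_spec. exact (H z Hz). Qed.

Lemma mean_diff_le (u v : R -> R) (A B T M : R) : 0 < T ->
  is_RInt u 0 T (T * A) -> is_RInt v 0 T (T * B) ->
  (forall t, Rabs (u t - v t) <= M) -> Rabs (A - B) <= M.
Proof.
  intros HT Hu Hv HM.
  assert (I : is_RInt (fun t => u t - v t) 0 T (T * A - T * B)) by exact (is_RInt_minus u v 0 T _ _ Hu Hv).
  assert (L : Rabs (RInt (fun t => u t - v t) 0 T) <= (T - 0) * M).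
  { apply abs_RInt_le_const; [lra | now eexists; apply I | auto]. }
  rewrite (@is_RInt_unique R_CompleteNormedModule _ _ _ _ I) in L.
  replace (T * A - T * B) with (T * (A - B)) in L by ring.
  rewrite Rabs_mult, (Rabs_pos_eq T), Rminus_0_r in L by lra.
  now apply Rmult_le_reg_l with T.
Qed.

(** By the mean value property of the difference quotient, [f' a] is the mean over a circle of
    fixed radius of a function depending continuously on [a]. *)
Lemma Cder_cont (f : C -> C) (a : C) : holomorphic_on in_disc f -> Cmod a < 1 -> Ccont (Cder f) a.
Proof.
  (* A quarter of the distance to the boundary: for [|b - a| < r] the circles of radius [r] about
     [a] and [b] both stay in the disc of radius [2 * r] about [a], where [f] is uniformly
     continuous. *)
  intros Hf Ha e He. set (r := (1 - Cmod a) / 4). assert (Hr : 0 < r) by (unfold r; lra).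
  destruct (unif_cont_disc f a (2 * r)) with (e := e * r / 8) as [d [Hd HU]]; [lra | | nra |].
  { intros z Hz. apply holo_Ccont; auto. apply (disc_open a); auto. unfold r in *; lra. }
  exists (Rmin d r). split; [apply Rmin_pos; auto|]. intros b Hb.
  assert (Hb1 : Cmod (b - a) < d) by (eapply Rlt_le_trans; [exact Hb | apply Rmin_l]).
  assert (Hb2 : Cmod (b - a) < r) by (eapply Rlt_le_trans; [exact Hb | apply Rmin_r]).
  assert (Hbd : Cmod b < 1 - 3 * r) by (pose proof (Cmod_rev_triangle b a); unfold r in *; lra).
  assert (HM : forall c, Cmod c < 1 - 3 * r ->
    is_RInt (fun t => fst (dquot f c (Cder f c) (circ c r t))) 0 (2 * PI) (2 * PI * fst (Cder f c)) /\
    is_RInt (fun t => snd (dquot f c (Cder f c) (circ c r t))) 0 (2 * PI) (2 * PI * snd (Cder f c))).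
  { intros c Hc. pose proof (mean_value (dquot f c (Cder f c)) c (2 * r) r) as M.
    rewrite dquot_eq in M. apply M; [lra | |].
    - apply Ccont_dquot, holo_Cder; auto. lra.
    - intros w Hw. destruct (Hf w) as [m Hm]; [apply (disc_open c); lra|].
      apply (Cderiv_dquot f c _ w m); auto. now apply Cmod_sub_pos. }
  destruct (HM a) as [A1 A2]; [unfold r; lra|]. destruct (HM b Hbd) as [B1 B2].
  assert (Hdiff : forall t, Cmod (dquot f b (Cder f b) (circ b r t) - dquot f a (Cder f a) (circ a r t)) <= e / 4).
  { intro t. pose proof (Cmod_circ a r t ltac:(lra)) as Ea. pose proof (Cmod_circ b r t ltac:(lra)) as Eb.
    assert (Hcis : (r * (cos t, sin t))%C <> 0).
    { intro E. rewrite <- (circ_minus a) in E. rewrite E, Cmod_0 in Ea. lra. }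
    rewrite !dquot_neq by (apply Cmod_sub_pos; lra). rewrite !circ_minus.
    replace ((f (circ b r t) - f b) / (r * (cos t, sin t)) - (f (circ a r t) - f a) / (r * (cos t, sin t)))%C
      with (((f (circ b r t) - f (circ a r t)) - (f b - f a)) / (r * (cos t, sin t)))%C
      by (unfold Cdiv; ring).
    rewrite Cmod_div by auto. rewrite <- (circ_minus a), Ea.
    assert (U1 : Cmod (f b - f a) < e * r / 8) by (apply HU; [rewrite Cmod_self; lra | auto]).
    assert (U2 : Cmod (f (circ b r t) - f (circ a r t)) < e * r / 8).
    { apply HU; [lra|]. replace (circ b r t - circ a r t)%C with (b - a)%C by (unfold circ; ring). auto. }
    apply Rle_div_l; auto. eapply Rle_trans; [apply Cmod_triangle|]. rewrite Cmod_opp. lra. }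
  assert (HPI := PI_RGT_0).
  assert (F1 : Rabs (fst (Cder f b) - fst (Cder f a)) <= e / 4).
  { apply (mean_diff_le _ _ _ _ (2 * PI) _ ltac:(lra) B1 A1). intro t.
    apply Rle_trans with (2 := Hdiff t). apply (Rabs_fst_le (_ - _)%C). }
  assert (F2 : Rabs (snd (Cder f b) - snd (Cder f a)) <= e / 4).
  { apply (mean_diff_le _ _ _ _ (2 * PI) _ ltac:(lra) B2 A2). intro t.
    apply Rle_trans with (2 := Hdiff t). apply (Rabs_snd_le (_ - _)%C). }
  eapply Rle_lt_trans; [apply Cmod_le_sum|].
  change (Rabs (fst (Cder f b) - fst (Cder f a)) + Rabs (snd (Cder f b) - snd (Cder f a)) < e). lra.
Qed.

(** * Curves and logarithms *)

(** Extending a curve to the plane as a function of the real part lets the algebraic rules for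
    [Ccont] be reused for curves. *)
Lemma curve_cont_Ccont (c : R -> C) (t : R) : curve_cont c t <-> Ccont (fun z => c (fst z)) (t, 0).
Proof.
  rewrite curve_cont_iff. split; intros H e He; destruct (H e He) as [d [Hd H1]]; exists d; split; auto.
  - intros w Hw. apply H1. apply Rle_lt_trans with (2 := Hw). apply (Rabs_fst_le (w - (t, 0))).
  - intros s Hs. apply (H1 (s, 0)). 
    replace ((s, 0) - (t, 0))%C with (RtoC (s - t)) by (unfold RtoC, Cminus, Cplus, Copp; simpl; f_equal; ring).
    now rewrite Cmod_R.
Qed.

Lemma curve_cont_mul (c e : R -> C) (t : R) : curve_cont c t -> curve_cont e t ->
  curve_cont (fun s => c s * e s)%C t.
Proof. rewrite !curve_cont_Ccont. apply Ccont_mul. Qed.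
Lemma curve_cont_add (c e : R -> C) (t : R) : curve_cont c t -> curve_cont e t ->
  curve_cont (fun s => c s + e s)%C t.
Proof. rewrite !curve_cont_Ccont. apply Ccont_add. Qed.
Lemma curve_cont_inv (c : R -> C) (t : R) : curve_cont c t -> c t <> 0 -> curve_cont (fun s => / c s)%C t.
Proof. rewrite !curve_cont_Ccont. intros H H0. now apply (Ccont_inv (fun z => c (fst z))). Qed.
Lemma curve_cont_const (k : C) (t : R) : curve_cont (fun _ => k) t.
Proof. rewrite curve_cont_Ccont. apply Ccont_const. Qed.
Lemma curve_cont_real (u : R -> R) (t : R) : continuous u t -> curve_cont (fun s => RtoC (u s)) t.
Proof. intro H. split; simpl; auto. apply continuous_const. Qed.
Lemma curve_cont_Cmod (c : R -> C) (t : R) : curve_cont c t -> continuous (fun s => Cmod (c s)) t.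
Proof.
  rewrite curve_cont_iff. intro H. apply filterlim_locally. intro e.
  destruct (H e (cond_pos e)) as [d [Hd H1]]. exists (mkposreal d Hd). intros s Hs. specialize (H1 s Hs).
  unfold ball; simpl; unfold AbsRing_ball, abs, minus, plus, opp; simpl.
  pose proof (Cmod_rev_triangle (c s) (c t)). pose proof (Cmod_rev_triangle (c t) (c s)).
  rewrite Cmod_minus_sym in H2. apply Rabs_def1; lra.
Qed.
Lemma curve_cont_reparam (c : R -> C) (u : R -> R) (t : R) : continuous u t -> curve_cont c (u t) ->
  curve_cont (fun s => c (u s)) t.
Proof.
  intros Hu [H1 H2]. split.
  - apply (continuous_comp u (fun s => fst (c s))); auto.
  - apply (continuous_comp u (fun s => snd (c s))); auto.
Qed.

Definition Rderiv (c : R -> C) (t : R) (l : C) : Prop :=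
  is_derive (fun s => fst (c s)) t (fst l) /\ is_derive (fun s => snd (c s)) t (snd l).

Lemma is_derive_eps (f : R -> R) (t l : R) : is_derive f t l <->
  forall e, 0 < e -> exists d, 0 < d /\ forall s, Rabs (s - t) < d ->
    Rabs (f s - f t - (s - t) * l) <= e * Rabs (s - t).
Proof.
  rewrite is_derive_Reals. split.
  - intros H e He. destruct (H e He) as [d Hd]. exists d. split; [apply cond_pos|].
    intros s Hs. destruct (Req_dec (s - t) 0) as [E|Hn].
    { replace s with t by lra. replace (f t - f t - (t - t) * l) with 0 by ring. rewrite Rminus_diag, Rabs_R0. lra. }
    specialize (Hd (s - t) Hn Hs). replace (t + (s - t)) with s in Hd by ring.
    replace (f s - f t - (s - t) * l) with (((f s - f t) / (s - t) - l) * (s - t)) by (field; auto).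
    rewrite Rabs_mult. apply Rmult_le_compat_r; [apply Rabs_pos | lra].
  - intros H e He. destruct (H (e / 2)) as [d [Hd H1]]; [lra|]. exists (mkposreal d Hd).
    intros h Hn Hh. simpl in Hh. specialize (H1 (t + h)). replace (t + h - t) with h in H1 by ring.
    specialize (H1 Hh).
    replace ((f (t + h) - f t) / h - l) with ((f (t + h) - f t - h * l) / h) by (field; auto).
    pose proof (Rabs_pos_lt h Hn). rewrite Rabs_div by auto. apply Rlt_div_l; [auto|]. nra.
Qed.

Lemma Rderiv_iff (c : R -> C) (t : R) (l : C) : Rderiv c t l <->
  forall e, 0 < e -> exists d, 0 < d /\ forall s, Rabs (s - t) < d ->
    Cmod (c s - c t - RtoC (s - t) * l) <= e * Rabs (s - t).
Proof.
  unfold Rderiv. rewrite !is_derive_eps. split.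
  - intros [H1 H2] e He. destruct (H1 (e / 2)) as [d1 [P1 Q1]]; [lra|].
    destruct (H2 (e / 2)) as [d2 [P2 Q2]]; [lra|].
    exists (Rmin d1 d2). split; [apply Rmin_pos; auto|]. intros s Hs.
    assert (A := Q1 s ltac:(eapply Rlt_le_trans; [exact Hs | apply Rmin_l])).
    assert (B := Q2 s ltac:(eapply Rlt_le_trans; [exact Hs | apply Rmin_r])).
    eapply Rle_trans; [apply Cmod_le_sum|].
    unfold Cminus, Cplus, Copp, Cmult, RtoC; simpl.
    replace (fst (c s) + - fst (c t) + - ((s - t) * fst l - 0 * snd l)) with (fst (c s) - fst (c t) - (s - t) * fst l) by ring.
    replace (snd (c s) + - snd (c t) + - ((s - t) * snd l + 0 * fst l)) with (snd (c s) - snd (c t) - (s - t) * snd l) by ring.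
    lra.
  - intro H. split; intros e He; destruct (H e He) as [d [Hd H1]]; exists d; split; auto;
      intros s Hs; specialize (H1 s Hs); apply Rle_trans with (2 := H1).
    + apply Rle_trans with (2 := Rabs_fst_le _). unfold Cminus, Cplus, Copp, Cmult, RtoC; simpl. right. f_equal. ring.
    + apply Rle_trans with (2 := Rabs_snd_le _). unfold Cminus, Cplus, Copp, Cmult, RtoC; simpl. right. f_equal. ring.
Qed.

Lemma Rderiv_cont (c : R -> C) (t : R) (l : C) : Rderiv c t l -> curve_cont c t.
Proof.
  intros [H1 H2]. split; apply (@ex_derive_continuous R_AbsRing R_NormedModule); eexists; eassumption.
Qed.

Lemma Rderiv_eq (c : R -> C) (t : R) (l l' : C) : l = l' -> Rderiv c t l -> Rderiv c t l'.
Proof. now intros ->. Qed.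

Lemma Rderiv_const (k : C) (t : R) : Rderiv (fun _ => k) t 0.
Proof. split; apply (is_derive_const (V := R_NormedModule)). Qed.

Lemma Rderiv_add (c e : R -> C) (t : R) (l m : C) : Rderiv c t l -> Rderiv e t m ->
  Rderiv (fun s => c s + e s)%C t (l + m).
Proof. intros [H1 H2] [H3 H4]. split; simpl; now apply (is_derive_plus (V := R_NormedModule)). Qed.

Lemma Rderiv_mul (c e : R -> C) (t : R) (l m : C) : Rderiv c t l -> Rderiv e t m ->
  Rderiv (fun s => c s * e s)%C t (l * e t + c t * m).
Proof.
  intros [H1 H2] [H3 H4]. rewrite is_derive_Reals in H1, H2, H3, H4. split; simpl; apply is_derive_Reals.
  - replace (fst l * fst (e t) - snd l * snd (e t) + (fst (c t) * fst m - snd (c t) * snd m))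
      with ((fst l * fst (e t) + fst (c t) * fst m) - (snd l * snd (e t) + snd (c t) * snd m)) by ring.
    apply derivable_pt_lim_minus; now apply derivable_pt_lim_mult.
  - replace (fst l * snd (e t) + snd l * fst (e t) + (fst (c t) * snd m + snd (c t) * fst m))
      with ((fst l * snd (e t) + fst (c t) * snd m) + (snd l * fst (e t) + snd (c t) * fst m)) by ring.
    apply derivable_pt_lim_plus; now apply derivable_pt_lim_mult.
Qed.

Lemma Rderiv_scal (k : C) (c : R -> C) (t : R) (l : C) : Rderiv c t l -> Rderiv (fun s => k * c s)%C t (k * l).
Proof.
  intro H. eapply Rderiv_eq; [|apply (Rderiv_mul _ _ t _ _ (Rderiv_const k t) H)]. ring.
Qed.

Lemma Rderiv_reparam (c : R -> C) (u : R -> R) (t k : R) (l : C) : is_derive u t k -> Rderiv c (u t) l ->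
  Rderiv (fun s => c (u s)) t (k * l).
Proof.
  intros Hu [H1 H2]. split.
  - replace (fst (k * l)%C) with (k * fst l) by (simpl; ring). apply (is_derive_comp (fun s => fst (c s)) u); auto.
  - replace (snd (k * l)%C) with (k * snd l) by (simpl; ring). apply (is_derive_comp (fun s => snd (c s)) u); auto.
Qed.

Lemma Rderiv_id_mul (b : C) (t : R) : Rderiv (fun s => s * b)%C t b.
Proof.
  split; simpl; auto_derive; auto; ring.
Qed.

Lemma Rderiv_comp (f : C -> C) (c : R -> C) (t : R) (l m : C) :
  Rderiv c t l -> Cderiv f (c t) m -> Rderiv (fun s => f (c s)) t (m * l).
Proof.
  intros Hc Hf. pose proof (proj1 (curve_cont_iff _ _) (Rderiv_cont _ _ _ Hc)) as Cc.
  rewrite Rderiv_iff in *. intros e He.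
  pose proof (Cmod_ge_0 l). pose proof (Cmod_ge_0 m).
  set (q := e / (2 * (Cmod l + 1))). assert (Hq : 0 < q) by (apply Rdiv_lt_0_compat; lra).
  set (p := Rmin 1 (e / (2 * (Cmod m + 1)))).
  assert (Hp : 0 < p) by (apply Rmin_pos; [lra | apply Rdiv_lt_0_compat; lra]).
  assert (Hp1 := Rmin_l 1 (e / (2 * (Cmod m + 1)))). assert (Hp2 := Rmin_r 1 (e / (2 * (Cmod m + 1)))).
  fold p in Hp1, Hp2. clearbody p.
  destruct (Hf q Hq) as [d1 [P1 Q1]]. destruct (Hc p Hp) as [d2 [P2 Q2]]. destruct (Cc d1 P1) as [d3 [P3 Q3]].
  exists (Rmin d2 d3). split; [apply Rmin_pos; auto|]. intros s Hs.
  assert (A := Q2 s ltac:(eapply Rlt_le_trans; [exact Hs | apply Rmin_l])).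
  assert (B := Q1 _ (Q3 s ltac:(eapply Rlt_le_trans; [exact Hs | apply Rmin_r]))).
  replace (f (c s) - f (c t) - RtoC (s - t) * (m * l))%C with
    ((f (c s) - f (c t) - m * (c s - c t)) + m * (c s - c t - RtoC (s - t) * l))%C by ring.
  eapply Rle_trans; [apply Cmod_triangle|]. rewrite Cmod_mult.
  pose proof (Rabs_pos (s - t)) as Hst.
  assert (D : Cmod (c s - c t) <= (Cmod l + 1) * Rabs (s - t)).
  { replace (c s - c t)%C with ((c s - c t - RtoC (s - t) * l) + RtoC (s - t) * l)%C by ring.
    eapply Rle_trans; [apply Cmod_triangle|]. rewrite Cmod_mult, Cmod_R. nra. }
  assert (X1 : q * Cmod (c s - c t) <= e / 2 * Rabs (s - t)).
  { apply Rle_trans with (q * ((Cmod l + 1) * Rabs (s - t))); [apply Rmult_le_compat_l; lra|].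
    right. unfold q. field. lra. }
  assert (X2 : Cmod m * Cmod (c s - c t - RtoC (s - t) * l) <= e / 2 * Rabs (s - t)).
  { apply Rle_trans with (Cmod m * (e / (2 * (Cmod m + 1)) * Rabs (s - t))).
    - apply Rmult_le_compat_l; [lra|]. apply Rle_trans with (1 := A). apply Rmult_le_compat_r; lra.
    - rewrite <- Rmult_assoc. apply Rmult_le_compat_r; [lra|].
      replace (Cmod m * (e / (2 * (Cmod m + 1)))) with (e / 2 * (Cmod m / (Cmod m + 1))) by (field; lra).
      rewrite <- (Rmult_1_r (e / 2)) at 2. apply Rmult_le_compat_l; [lra|]. apply Rle_div_l; lra. }
  lra.
Qed.

Lemma Rderiv_zero_const (c : R -> C) : (forall t, Rderiv c t 0) -> forall t, c t = c 0.
Proof.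
  intros H.
  assert (G : forall a b, a < b -> c a = c b).
  { intros a b Hab. rewrite (surjective_pairing (c a)), (surjective_pairing (c b)). f_equal.
    - apply (eq_is_derive (V := R_NormedModule) (fun s => fst (c s))); auto. intros t _. apply (H t).
    - apply (eq_is_derive (V := R_NormedModule) (fun s => snd (c s))); auto. intros t _. apply (H t). }
  intro t. destruct (Rtotal_order t 0) as [L|[->|L]]; auto. symmetry; auto.
Qed.

Lemma is_derive_primitive (k : R -> R) (t : R) : (forall s, continuous k s) -> is_derive (fun s => RInt k 0 s) t (k t).
Proof.
  intro H. apply (is_derive_RInt (V := R_CompleteNormedModule) k (fun s => RInt k 0 s) 0); auto.
  apply filter_forall. intro s. apply (RInt_correct (V := R_CompleteNormedModule)).
  apply (ex_RInt_continuous (V := R_CompleteNormedModule)). auto.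
Qed.

Definition Cprim (psi : R -> C) (t : R) : C :=
  (RInt (fun s => fst (psi s)) 0 t, RInt (fun s => snd (psi s)) 0 t).

Lemma Rderiv_Cprim (psi : R -> C) (t : R) : (forall s, curve_cont psi s) -> Rderiv (Cprim psi) t (psi t).
Proof.
  intro H. split; simpl.
  - apply (is_derive_primitive (fun s => fst (psi s))). intro s. apply H.
  - apply (is_derive_primitive (fun s => snd (psi s))). intro s. apply H.
Qed.

Lemma Cprim_0 (psi : R -> C) : Cprim psi 0 = 0.
Proof. unfold Cprim. now rewrite !RInt_point. Qed.

(** [t -> c t * exp (- l t)] is constant when [l] is a primitive of [c' / c]. *)
Lemma exp_primitive (c c' : R -> C) (c0 : C) :
  (forall t, Rderiv c t (c' t)) -> (forall t, curve_cont c' t) -> (forall t, c t <> 0) -> Cexp c0 = c 0 ->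
  let l := fun t => (c0 + Cprim (fun s => c' s / c s)%C t)%C in
  (forall t, Rderiv l t (c' t / c t)) /\ forall t, c t = Cexp (l t).
Proof.
  intros Hc Hc' Hn H0 l.
  assert (Hl : forall t, Rderiv l t (c' t / c t)).
  { intro t. eapply Rderiv_eq; [|apply Rderiv_add; [apply Rderiv_const | apply Rderiv_Cprim]].
    - ring.
    - intro s. apply curve_cont_mul; auto. apply curve_cont_inv; auto. exact (Rderiv_cont _ _ _ (Hc s)). }
  split; auto. intro t.
  assert (E := Rderiv_zero_const (fun t => c t * Cexp (- (1) * l t))%C).
  assert (E' : forall t, (c t * Cexp (- (1) * l t) = 1)%C).
  { intro s. rewrite E.
    - unfold l. rewrite Cprim_0. replace (- (1) * (c0 + 0))%C with (- c0)%C by ring.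
      rewrite Cexp_opp, H0. field. auto.
    - intro u. eapply Rderiv_eq; [|apply Rderiv_mul; [apply Hc|]].
      2:{ apply (Rderiv_comp Cexp); [apply Rderiv_scal, Hl | apply Cderiv_Cexp]. }
      simpl. field. auto. }
  specialize (E' t). replace (- (1) * l t)%C with (- l t)%C in E' by ring. rewrite Cexp_opp in E'.
  pose proof (Cexp_neq_0 (l t)). replace (c t) with (c t * / Cexp (l t) * Cexp (l t))%C by (field; auto).
  rewrite E'. ring.
Qed.

(** The factor [6] makes the integral over [[0, 1]] equal to [1]. The primitive [smooth] is thus a
    [C^1] map of the whole line onto [[0, 1]], stationary outside it. Composition with it gives a
    curve that is controlled at all real times and comes to rest at both ends. *)
Definition bump (t : R) : R := Rmax 0 (6 * t * (1 - t)).
Definition smooth (t : R) : R := RInt bump 0 t.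

Lemma bump_cont (t : R) : continuous bump t.
Proof.
  assert (E : forall s, (6 * s * (1 - s) + Rabs (6 * s * (1 - s))) / 2 = bump s).
  { intro s. unfold bump, Rmax. destruct (Rle_dec 0 (6 * s * (1 - s))).
    - rewrite Rabs_pos_eq by auto. field.
    - rewrite Rabs_left by lra. field. }
  apply (continuous_ext _ _ _ E). apply continuity_pt_filterlim. reg.
Qed.
Lemma bump_ge_0 (t : R) : 0 <= bump t.
Proof. apply Rmax_l. Qed.
Lemma bump_le_2 (t : R) : bump t <= 2.
Proof. apply Rmax_lub; [lra|]. pose proof (pow2_ge_0 (t - 1/2)). nra. Qed.
Lemma bump_out (t : R) : t <= 0 \/ 1 <= t -> bump t = 0.
Proof. intro H. apply Rmax_left. destruct H; nra. Qed.
Lemma bump_in (t : R) : 0 <= t <= 1 -> bump t = 6 * t * (1 - t).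
Proof. intro H. apply Rmax_right. apply Rmult_le_pos; nra. Qed.

Lemma is_derive_smooth (t : R) : is_derive smooth t (bump t).
Proof. apply is_derive_primitive, bump_cont. Qed.
Lemma smooth_cont (t : R) : continuous smooth t.
Proof. apply (@ex_derive_continuous R_AbsRing R_NormedModule). eexists. apply is_derive_smooth. Qed.

Lemma smooth_le_0 (t : R) : t <= 0 -> smooth t = 0.
Proof.
  intro H. unfold smooth. rewrite (RInt_ext _ (fun _ => 0)).
  - rewrite RInt_const. unfold scal; simpl; unfold mult; simpl. ring.
  - intros s Hs. rewrite Rmin_right, Rmax_left in Hs by auto. apply bump_out. lra.
Qed.
Lemma smooth_1 : smooth 1 = 1.
Proof.
  unfold smooth. rewrite (RInt_ext _ (fun t => 6 * t * (1 - t))).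
  - assert (I := is_RInt_derive (V := R_CompleteNormedModule) (fun t => 3 * t ^ 2 - 2 * t ^ 3) (fun t => 6 * t * (1 - t)) 0 1).
    apply (@is_RInt_unique R_CompleteNormedModule).
    replace 1 with (minus (3 * 1 ^ 2 - 2 * 1 ^ 3) (3 * 0 ^ 2 - 2 * 0 ^ 3)) at 2
      by (unfold minus, plus, opp; simpl; ring).
    apply I.
    + intros x _. auto_derive; auto. ring.
    + intros x _. apply continuity_pt_filterlim. reg.
  - intros s. rewrite Rmin_left, Rmax_right by lra. intro Hs. apply bump_in. lra.
Qed.
Lemma ex_RInt_bump (a b : R) : ex_RInt bump a b.
Proof. apply (ex_RInt_continuous (V := R_CompleteNormedModule)). intros; apply bump_cont. Qed.
Lemma smooth_ge_1 (t : R) : 1 <= t -> smooth t = 1.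
Proof.
  intro H. unfold smooth. rewrite <- (RInt_Chasles (V := R_CompleteNormedModule) bump 0 1 t) by apply ex_RInt_bump.
  fold (smooth 1). rewrite smooth_1, (RInt_ext _ (fun _ => 0)).
  - rewrite RInt_const. unfold plus, scal; simpl; unfold mult; simpl. ring.
  - intros s Hs. rewrite Rmin_left, Rmax_right in Hs by auto. apply bump_out. lra.
Qed.
Lemma smooth_mono (s t : R) : s <= t -> smooth s <= smooth t.
Proof.
  intro H. unfold smooth. rewrite <- (RInt_Chasles (V := R_CompleteNormedModule) bump 0 s t) by apply ex_RInt_bump.
  assert (0 <= RInt bump s t) by (apply RInt_ge_0; auto; [apply ex_RInt_bump | intros; apply bump_ge_0]).
  unfold plus; simpl. lra.
Qed.
Lemma smooth_0 : smooth 0 = 0.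
Proof. apply smooth_le_0; lra. Qed.
Lemma smooth_range (t : R) : 0 <= smooth t <= 1.
Proof.
  split.
  - destruct (Rle_dec t 0); [rewrite smooth_le_0; lra|]. rewrite <- smooth_0. apply smooth_mono. lra.
  - destruct (Rle_dec 1 t); [rewrite smooth_ge_1; lra|]. rewrite <- smooth_1. apply smooth_mono. lra.
Qed.

(** A continuous logarithm of a differentiable function is differentiable. With
    [E u = (exp u - 1) / u], where [E 0 = 1], the increment [q w - q z] equals
    [(h w - h z) / (h z * E (q w - q z))], and the denominator stays away from zero near [z]. *)
Lemma Cderiv_log (h q : C -> C) (z l : C) (r : R) : 0 < r ->
  (forall w, Cmod (w - z) < r -> h w = Cexp (q w)) -> Ccont q z -> Cderiv h z l -> Cderiv q z (l / h z).
Proof.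
  intros Hr HE Hq Hh. apply Cderiv_iff in Hh. destruct Hh as (H & s & Hs & CH & HHz & HH).
  set (E := dquot Cexp 0 1). pose proof (Ccont_dquot Cexp 0 1 Cderiv_Cexp_0) as CE. fold E in CE.
  assert (Hz : h z = Cexp (q z)) by (apply HE; rewrite Cmod_self; lra).
  assert (Hz0 : h z <> 0) by (rewrite Hz; apply Cexp_neq_0).
  assert (Cd : Ccont (fun w => E (q w - q z)%C) z).
  { apply (Ccont_comp E (fun w => q w - q z)%C).
    - apply Ccont_add; auto. apply Ccont_const.
    - replace (q z - q z)%C with (RtoC 0) by ring. auto. }
  assert (E0 : E (q z - q z)%C = 1).
  { replace (q z - q z)%C with (RtoC 0) by ring. apply dquot_eq. }
  destruct (Ccont_neq _ z Cd) as (d & Pd & Qd); [rewrite E0; intro X; injection X; lra|].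
  apply Cderiv_iff. exists (fun w => H w * / (h z * E (q w - q z)%C))%C, (Rmin (Rmin r s) d).
  split; [repeat apply Rmin_pos; auto|]. split; [|split].
  - apply Ccont_mul; auto. apply (Ccont_inv (fun w => h z * E (q w - q z))%C).
    + apply Ccont_mul; auto. apply Ccont_const.
    + rewrite E0. apply Cmult_neq_0; auto. intro X; injection X; lra.
  - rewrite E0, HHz. field. auto.
  - intros w Hw. pose proof (Rmin_l (Rmin r s) d). pose proof (Rmin_r (Rmin r s) d).
    pose proof (Rmin_l r s). pose proof (Rmin_r r s).
    specialize (Qd w ltac:(lra)). specialize (HH w ltac:(lra)). specialize (HE w ltac:(lra)).
    assert (EE : (Cexp (q w - q z) - 1 = E (q w - q z) * (q w - q z))%C).
    { unfold E. destruct (Ceq_dec (q w - q z)%C 0) as [X|X].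
      - rewrite X, Cexp_0. ring.
      - rewrite dquot_neq, Cexp_0 by auto. field. 
        replace (q w - q z - 0)%C with (q w - q z)%C by ring. auto. }
    assert (Hd : (H w * (w - z) = h z * (Cexp (q w - q z) - 1))%C).
    { replace (H w * (w - z))%C with (h w - h z)%C by (rewrite HH; ring).
      rewrite HE, Hz. unfold Cminus at 3. rewrite Cexp_add, Cexp_opp. field. apply Cexp_neq_0. }
    replace (H w * / (h z * E (q w - q z)) * (w - z))%C with (H w * (w - z) * / (h z * E (q w - q z)))%C by ring.
    rewrite Hd, EE. field. auto.
Qed.

Lemma Cmod_real_scale (s : R) (z : C) : 0 <= s <= 1 -> Cmod (s * z) <= Cmod z.
Proof. intro Hs. rewrite Cmod_mult, Cmod_R, Rabs_pos_eq by lra. pose proof (Cmod_ge_0 z). nra. Qed.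

Lemma is_RInt_Cprim_1 (psi : R -> C) : (forall s, curve_cont psi s) ->
  is_RInt (fun s => fst (psi s)) 0 1 (1 * fst (Cprim psi 1)) /\
  is_RInt (fun s => snd (psi s)) 0 1 (1 * snd (Cprim psi 1)).
Proof.
  intro H. rewrite !Rmult_1_l. split; apply (RInt_correct (V := R_CompleteNormedModule));
    apply (ex_RInt_continuous (V := R_CompleteNormedModule)); intros s _; apply H.
Qed.

(** The logarithm [q z] is the integral of [h' / h] along the ray from [0] to [z], run through by
    [smooth]. [exp_primitive] on each ray gives [h = exp q]. Uniform continuity of [h' / h] on a
    smaller disc gives continuity of [q], and [Cderiv_log] turns that into differentiability. *)
Lemma log_exists (h : C -> C) : holomorphic_on in_disc h -> (forall z, Cmod z < 1 -> h z <> 0) ->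
  exists q, forall z, Cmod z < 1 -> h z = Cexp (q z) /\ Cderiv q z (Cder h z / h z).
Proof.
  intros Hh Hn.
  destruct (polar (h 0)) as [c0 Hc0]; [apply Hn; rewrite Cmod_0; lra|].
  set (phi := fun z => (Cder h z / h z)%C).
  assert (Cphi : forall z, Cmod z < 1 -> Ccont phi z).
  { intros z Hz. apply Ccont_mul; [now apply Cder_cont|]. apply Ccont_inv; auto. now apply holo_Ccont. }
  set (psi := fun z t => (bump t * z * phi (smooth t * z))%C).
  set (q := fun z => (c0 + Cprim (psi z) 1)%C).
  assert (Hin : forall z t, Cmod z < 1 -> Cmod (smooth t * z) < 1).
  { intros z t Hz. apply Rle_lt_trans with (2 := Hz). apply Cmod_real_scale, smooth_range. }
  assert (Hray : forall z t, Rderiv (fun t => smooth t * z)%C t (bump t * z)).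
  { intros z t. eapply Rderiv_eq; [|apply (Rderiv_mul (fun t => RtoC (smooth t)) (fun _ => z) t (bump t) 0); [|apply Rderiv_const]].
    - ring.
    - split; simpl; [apply is_derive_smooth | apply (is_derive_const (V := R_NormedModule))]. }
  assert (Cpsi : forall z, Cmod z < 1 -> forall t, curve_cont (psi z) t).
  { intros z Hz t. apply curve_cont_mul; [apply curve_cont_mul|].
    - apply curve_cont_real, bump_cont.
    - apply curve_cont_const.
    - apply (curve_cont_comp phi (fun t => smooth t * z)%C); auto. exact (Rderiv_cont _ _ _ (Hray z t)). }
  assert (Eq : forall z, Cmod z < 1 -> h z = Cexp (q z)).
  { intros z Hz.
    destruct (exp_primitive (fun t => h (smooth t * z)%C) (fun t => Cder h (smooth t * z) * (bump t * z))%C c0) as [_ E].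
    - intro t. apply (Rderiv_comp h (fun t => smooth t * z)%C); auto. apply holo_Cder; auto.
    - intro t. apply curve_cont_mul.
      + apply (curve_cont_comp (Cder h) (fun t => smooth t * z)%C); [exact (Rderiv_cont _ _ _ (Hray z t)) | now apply Cder_cont; auto].
      + apply curve_cont_mul; [apply curve_cont_real, bump_cont | apply curve_cont_const].
    - intro t. auto.
    - rewrite smooth_0. rewrite Hc0. f_equal. ring.
    - specialize (E 1). rewrite smooth_1 in E. replace (1 * z)%C with z in E by ring. rewrite E.
      f_equal. unfold q. f_equal. unfold Cprim. f_equal; apply RInt_ext; intros t _; f_equal; unfold psi, phi; field; auto. }
  exists q. intros z Hz. split; auto.
  apply (Cderiv_log h q z _ (1 - Cmod z)); [lra | intros w Hw; apply Eq; now apply (disc_open z) | | now apply holo_Cder].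
  intros e He.
  set (r := (1 + Cmod z) / 2). pose proof (Cmod_ge_0 z) as Hz0.
  assert (Hball : forall p, Cmod (p - 0) <= r -> Ccont phi p).
  { intros p Hp. apply Cphi. replace (p - 0)%C with p in Hp by ring. unfold r in Hp; lra. }
  destruct (max_on_disc (fun p => Cmod (phi p)) 0 r) as [m [_ Hm]]; [unfold r; lra | |].
  { intros p Hp e0 He0. destruct (Hball p Hp e0 He0) as [d [Pd Qd]]. exists d. split; auto.
    intros w Hw. specialize (Qd w Hw).
    pose proof (Cmod_rev_triangle (phi w) (phi p)). pose proof (Cmod_rev_triangle (phi p) (phi w)).
    rewrite Cmod_minus_sym in H0. apply Rabs_def1; lra. }
  set (B := Cmod (phi m)) in *. pose proof (Cmod_ge_0 (phi m)) as HB. fold B in HB.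
  destruct (unif_cont_disc phi 0 r ltac:(unfold r; lra) Hball (e / 16) ltac:(lra)) as [d [Pd Qd]].
  (* Each of the two terms of [psi w - psi z] is at most [e / 16] before multiplication by
     [bump <= 2], which yields the bound [e / 4] below. *)
  set (d' := Rmin (Rmin d (1 - Cmod z)) (e / (16 * (B + 1)))).
  exists d'. split.
  { repeat apply Rmin_pos; auto; [lra | apply Rdiv_lt_0_compat; lra]. }
  intros w Hw.
  assert (Hw1 : Cmod (w - z) < d /\ Cmod (w - z) < 1 - Cmod z /\ Cmod (w - z) < e / (16 * (B + 1))).
  { unfold d' in Hw. pose proof (Rmin_l (Rmin d (1 - Cmod z)) (e / (16 * (B + 1)))).
    pose proof (Rmin_r (Rmin d (1 - Cmod z)) (e / (16 * (B + 1)))).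
    pose proof (Rmin_l d (1 - Cmod z)). pose proof (Rmin_r d (1 - Cmod z)). repeat split; lra. }
  destruct Hw1 as (W1 & W2 & W3). assert (Hwd : Cmod w < 1) by now apply (disc_open z).
  assert (Hdiff : forall t, Cmod (psi w t - psi z t) <= e / 4).
  { intro t. unfold psi.
    replace (bump t * w * phi (smooth t * w) - bump t * z * phi (smooth t * z))%C with
      (bump t * (w * (phi (smooth t * w) - phi (smooth t * z)) + (w - z) * phi (smooth t * z)))%C by ring.
    rewrite Cmod_mult, Cmod_R, Rabs_pos_eq by apply bump_ge_0.
    assert (Hsz : Cmod (smooth t * z - 0) <= r).
    { replace (smooth t * z - 0)%C with (smooth t * z)%C by ring.
      pose proof (Cmod_real_scale (smooth t) z (smooth_range t)). unfold r; lra. }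
    assert (X : Cmod (phi (smooth t * w)%C - phi (smooth t * z)%C) < e / 16).
    { apply Qd; auto. replace (smooth t * w - smooth t * z)%C with (smooth t * (w - z))%C by ring.
      pose proof (Cmod_real_scale (smooth t) (w - z)%C (smooth_range t)). lra. }
    assert (Y : Cmod (w - z) * Cmod (phi (smooth t * z)%C) <= e / 16).
    { specialize (Hm _ Hsz). simpl in Hm. fold B in Hm.
      apply Rle_trans with (e / (16 * (B + 1)) * B).
      - apply Rmult_le_compat; try apply Cmod_ge_0; lra.
      - replace (e / (16 * (B + 1)) * B) with (e / 16 * (B / (B + 1))) by (field; lra).
        rewrite <- (Rmult_1_r (e / 16)) at 2. apply Rmult_le_compat_l; [lra|]. apply Rle_div_l; lra. }
    pose proof (Cmod_triangle (w * (phi (smooth t * w) - phi (smooth t * z)))%C ((w - z) * phi (smooth t * z))%C) as T.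
    rewrite !Cmod_mult in T.
    pose proof (bump_ge_0 t). pose proof (bump_le_2 t). pose proof (Cmod_ge_0 w).
    pose proof (Cmod_ge_0 (phi (smooth t * w)%C - phi (smooth t * z)%C)).
    set (T0 := Cmod (w * (phi (smooth t * w)%C - phi (smooth t * z)%C) + (w - z) * phi (smooth t * z)%C)) in *.
    pose proof (Cmod_ge_0 (w * (phi (smooth t * w)%C - phi (smooth t * z)%C) + (w - z) * phi (smooth t * z)%C)) as T0p.
    fold T0 in T0p.
    assert (T0 <= e / 8) by nra. nra. }
  destruct (is_RInt_Cprim_1 (psi z) (Cpsi z Hz)) as [Z1 Z2].
  destruct (is_RInt_Cprim_1 (psi w) (Cpsi w Hwd)) as [W4 W5].
  assert (F1 : Rabs (fst (Cprim (psi w) 1) - fst (Cprim (psi z) 1)) <= e / 4).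
  { apply (mean_diff_le _ _ _ _ 1 _ ltac:(lra) W4 Z1). intro t.
    apply Rle_trans with (2 := Hdiff t). apply (Rabs_fst_le (_ - _)%C). }
  assert (F2 : Rabs (snd (Cprim (psi w) 1) - snd (Cprim (psi z) 1)) <= e / 4).
  { apply (mean_diff_le _ _ _ _ 1 _ ltac:(lra) W5 Z2). intro t.
    apply Rle_trans with (2 := Hdiff t). apply (Rabs_snd_le (_ - _)%C). }
  replace (q w - q z)%C with (Cprim (psi w) 1 - Cprim (psi z) 1)%C by (unfold q; ring).
  eapply Rle_lt_trans; [apply Cmod_le_sum|].
  change (Rabs (fst (Cprim (psi w) 1) - fst (Cprim (psi z) 1)) + Rabs (snd (Cprim (psi w) 1) - snd (Cprim (psi z) 1)) < e). lra.
Qed.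

Lemma Cmod_le_sqr (a b : C) : Cmod a ^ 2 <= Cmod b ^ 2 -> Cmod a <= Cmod b.
Proof. intro H. pose proof (Cmod_ge_0 a). pose proof (Cmod_ge_0 b). apply Rnot_lt_le. intro. nra. Qed.

(** The Schwarz lemma for the Cayley-type quotient [(p - p x) / (p + conj (p x))], [p = - log h]. *)
Lemma Schwarz_nonvanishing (h : C -> C) (x l : C) : holomorphic_on in_disc h ->
  (forall z, Cmod z < 1 -> h z <> 0 /\ Cmod (h z) <= 1) -> Cmod x < 1 -> Cderiv h x l ->
  Cmod l * (1 - Cmod x ^ 2) <= - 2 * ln (Cmod (h x)) * Cmod (h x).
Proof.
  intros Hh Hb Hx Hl.
  destruct (log_exists h Hh) as [q Hq]; [apply Hb|].
  assert (Hre : forall z, Cmod z < 1 -> fst (q z) = ln (Cmod (h z)) /\ fst (q z) <= 0).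
  { intros z Hz. destruct (Hq z Hz) as [E _]. destruct (Hb z Hz) as [_ B].
    rewrite E, Cmod_Cexp in *. rewrite ln_exp. split; auto.
    apply Rnot_lt_le. intro X. apply exp_increasing in X. rewrite exp_0 in X. lra. }
  destruct (Hb x Hx) as [Hx0 _]. pose proof (Cmod_pos _ Hx0) as Hp.
  cut (Cmod l * (1 - Cmod x ^ 2) / Cmod (h x) <= - 2 * ln (Cmod (h x))).
  { intro H. now apply (Rle_div_l _ _ (Cmod (h x))) in H. }
  apply le_epsilon. intros e He.
  (* As [|h|] may equal [1], the shift by [e / 2] is what makes the real part of [p] strictly
     positive; it costs the [e] removed by [le_epsilon]. *)
  set (p := fun z => (- (1) * q z + RtoC (e / 2))%C).
  assert (Dp : forall z, Cmod z < 1 -> Cderiv p z (- (1) * (Cder h z / h z))).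
  { intros z Hz. eapply Cderiv_eq; [|apply Cderiv_add; [apply Cderiv_scal, Hq; auto | apply Cderiv_const]]. ring. }
  assert (Rp : forall z, Cmod z < 1 -> 0 < fst (p z)).
  { intros z Hz. destruct (Hre z Hz) as [_ H]. unfold p; simpl. lra. }
  pose proof (Rp x Hx) as Rpx.
  assert (Hden : forall z, Cmod z < 1 -> (p z + Cconj (p x))%C <> 0).
  { intros z Hz X. apply (f_equal fst) in X. specialize (Rp z Hz). revert X.
    change (fst (p z) + fst (p x) = 0 -> False). lra. }
  set (f := fun z => ((p z - p x) / (p z + Cconj (p x)))%C).
  assert (Df : forall z, Cmod z < 1 -> Cderiv f z
     (((- (1) * (Cder h z / h z) - 0) * (p z + Cconj (p x)) - (p z - p x) * (- (1) * (Cder h z / h z) + 0)) /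
       ((p z + Cconj (p x)) * (p z + Cconj (p x))))).
  { intros z Hz. apply (Cderiv_div (fun z => p z - p x)%C (fun z => p z + Cconj (p x))%C); auto.
    - apply Cderiv_sub; [auto | apply Cderiv_const].
    - apply Cderiv_add; [auto | apply Cderiv_const]. }
  (* The quotient [f] vanishes at [x], so its derivative there is [p' x / (2 * Re (p x))], and
     [p' = - h' / h]. *)
  assert (S := Schwarz_at f x (- (1) * (l / h x) / (2 * fst (p x)))).
  assert (S' : Cmod (- (1) * (l / h x) / (2 * fst (p x))) * (1 - Cmod x ^ 2) <= 1).
  { apply S; auto.
    - intros z Hz. eexists. apply Df, Hz.
    - intros z Hz. unfold f. rewrite Cmod_div by auto.
      apply Rle_div_l; [now apply Cmod_pos, Hden|]. rewrite Rmult_1_l. apply Cmod_le_sqr.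
      rewrite !Cmod_sqr. specialize (Rp z Hz). destruct (p z) as [u1 u2], (p x) as [v1 v2]. simpl in *. nra.
    - unfold f. unfold Cdiv. ring.
    - eapply Cderiv_eq; [|apply Df, Hx]. rewrite (Cderiv_unique h x _ _ (holo_Cder h x Hh Hx) Hl).
      replace (p x + Cconj (p x))%C with (2 * fst (p x))%C.
      2:{ destruct (p x) as [v1 v2]. unfold Cconj, Cplus, Cmult, RtoC; simpl. f_equal; ring. }
      field. repeat split; auto; intro X; apply RtoC_inj in X; lra. }
  rewrite Cmod_div, Cmod_mult, Cmod_div in S'; auto.
  2:{ rewrite <- RtoC_mult; intro X; apply RtoC_inj in X; lra. }
  rewrite Cmod_opp, Cmod_1, Rmult_1_l, <- RtoC_mult, Cmod_R, Rabs_pos_eq in S' by lra.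
  assert (Ep : 2 * fst (p x) = - 2 * ln (Cmod (h x)) + e).
  { destruct (Hre x Hx) as [<- _]. unfold p; simpl. field. }
  rewrite <- Ep.
  replace (Cmod l / Cmod (h x) / (2 * fst (p x)) * (1 - Cmod x ^ 2)) with
    (Cmod l * (1 - Cmod x ^ 2) / Cmod (h x) / (2 * fst (p x))) in S' by (field; lra).
  apply (Rle_div_l _ _ (2 * fst (p x))) in S'; lra.
Qed.

(** * Zeros of high order *)

Lemma ge_0_of_derive_ge_0 (f f' : R -> R) : f 0 = 0 ->
  (forall t, is_derive f t (f' t)) -> (forall t, 0 <= t -> 0 <= f' t) -> forall t, 0 <= t -> 0 <= f t.
Proof.
  intros H0 Hd Hp t Ht.
  destruct (MVT_gen f 0 t f') as [c [Hc E]].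
  - intros; apply Hd.
  - intros x _. apply continuity_pt_filterlim. apply (@ex_derive_continuous R_AbsRing R_NormedModule). eexists; apply Hd.
  - rewrite Rmin_left in Hc by auto. rewrite H0, !Rminus_0_r in E. rewrite E.
    apply Rmult_le_pos; auto. apply Hp. lra.
Qed.

Lemma exp_opp_mul (t : R) : exp t * exp (- t) = 1.
Proof. rewrite <- exp_plus. replace (t + - t) with 0 by ring. apply exp_0. Qed.

Lemma exp_ge_1 (t : R) : 0 <= t -> 1 <= exp t.
Proof. intros [H| <-]; [left; rewrite <- exp_0; now apply exp_increasing | rewrite exp_0; lra]. Qed.

(** Twice the hyperbolic sine. For [0 < r < 1] the quantity [m * sh2 (- ln r / m) * r = m * r *
    (r^(-1/m) - r^(1/m))] is [2] divided by the density of [omega] at modulus [r]. *)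
Definition sh2 (t : R) : R := exp t - exp (- t).

Lemma sh2_ge (t : R) : 0 <= t -> 2 * t <= sh2 t.
Proof.
  intro Ht. unfold sh2.
  cut (0 <= exp t - exp (- t) - 2 * t); [lra|].
  apply (ge_0_of_derive_ge_0 (fun t => exp t - exp (- t) - 2 * t) (fun t => exp t + exp (- t) - 2)); auto.
  - rewrite Ropp_0, exp_0. ring.
  - intro s. auto_derive; auto. ring.
  - intros s _. pose proof (exp_opp_mul s). pose proof (exp_pos s). pose proof (exp_pos (- s)).
    pose proof (pow2_ge_0 (exp s - exp (- s))). nra.
Qed.

(** The difference of the two sides is [(e^s - 1) (e^t - 1) - (1 - e^(-s)) (1 - e^(-t))], and
    [1 - e^(-s) <= e^s - 1]. *)
Lemma sh2_superadd (s t : R) : 0 <= s -> 0 <= t -> sh2 s + sh2 t <= sh2 (s + t).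
Proof.
  intros Hs Ht. unfold sh2. rewrite Ropp_plus_distr, !exp_plus.
  pose proof (exp_opp_mul s). pose proof (exp_opp_mul t).
  pose proof (exp_ge_1 s Hs). pose proof (exp_ge_1 t Ht).
  pose proof (exp_pos (- s)). pose proof (exp_pos (- t)).
  assert (exp (- s) <= 1) by nra. assert (exp (- t) <= 1) by nra.
  assert (0 <= (exp s - 1) * (exp t - 1)) by nra.
  assert (0 <= (1 - exp (-s)) * (1 - exp (-t))) by nra.
  assert (0 <= (exp s - 1) * (exp t - 1) - (1 - exp (-s)) * (1 - exp (-t))); [|lra].
  assert (1 - exp (- s) <= exp s - 1) by nra. assert (1 - exp (- t) <= exp t - 1) by nra.
  assert ((1 - exp (-s)) * (1 - exp (-t)) <= (exp s - 1) * (exp t - 1)) by (apply Rmult_le_compat; lra). lra.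
Qed.

(** Both sides vanish at [0], and the derivative of their difference is [2 c (cosh (c t) - cosh t)],
    nonnegative for [c >= 1]. *)
Lemma sh2_scale (c t : R) : 1 <= c -> 0 <= t -> c * sh2 t <= sh2 (c * t).
Proof.
  intros Hc Ht. unfold sh2.
  cut (0 <= exp (c * t) - exp (- (c * t)) - c * (exp t - exp (- t))); [lra|].
  apply (ge_0_of_derive_ge_0 (fun t => exp (c * t) - exp (- (c * t)) - c * (exp t - exp (- t)))
    (fun t => c * (exp (c * t) + exp (- (c * t)) - (exp t + exp (- t))))); auto.
  - rewrite Rmult_0_r, Ropp_0, exp_0. ring.
  - intro s. auto_derive; auto. ring.
  - intros s Hs. apply Rmult_le_pos; [lra|].
    replace (c * s) with (s + (c - 1) * s) by ring. rewrite Ropp_plus_distr, !exp_plus.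
    assert (Hu : 0 <= (c - 1) * s) by (apply Rmult_le_pos; lra).
    pose proof (exp_ge_1 _ Hs). pose proof (exp_ge_1 _ Hu).
    pose proof (exp_opp_mul s). pose proof (exp_opp_mul ((c - 1) * s)).
    pose proof (exp_pos (- s)). pose proof (exp_pos (- ((c - 1) * s))).
    set (A := exp s) in *. set (B := exp (- s)) in *.
    set (U := exp ((c - 1) * s)) in *. set (V := exp (- ((c - 1) * s))) in *.
    assert (B <= 1) by nra. assert (0 <= 1 - V) by nra. assert (E : 1 - V = (U - 1) * V) by lra.
    replace (A * U + B * V - (A + B)) with (A * (U - 1) - B * (1 - V)) by ring.
    rewrite E. assert (B * V <= A) by nra.
    replace (A * (U - 1) - B * ((U - 1) * V)) with ((U - 1) * (A - B * V)) by ring.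
    apply Rmult_le_pos; lra.
Qed.

(** The list only has to cover the zeros; it may hold other points or repetitions. An induction on
    it can then simply discard a head that is not a zero in the disc. *)
Definition zeros_in (h : C -> C) (l : list C) (m : nat) : Prop :=
  forall z, Cmod z < 1 -> h z = 0 -> In z l /\ exists k, vanishing_order h z k /\ (m <= k)%nat.

Lemma vanishing_order_spec (h : C -> C) (z : C) (k : nat) : vanishing_order h z k ->
  exists r g, 0 < r /\ (forall w, Cmod (w - z) < r -> exists l, Cderiv g w l) /\ g z <> 0 /\
    forall w, Cmod (w - z) < r -> h w = ((w - z) ^ k * g w)%C.
Proof.
  intros (r & g & Hr & Hg & Hz & E). exists r, g. split; [auto|]. split; [exact Hg|]. split; [auto|].
  intros w Hw. rewrite <- Cpow_eq. now apply E.
Qed.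

Lemma vanishing_order_intro (h : C -> C) (z : C) (k : nat) (r : R) (g : C -> C) : 0 < r ->
  (forall w, Cmod (w - z) < r -> exists l, Cderiv g w l) -> g z <> 0 ->
  (forall w, Cmod (w - z) < r -> h w = ((w - z) ^ k * g w)%C) -> vanishing_order h z k.
Proof.
  intros Hr Hg Hz E. exists r, g. split; [auto|]. split; [exact Hg|]. split; [auto|].
  intros w Hw. change (Defs.Cpow (Csub w z) k) with (Defs.Cpow (w - z)%C k). rewrite Cpow_eq. now apply E.
Qed.

Lemma isolated_zero (h : C -> C) (z : C) (k : nat) : vanishing_order h z k ->
  exists r, 0 < r /\ forall w, Cmod (w - z) < r -> w <> z -> h w <> 0.
Proof.
  intro H. destruct (vanishing_order_spec _ _ _ H) as (r & g & Hr & Hg & Hz & E).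
  destruct (Hg z) as [l Hl]; [rewrite Cmod_self; lra|].
  destruct (Ccont_neq g z (Cderiv_Ccont _ _ _ Hl) Hz) as (d & Pd & Qd).
  exists (Rmin r d). split; [apply Rmin_pos; auto|]. intros w Hw Hn.
  pose proof (Rmin_l r d). pose proof (Rmin_r r d).
  rewrite E by lra. apply Cmult_neq_0; [apply Cpow_nz, Cminus_neq_0; auto | apply Qd; lra].
Qed.

(** A zero of finite order is isolated, and bisection turns isolation into finiteness on a closed
    disc. The restriction to [r < 1] prevents accumulation at the unit circle. *)
Lemma finitely_many_zeros (h : C -> C) (r : R) : holomorphic_on in_disc h -> 0 < r < 1 ->
  (forall z, Cmod z < 1 -> h z = 0 -> exists k, vanishing_order h z k) ->
  exists l, forall z, Cmod z <= r -> h z = 0 -> In z l.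
Proof.
  intros Hh Hr Hv.
  pose (P := fun x y t => exists l : list C, forall z : C, x <= fst z <= x + 2 * r * t -> y <= snd z <= y + 2 * r * t ->
    Cmod z <= r -> h z = 0 -> In z l).
  assert (HP : P (fst (RtoC 0) - r) (snd (RtoC 0) - r) 1).
  { apply (Cousin_disc 0 r); [lra | |].
    - intros x y t Ht [l1 H1] [l2 H2] [l3 H3] [l4 H4].
      exists (l1 ++ l2 ++ l3 ++ l4). intros z Hx Hy Hz H0. rewrite !in_app_iff.
      destruct (rect_quarters _ _ _ _ _ _ Hx Hy) as [[U V]|[[U V]|[[U V]|[U V]]]]; auto 6.
    - intro z. destruct (Rlt_dec (Cmod z) 1) as [Hz|Hz].
      + destruct (Ceq_dec (h z) 0) as [E|E].
        * destruct (Hv z Hz E) as [k Hk]. destruct (isolated_zero _ _ _ Hk) as (d & Pd & Qd).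
          exists d. split; auto. intros x y t _ Hall. exists (z :: nil). intros w Hx Hy _ Hw.
          destruct (Ceq_dec z w); [now left|]. exfalso. apply (Qd w); auto.
        * destruct (Ccont_neq h z (holo_Ccont h z Hh Hz) E) as (d & Pd & Qd).
          exists d. split; auto. intros x y t _ Hall. exists nil. intros w Hx Hy _ Hw. exfalso. apply (Qd w); auto.
      + exists (Cmod z - r). split; [lra|]. intros x y t _ Hall. exists nil. intros w Hx Hy Hw _.
        specialize (Hall w Hx Hy). pose proof (Cmod_rev_triangle z w). rewrite Cmod_minus_sym in H. lra. }
  destruct HP as [l Hl]. exists l. intros z Hz. 
  destruct (disc_in_square 0 z r); [now replace (z - 0)%C with z by ring|]. apply Hl; auto.
Qed.

(** If every zero has order at least [m], a zero [a] of order [k] contributes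
    [k sh2 s <= m sh2 (k s / m)] to the logarithmic derivative, where [s = - log |b_a x|], and the
    contributions of the Blaschke factors are added up by superadditivity of [sinh]. *)
Lemma Schwarz_zeros (m : nat) (x : C) : (1 <= m)%nat -> Cmod x < 1 -> forall (l : list C) (h : C -> C) (d : C),
  holomorphic_on in_disc h -> (forall z, Cmod z < 1 -> Cmod (h z) <= 1) -> zeros_in h l m ->
  h x <> 0 -> Cderiv h x d ->
  Cmod d * (1 - Cmod x ^ 2) <= INR m * sh2 (- ln (Cmod (h x)) / INR m) * Cmod (h x).
Proof.
  intros Hm Hx. assert (Hm' : 1 <= INR m) by (change 1 with (INR 1); now apply le_INR).
  induction l as [|a l IH]; intros h d Hh Hb Hz Hhx Hd.
  - pose proof (Cmod_pos _ Hhx) as Hp.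
    assert (Hln : ln (Cmod (h x)) <= 0).
    { rewrite <- ln_1. destruct (Hb x Hx) as [H|H]; [left; now apply ln_increasing | rewrite H; lra]. }
    eapply Rle_trans; [apply (Schwarz_nonvanishing h x d); auto|].
    + intros z Hz1. split; auto. intro E. destruct (Hz z Hz1 E) as [[] _].
    + apply Rmult_le_compat_r; [lra|].
      assert (Hs : 0 <= - ln (Cmod (h x)) / INR m) by (apply Rdiv_le_0_compat; lra).
      pose proof (sh2_ge _ Hs) as S.
      apply Rle_trans with (INR m * (2 * (- ln (Cmod (h x)) / INR m))).
      * right. field. lra.
      * apply Rmult_le_compat_l; lra.
  - destruct (classic (Cmod a < 1 /\ h a = 0)) as [[Ha Ea]|Hno].
    2:{ apply IH; auto. intros z Hz1 E. destruct (Hz z Hz1 E) as [[->|Hin] Hk]; [tauto | auto]. }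
    destruct (Hz a Ha Ea) as [_ (k & Hv & Hmk)].
    destruct (vanishing_order_spec _ _ _ Hv) as (r & G & Hr & HG & HGa & EG).
    (* This is [h / b_a ^ k]; the value at [a] comes from the local factorisation
       [h = (z - a) ^ k * G]. *)
    set (h1 := fun z => if Ceq_dec z a then (G a * (1 - Cconj a * a) ^ k)%C
                        else (h z * (1 - Cconj a * z) ^ k / (z - a) ^ k)%C).
    assert (Hnear : forall z, Cmod (z - a) < r -> h1 z = (G z * (1 - Cconj a * z) ^ k)%C).
    { intros z Hzr. unfold h1. destruct (Ceq_dec z a) as [->|Hn]; auto. rewrite (EG z Hzr).
      field. apply Cpow_nz, Cminus_neq_0; auto. }
    assert (Hfar : forall z, z <> a -> h1 z = (h z * (1 - Cconj a * z) ^ k / (z - a) ^ k)%C).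
    { intros z Hn. unfold h1. destruct (Ceq_dec z a); tauto. }
    assert (DA : forall z, Cderiv (fun z => (1 - Cconj a * z) ^ k)%C z (INR k * (1 - Cconj a * z) ^ (k - 1) * (0 - Cconj a * 1))).
    { intro z. apply (Cderiv_pow (fun z => 1 - Cconj a * z)%C). apply Cderiv_sub; [apply Cderiv_const | apply Cderiv_scal, Cderiv_id]. }
    assert (DB : forall z, Cderiv (fun z => (z - a) ^ k)%C z (INR k * (z - a) ^ (k - 1) * (1 - 0))).
    { intro z. apply (Cderiv_pow (fun z => z - a)%C). apply Cderiv_sub; [apply Cderiv_id | apply Cderiv_const]. }
    assert (Dfar : forall z e, z <> a -> Cderiv h z e -> 
      Cderiv h1 z (((e * (1 - Cconj a * z) ^ k + h z * (INR k * (1 - Cconj a * z) ^ (k - 1) * (0 - Cconj a * 1))) * (z - a) ^ k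
        - h z * (1 - Cconj a * z) ^ k * (INR k * (z - a) ^ (k - 1) * (1 - 0))) / ((z - a) ^ k * (z - a) ^ k))).
    { intros z e Hn He.
      apply (Cderiv_ext_loc (fun z => h z * (1 - Cconj a * z) ^ k / (z - a) ^ k)%C) with (r := Cmod (z - a)).
      - now apply Cmod_pos, Cminus_neq_0.
      - intros w Hw. symmetry. apply Hfar. intros ->. rewrite Cmod_minus_sym in Hw. lra.
      - apply (Cderiv_div (fun z => h z * (1 - Cconj a * z) ^ k)%C (fun z => (z - a) ^ k)%C); auto.
        + apply Cderiv_mul; auto.
        + apply Cpow_nz, Cminus_neq_0; auto. }
    assert (Hh1 : holomorphic_on in_disc h1).
    { intros z Hz1. change (exists e, Cderiv h1 z e). destruct (Ceq_dec z a) as [->|Hn].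
      - destruct (HG a) as [e He]; [rewrite Cmod_self; lra|]. eexists.
        apply (Cderiv_ext_loc (fun z => G z * (1 - Cconj a * z) ^ k)%C) with (r := r); auto.
        + intros w Hw. symmetry. auto.
        + apply Cderiv_mul; eauto.
      - destruct (Hh z Hz1) as [e He]. eexists. apply (Dfar z e Hn He). }
    assert (Hbl : forall z, Cmod z < 1 -> z <> a -> Cmod (h z) = Cmod (h1 z) * Cmod (blaschke a z) ^ k).
    { intros z Hz1 Hn. rewrite Hfar by auto. unfold blaschke.
      pose proof (blaschke_den_neq_0 a z Ha ltac:(lra)) as N1. pose proof (Cminus_neq_0 _ _ Hn) as N2.
      rewrite !Cmod_div, Cmod_mult, !Cmod_pow by (try apply Cpow_nz; auto).
      apply Cmod_pos in N1. apply Cmod_pos in N2. unfold Rdiv. rewrite Rpow_mult_distr, pow_inv.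
      field. split; apply pow_nonzero; lra. }
    assert (Hb1 : forall z, Cmod z < 1 -> Cmod (h1 z) <= 1).
    { apply (max_principle_blaschke h1 a k); auto.
      - intros z Hz1. now apply holo_Ccont.
      - intros z Hz1. exists (1 - Cmod z). split; [lra|]. intros w [_ Hw]. apply Hh1. now apply (disc_open z).
      - intros z Hz1. destruct (Ceq_dec z a) as [->|Hn].
        + unfold blaschke. replace ((a - a) / (1 - Cconj a * a))%C with (RtoC 0) by (unfold Cdiv; ring).
          rewrite Cmod_0, pow_i by lia. lra.
        + rewrite <- Hbl by auto. auto. }
    assert (Hxa : x <> a) by (intros ->; auto).
    (* The quotient no longer vanishes at [a] because [G a <> 0]. At any other zero [b_a ^ k] is
       invertible, so the order is unchanged. *)
    assert (Hz1 : zeros_in h1 l m).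
    { intros z Hzd Ez.
      assert (Hn : z <> a).
      { intros ->. revert Ez. rewrite Hnear by (rewrite Cmod_self; lra).
        apply Cmult_neq_0; auto. apply Cpow_nz, blaschke_den_neq_0; auto. lra. }
      assert (Ez' : h z = 0).
      { apply Cmod_eq_0. rewrite Hbl, Ez, Cmod_0 by auto. ring. }
      destruct (Hz z Hzd Ez') as [[->|Hin] (k' & Hv' & Hk')]; [tauto|]. split; auto.
      exists k'. split; auto. destruct (vanishing_order_spec _ _ _ Hv') as (r' & G' & Hr' & HG' & HGz & EG').
      set (g := fun w => (G' w * (1 - Cconj a * w) ^ k / (w - a) ^ k)%C).
      apply (vanishing_order_intro h1 z k' (Rmin (Rmin r' (Cmod (z - a))) (1 - Cmod z)) g).
      - repeat apply Rmin_pos; auto; [now apply Cmod_pos, Cminus_neq_0 | lra].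
      - intros w Hw. pose proof (Rmin_l (Rmin r' (Cmod (z - a))) (1 - Cmod z)).
        pose proof (Rmin_l r' (Cmod (z - a))). pose proof (Rmin_r r' (Cmod (z - a))).
        destruct (HG' w ltac:(lra)) as [e He]. eexists.
        apply (Cderiv_div (fun z => G' z * (1 - Cconj a * z) ^ k)%C (fun z => (z - a) ^ k)%C); auto.
        + apply Cderiv_mul; eauto.
        + apply Cpow_nz, Cminus_neq_0. intros ->. rewrite Cmod_minus_sym in Hw. lra.
      - unfold g, Cdiv. apply Cmult_neq_0; [apply Cmult_neq_0; auto|].
        + apply Cpow_nz, blaschke_den_neq_0; auto. lra.
        + intro E. assert (N : ((z - a) ^ k)%C <> 0) by (apply Cpow_nz, Cminus_neq_0; auto).
          apply Cmod_pos in N. apply (f_equal Cmod) in E. rewrite Cmod_0, Cmod_inv in E by (now apply Cmod_gt_0).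
          pose proof (Rinv_0_lt_compat _ N). lra.
      - intros w Hw. pose proof (Rmin_l (Rmin r' (Cmod (z - a))) (1 - Cmod z)).
        pose proof (Rmin_l r' (Cmod (z - a))). pose proof (Rmin_r r' (Cmod (z - a))).
        rewrite Hfar by (intros ->; rewrite Cmod_minus_sym in Hw; lra).
        rewrite EG' by lra. unfold g, Cdiv. ring. }
    pose proof (Dfar x d Hxa Hd) as D1.
    set (d1 := (((d * (1 - Cconj a * x) ^ k + h x * (INR k * (1 - Cconj a * x) ^ (k - 1) * (0 - Cconj a * 1))) * (x - a) ^ k
        - h x * (1 - Cconj a * x) ^ k * (INR k * (x - a) ^ (k - 1) * (1 - 0))) / ((x - a) ^ k * (x - a) ^ k))%C) in *.
    set (p := (1 - Cconj a * x)%C) in *. set (y := (x - a)%C) in *.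
    assert (Hp : p <> 0) by (apply blaschke_den_neq_0; lra). assert (Hy : y <> 0) by now apply Cminus_neq_0.
    assert (Eh1 : h1 x = (h x * p ^ k / y ^ k)%C) by now apply Hfar.
    assert (Hh1x : h1 x <> 0).
    { intro E. apply Hhx. apply Cmod_eq_0. rewrite Hbl, E, Cmod_0 by auto. ring. }
    specialize (IH h1 d1 Hh1 Hb1 Hz1 Hh1x D1).
    (* Logarithmic derivatives add, and [b_a' / b_a = (1 - |a| ^ 2) / ((1 - conj a * x) * (x -
       a))]. *)
    assert (Elog : (d / h x = d1 / h1 x + INR k * (1 - Cconj a * a) / (p * y))%C).
    { assert (Epa : (1 - Cconj a * a = Cconj a * y + p)%C) by (unfold p, y; ring). rewrite Epa, Eh1.
      unfold d1. destruct k as [|k]; [lia|]. replace (S k - 1)%nat with k by lia. simpl Complex.Cpow.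
      pose proof (Cpow_nz p k Hp). pose proof (Cpow_nz y k Hy). field. repeat split; auto. }
    pose proof (Cmod_pos _ Hhx) as Ph. pose proof (Cmod_pos _ Hh1x) as Ph1.
    pose proof (Cmod_pos _ Hp) as Pp. pose proof (Cmod_pos _ Hy) as Py.
    set (rho := Cmod y / Cmod p).
    assert (Hrho : 0 < rho) by (apply Rdiv_lt_0_compat; auto).
    assert (Eh : Cmod (h x) = Cmod (h1 x) * rho ^ k).
    { rewrite Hbl by auto. unfold blaschke. fold p y. now rewrite Cmod_div. }
    pose proof (blaschke_norm_identity a x) as Hid. fold p y in Hid.
    pose proof (Cmod_ge_0 a) as Ga. pose proof (Cmod_ge_0 x) as Gx.
    assert (Hpos : 0 < (1 - Cmod a ^ 2) * (1 - Cmod x ^ 2)) by (apply Rmult_lt_0_compat; nra).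
    assert (Hrho1 : rho < 1).
    { apply Rlt_div_l; auto. nra. }
    set (s := - ln rho). set (s1 := - ln (Cmod (h1 x))).
    assert (Hs : 0 <= s).
    { unfold s. assert (ln rho < 0) by (rewrite <- ln_1; now apply ln_increasing). lra. }
    assert (Hs1 : 0 <= s1).
    { unfold s1. destruct (Hb1 x Hx) as [H|H]; [|rewrite H, ln_1; lra].
      apply ln_increasing in H; auto. rewrite ln_1 in H. lra. }
    assert (Es : - ln (Cmod (h x)) = s1 + INR k * s).
    { rewrite Eh, ln_mult, ln_pow by (auto; now apply pow_lt). unfold s, s1. ring. }
    (* By the norm identity the left side is [(|p| ^ 2 - |y| ^ 2) / (|p| * |y|) = / rho - rho], with
       [rho = |b_a x|]. *)
    assert (Esh : (1 - Cmod a ^ 2) * (1 - Cmod x ^ 2) / (Cmod p * Cmod y) = sh2 s).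
    { unfold sh2, s. rewrite Ropp_involutive, exp_Ropp, exp_ln by auto. rewrite <- Hid. unfold rho. field. lra. }
    assert (Ha1 : Cmod (1 - Cconj a * a) = 1 - Cmod a ^ 2).
    { replace (1 - Cconj a * a)%C with (RtoC (1 - Cmod a ^ 2)).
      - rewrite Cmod_R, Rabs_pos_eq; nra.
      - rewrite Cmod_sqr. destruct a as [a1 a2]. unfold RtoC, Cconj, Cminus, Cplus, Copp, Cmult; simpl. f_equal; ring. }
    assert (Hkm : INR m <= INR k) by now apply le_INR.
    assert (T : Cmod d / Cmod (h x) <= Cmod d1 / Cmod (h1 x) + INR k * (1 - Cmod a ^ 2) / (Cmod p * Cmod y)).
    { rewrite <- (Cmod_div d), Elog by auto. eapply Rle_trans; [apply Cmod_triangle|].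
      rewrite (Cmod_div d1), (Cmod_div (_ * _)), !Cmod_mult, Cmod_R, Ha1, Rabs_pos_eq by (auto; try apply pos_INR; now apply Cmult_neq_0).
      lra. }
    assert (T1 : Cmod d1 / Cmod (h1 x) * (1 - Cmod x ^ 2) <= INR m * sh2 (s1 / INR m)).
    { fold s1 in IH. replace (Cmod d1 / Cmod (h1 x) * (1 - Cmod x ^ 2)) with (Cmod d1 * (1 - Cmod x ^ 2) / Cmod (h1 x)) by (field; lra).
      apply Rle_div_l; auto. }
    assert (T2 : INR k * (1 - Cmod a ^ 2) / (Cmod p * Cmod y) * (1 - Cmod x ^ 2) <= INR m * sh2 (INR k * s / INR m)).
    { replace (INR k * (1 - Cmod a ^ 2) / (Cmod p * Cmod y) * (1 - Cmod x ^ 2)) with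
        (INR k * ((1 - Cmod a ^ 2) * (1 - Cmod x ^ 2) / (Cmod p * Cmod y))) by (field; lra).
      rewrite Esh. replace (INR k * sh2 s) with (INR m * (INR k / INR m * sh2 s)) by (field; lra).
      apply Rmult_le_compat_l; [lra|]. replace (INR k * s / INR m) with (INR k / INR m * s) by (field; lra).
      apply sh2_scale; auto. apply Rle_div_r; lra. }
    assert (T3 : INR m * sh2 (s1 / INR m) + INR m * sh2 (INR k * s / INR m) <= INR m * sh2 (- ln (Cmod (h x)) / INR m)).
    { rewrite Es, <- Rmult_plus_distr_l. apply Rmult_le_compat_l; [lra|].
      replace ((s1 + INR k * s) / INR m) with (s1 / INR m + INR k * s / INR m) by (field; lra).
      apply sh2_superadd; apply Rdiv_le_0_compat; try lra. apply Rmult_le_pos; lra. }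
    replace (Cmod d * (1 - Cmod x ^ 2)) with (Cmod d / Cmod (h x) * (1 - Cmod x ^ 2) * Cmod (h x)) by (field; lra).
    apply Rmult_le_compat_r; [lra|]. assert (0 < 1 - Cmod x ^ 2) by nra. nra.
Qed.

(** * The orbifold Schwarz-Pick inequality *)

Lemma Schwarz_orbifold (m : nat) (h : C -> C) (x d : C) : (1 <= m)%nat ->
  holomorphic_on in_disc h -> (forall z, Cmod z < 1 -> Cmod (h z) < 1) ->
  (forall z, Cmod z < 1 -> h z = 0 -> exists k, vanishing_order h z k /\ (m <= k)%nat) ->
  Cmod x < 1 -> h x <> 0 -> Cderiv h x d ->
  Cmod d * (1 - Cmod x ^ 2) <= INR m * sh2 (- ln (Cmod (h x)) / INR m) * Cmod (h x).
Proof.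
  intros Hm Hh Hb Hv Hx Hhx Hd. set (B := INR m * sh2 (- ln (Cmod (h x)) / INR m) * Cmod (h x)).
  pose proof (Cmod_ge_0 x) as Gx. pose proof (Cmod_ge_0 d) as Gd.
  (* The inequality for [z -> h (R z)] at [x / R], multiplied by [R] to clear denominators. That
     function has finitely many zeros in the disc, since those of [h] in the closed disc of radius
     [R] are finitely many. *)
  assert (Key : forall R, Cmod x < R < 1 -> Cmod d * (R ^ 2 - Cmod x ^ 2) <= R * B).
  { intros R0 HR. assert (HR0 : 0 < R0) by lra.
    assert (HRC : RtoC R0 <> 0) by (intro X; apply RtoC_inj in X; lra).
    set (g := fun z => h (R0 * z)%C). set (x0 := (/ R0 * x)%C).
    assert (Ex : (R0 * x0)%C = x) by (unfold x0; field; auto).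
    assert (Hsc : forall z, Cmod (R0 * z) = R0 * Cmod z) by (intro; now rewrite Cmod_mult, Cmod_R, Rabs_pos_eq by lra).
    assert (Ex0 : R0 * Cmod x0 = Cmod x) by now rewrite <- Hsc, Ex.
    assert (Hin : forall z, Cmod z < 1 -> Cmod (R0 * z) < 1).
    { intros z Hz. rewrite Hsc. pose proof (Cmod_ge_0 z). nra. }
    assert (Dg : forall z l, Cderiv h (R0 * z)%C l -> Cderiv g z (l * (R0 * 1))).
    { intros z l Hl. apply (Cderiv_comp h (fun z => R0 * z)%C); auto. apply Cderiv_scal, Cderiv_id. }
    destruct (finitely_many_zeros h R0 Hh) as [l Hl]; [lra | |].
    { intros z Hz Ez. destruct (Hv z Hz Ez) as [k [Hk _]]. now exists k. }
    assert (S := Schwarz_zeros m x0 Hm).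
    assert (Hx0 : Cmod x0 < 1) by nra.
    specialize (S Hx0 (map (fun w => / R0 * w)%C l) g (d * (R0 * 1))%C).
    assert (Egx : g x0 = h x) by (unfold g; now rewrite Ex). rewrite Egx in S. fold B in S.
    assert (S' : Cmod (d * (R0 * 1)) * (1 - Cmod x0 ^ 2) <= B).
    { apply S; auto.
      - intros z Hz. change (exists e, Cderiv g z e). destruct (Hh (R0 * z)%C (Hin z Hz)) as [e He].
        eexists. apply (Dg z e He).
      - intros z Hz. left. apply Hb, Hin, Hz.
      - intros z Hz Ez. split.
        + apply in_map_iff. exists (R0 * z)%C. split; [field; auto|]. apply Hl; auto.
          rewrite Hsc. nra.
        + destruct (Hv (R0 * z)%C (Hin z Hz) Ez) as (k & Hk & Hmk). exists k. split; auto.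
          destruct (vanishing_order_spec _ _ _ Hk) as (r & G & Hr & HG & HGz & EG).
          assert (Hd' : forall w, Cmod (w - z) < r -> Cmod (R0 * w - R0 * z) < r).
          { intros w Hw. replace (R0 * w - R0 * z)%C with (R0 * (w - z))%C by ring. rewrite Hsc.
            pose proof (Cmod_ge_0 (w - z)). nra. }
          apply (vanishing_order_intro g z k r (fun w => R0 ^ k * G (R0 * w))%C); auto.
          * intros w Hw. destruct (HG (R0 * w)%C) as [e He]; auto. eexists.
            apply Cderiv_scal, (Cderiv_comp G (fun w => R0 * w)%C); [apply Cderiv_scal, Cderiv_id | exact He].
          * apply Cmult_neq_0; auto. now apply Cpow_nz.
          * intros w Hw. unfold g. rewrite EG by auto.
            replace (R0 * w - R0 * z)%C with (R0 * (w - z))%C by ring. rewrite Cpow_mult_l. ring.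
      - apply Dg. rewrite Ex. exact Hd. }
    replace (d * (R0 * 1))%C with (R0 * d)%C in S' by ring. rewrite Hsc in S'.
    replace (Cmod d * (R0 ^ 2 - Cmod x ^ 2)) with (R0 * (R0 * Cmod d * (1 - Cmod x0 ^ 2))) by (rewrite <- Ex0; ring).
    apply Rmult_le_compat_l; lra. }
  apply le_epsilon. intros e He.
  (* At [R = 1 - t] one has [R ^ 2 >= 1 - 2 * t], so the loss on the left is at most
     [|d| * 2 * t <= e]; on the right [R * B <= B]. *)
  set (t := Rmin ((1 - Cmod x) / 2) (e / (2 * (Cmod d + 1)))).
  assert (Ht : 0 < t) by (apply Rmin_pos; [lra | apply Rdiv_lt_0_compat; lra]).
  assert (T1 := Rmin_l ((1 - Cmod x) / 2) (e / (2 * (Cmod d + 1)))).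
  assert (T2 := Rmin_r ((1 - Cmod x) / 2) (e / (2 * (Cmod d + 1)))). fold t in T1, T2. clearbody t.
  assert (K := Key (1 - t) ltac:(lra)).
  assert (T3 : Cmod d * (2 * t) <= e).
  { apply Rle_trans with ((Cmod d + 1) * (2 * (e / (2 * (Cmod d + 1))))); [apply Rmult_le_compat; lra|].
    right. field. lra. }
  assert (HB : 0 <= B).
  { apply Rmult_le_reg_l with (1 - t); [lra|]. rewrite Rmult_0_r. apply Rle_trans with (2 := K).
    apply Rmult_le_pos; nra. }
  nra.
Qed.

(** * The densities of the two metrics *)

Lemma sqrt_poincare_coef (x : C) : Cmod x < 1 -> sqrt (poincare_coef x) = 2 / (1 - Cmod x ^ 2).
Proof.
  intro Hx. pose proof (Cmod_ge_0 x). unfold poincare_coef. change (Cnorm x) with (Cmod x).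
  assert (0 < 1 - Cmod x ^ 2) by nra.
  replace (4 / (1 - Cmod x ^ 2) ^ 2) with ((2 / (1 - Cmod x ^ 2)) ^ 2) by (field; lra).
  apply sqrt_pow2. apply Rdiv_le_0_compat; lra.
Qed.

Lemma neg_ln_pos (r : R) : 0 < r < 1 -> 0 < - ln r.
Proof. intros H. assert (ln r < ln 1) by (apply ln_increasing; lra). rewrite ln_1 in H0. lra. Qed.

Lemma sqrt_omega_None (z : C) : 0 < Cmod z < 1 ->
  sqrt (omega_coef None z) = 1 / (Cmod z * - ln (Cmod z)).
Proof.
  intro Hz. pose proof (neg_ln_pos _ Hz). unfold omega_coef. change (Cnorm z) with (Cmod z).
  rewrite ln_pow by lra. simpl INR.
  replace (4 / (Cmod z ^ 2 * ((1 + 1) * ln (Cmod z)) ^ 2)) with ((1 / (Cmod z * - ln (Cmod z))) ^ 2) by (field; lra).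
  apply sqrt_pow2. apply Rdiv_le_0_compat; [lra|]. apply Rmult_lt_0_compat; lra.
Qed.

Lemma sh2_pos (t : R) : 0 < t -> 0 < sh2 t.
Proof. intro H. pose proof (sh2_ge t). lra. Qed.

(** With [u = |z|^(1/m)] one has [sh2 (- ln |z| / m) = / u - u] and
    [|z|^(2 - 2/m) = |z| ^ 2 / u ^ 2]. The form on the right matches the bound of
    [Schwarz_orbifold]. *)
Lemma sqrt_omega_Some (m : nat) (z : C) : (1 <= m)%nat -> 0 < Cmod z < 1 ->
  sqrt (omega_coef (Some m) z) = 2 / (INR m * sh2 (- ln (Cmod z) / INR m) * Cmod z).
Proof.
  intros Hm Hz. assert (Hm' : 1 <= INR m) by (change 1 with (INR 1); now apply le_INR).
  pose proof (neg_ln_pos _ Hz) as Hl.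
  assert (Hs : 0 < sh2 (- ln (Cmod z) / INR m)) by (apply sh2_pos, Rdiv_lt_0_compat; lra).
  unfold omega_coef. change (Cnorm z) with (Cmod z). unfold rpow.
  destruct (Req_dec_T (Cmod z) 0) as [E|_]; [lra|]. unfold Rpower.
  set (L := ln (Cmod z)) in *. set (u := exp (L / INR m)).
  assert (Hu : 0 < u) by apply exp_pos.
  assert (E1 : exp (2 / INR m * L) = u ^ 2).
  { unfold u. replace (2 / INR m * L) with (L / INR m + L / INR m) by (field; lra). rewrite exp_plus. ring. }
  assert (E2 : exp ((2 - 2 / INR m) * L) = Cmod z ^ 2 / u ^ 2).
  { replace ((2 - 2 / INR m) * L) with (L + L + - (2 / INR m * L)) by (field; lra).
    rewrite !exp_plus, exp_Ropp, E1. unfold L. rewrite exp_ln by lra. field. lra. }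
  assert (E3 : sh2 (- L / INR m) = / u - u).
  { unfold sh2, u. replace (- L / INR m) with (- (L / INR m)) by (field; lra). now rewrite Ropp_involutive, exp_Ropp. }
  rewrite E1, E2, E3 in *.
  replace (4 / (INR m ^ 2 * (Cmod z ^ 2 / u ^ 2) * (1 - u ^ 2) ^ 2)) with ((2 / (INR m * (/ u - u) * Cmod z)) ^ 2).
  - apply sqrt_pow2. apply Rdiv_le_0_compat; [lra|]. repeat apply Rmult_lt_0_compat; lra.
  - assert (1 - u ^ 2 = u * (/ u - u)) by (field; lra).
    assert (0 < 1 - u ^ 2) by (rewrite H; now apply Rmult_lt_0_compat). field. repeat split; lra.
Qed.

(** For [m = 1] the exponent [2 - 2 / m] vanishes, and the convention [rpow 0 0 = 1] gives the
    Poincare coefficient at the origin, a regular point in this case. *)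
Lemma omega_Some_1_0 : omega_coef (Some 1%nat) (RtoC 0) = 4.
Proof.
  unfold omega_coef. change (Cnorm (RtoC 0)) with (Cmod 0). rewrite Cmod_0. unfold rpow. simpl INR.
  destruct (Req_dec_T 0 0) as [_|]; [|lra].
  destruct (Req_dec_T (2 - 2 / 1) 0) as [_|E]; [|exfalso; apply E; field].
  destruct (Req_dec_T (2 / 1) 0) as [E|_]; [exfalso; lra|]. field.
Qed.

Lemma vanishing_order_0 (h : C -> C) (z : C) : h z = 0 -> ~ vanishing_order h z 0.
Proof.
  intros E H. destruct (vanishing_order_spec _ _ _ H) as (r & g & Hr & _ & Hz & EG).
  rewrite EG in E by (rewrite Cmod_self; lra). apply Hz. simpl in E. rewrite <- E. ring.
Qed.

Lemma vanishing_order_Cderiv_0 (h : C -> C) (z l : C) (k : nat) : (2 <= k)%nat ->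
  vanishing_order h z k -> Cderiv h z l -> l = 0.
Proof.
  intros Hk H Hl. destruct (vanishing_order_spec _ _ _ H) as (r & g & Hr & Hg & _ & EG).
  destruct (Hg z) as [e He]; [rewrite Cmod_self; lra|].
  apply (Cderiv_unique h z); auto.
  apply (Cderiv_ext_loc (fun w => (w - z) ^ k * g w)%C) with (r := r); auto.
  - intros; symmetry; auto.
  - eapply Cderiv_eq; [|apply Cderiv_mul; [apply Cderiv_pow, Cderiv_sub; [apply Cderiv_id | apply Cderiv_const] | exact He]].
    destruct k as [|[|k]]; try lia. simpl Nat.sub. rewrite !Cpow_S. ring.
Qed.

(** Order [0] is a multiple of [m], but it cannot occur at a zero of [h]; a positive multiple of [m]
    is at least [m]. *)
Lemma orbifold_morphism_weaken (n : option nat) (h : C -> C) :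
  orbifold_morphism true n h -> orbifold_morphism false n h.
Proof.
  intros (H1 & H2 & H3 & H4). repeat split; auto. destruct n as [m|]; auto.
  intros x Hx E. destruct (H4 x Hx E) as (k & Hk & [j Hj]). exists k. split; auto.
  destruct j as [|j]; [|subst; simpl; lia].
  exfalso. subst k. now apply (vanishing_order_0 h x).
Qed.

(** The alternative [d = 0] covers points sent to [0] when [m >= 2]. There [omega] is infinite, but
    the zero has order at least [2], so the image of a curve has zero speed and the convention
    [inf * 0 = 0] applies. *)
Lemma orbifold_Schwarz_Pick (n : option nat) (h : C -> C) (x d : C) :
  (forall m, n = Some m -> (1 <= m)%nat) -> orbifold_morphism false n h -> in_disc x -> Cderiv h x d ->
  d = 0 \/ (omega_reg n (h x) /\ sqrt (omega_coef n (h x)) * Cmod d <= sqrt (poincare_coef x)).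
Proof.
  intros Hn (Hh & Hb & _ & Hz) Hx Hd. change (Cmod x < 1) in Hx.
  rewrite sqrt_poincare_coef by auto.
  pose proof (Hb x Hx : Cmod (h x) < 1) as Hbx.
  pose proof (Cmod_ge_0 x) as Gx. pose proof (Cmod_ge_0 d) as Gd. assert (Px : 0 < 1 - Cmod x ^ 2) by nra.
  assert (Fin : forall A B : R, 0 < B -> Cmod d * (1 - Cmod x ^ 2) <= 2 * B -> A = 1 / B -> A * Cmod d <= 2 / (1 - Cmod x ^ 2)).
  { intros A B HB H ->. apply (Rle_div_r _ _ (1 - Cmod x ^ 2)); auto.
    replace (1 / B * Cmod d * (1 - Cmod x ^ 2)) with (Cmod d * (1 - Cmod x ^ 2) / B) by (field; lra).
    apply (Rle_div_l _ _ B); lra. }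
  destruct n as [m|].
  - specialize (Hn m eq_refl). destruct (Ceq_dec (h x) 0) as [E|E].
    + destruct (Nat.eq_dec m 1) as [->|Hm1].
      * right. split; [split; auto|]. rewrite E, omega_Some_1_0.
        apply (Fin _ (1/2)); [lra | | replace 4 with (2 ^ 2) by ring; rewrite sqrt_pow2; lra].
        replace (2 * (1 / 2)) with 1 by field. apply (Schwarz_at h); auto.
        intros z Hz1. left. now apply Hb.
      * left. destruct (Hz x Hx E) as (k & Hk & Hmk). apply (vanishing_order_Cderiv_0 h x d k); auto. lia.
    + right. pose proof (Cmod_pos _ E) as Pz. split; [split; auto|].
      rewrite sqrt_omega_Some by (auto; lra).
      assert (Hm' : 1 <= INR m) by (change 1 with (INR 1); now apply le_INR).
      assert (Hs : 0 < INR m * sh2 (- ln (Cmod (h x)) / INR m) * Cmod (h x)).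
      { repeat apply Rmult_lt_0_compat; auto; [lra|]. apply sh2_pos, Rdiv_lt_0_compat; [apply neg_ln_pos|]; lra. }
      apply (Fin _ (INR m * sh2 (- ln (Cmod (h x)) / INR m) * Cmod (h x) / 2)); [lra | | field; split; [|split]; try lra].
      * replace (2 * (INR m * sh2 (- ln (Cmod (h x)) / INR m) * Cmod (h x) / 2)) with
          (INR m * sh2 (- ln (Cmod (h x)) / INR m) * Cmod (h x)) by field.
        apply (Schwarz_orbifold m h x d); auto.
      * intro X. rewrite X in Hs. lra.
  - right. pose proof (Hz x Hx) as E. pose proof (Cmod_pos _ E) as Pz. split; [split; auto|].
    rewrite sqrt_omega_None by lra. pose proof (neg_ln_pos (Cmod (h x))).
    apply (Fin _ (Cmod (h x) * - ln (Cmod (h x)))); [apply Rmult_lt_0_compat; lra | | reflexivity].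
    replace (2 * (Cmod (h x) * - ln (Cmod (h x)))) with (- 2 * ln (Cmod (h x)) * Cmod (h x)) by ring.
    apply (Schwarz_nonvanishing h x d); auto. intros z Hz1. split; [now apply Hz | left; now apply Hb].
Qed.

(** * Lengths of curves *)

(** Kept transparent: [RInt_step] computes with it, every approximating step function being [phi]
    itself. *)
Lemma Riemann_integrable_step (a b : R) (phi : StepFun a b) : Riemann_integrable phi a b.
Proof.
  intro eps. exists phi, (mkStepFun (StepFun_P4 a b 0)). split.
  - intros t _. simpl. unfold fct_cte. rewrite Rminus_diag, Rabs_R0. lra.
  - rewrite StepFun_P18, Rmult_0_l, Rabs_R0. apply cond_pos.
Defined.

Lemma RInt_step (a b : R) (phi : StepFun a b) : RInt phi a b = RiemannInt_SF phi.
Proof.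
  rewrite (RInt_Reals phi a b (Riemann_integrable_step a b phi)). unfold RiemannInt.
  destruct (RiemannInt_exists _ _ _) as [l Hl].
  apply (UL_sequence _ _ _ Hl). intros e He. exists 0%nat. intros n _. simpl.
  now rewrite Rdist_eq.
Qed.

Lemma ex_RInt_step (a b : R) (phi : StepFun a b) : ex_RInt phi a b.
Proof. apply ex_RInt_Reals_1, Riemann_integrable_step. Qed.

Lemma step_le_RInt (phi : StepFun 0 1) (F : R -> R) : ex_RInt F 0 1 ->
  (forall t, 0 <= t <= 1 -> phi t <= F t) -> RiemannInt_SF phi <= RInt F 0 1.
Proof.
  intros HF H. rewrite <- RInt_step. apply RInt_le; auto; [lra | apply ex_RInt_step |].
  intros t Ht. apply H. lra.
Qed.

(** Riemann integrability provides [phi] and [psi] with [phi - psi <= F <= phi + psi] on [[0, 1]]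
    and the integral of [psi] below [e / 2]. The lower step function is admissible, and the upper
    one exceeds it by less than [e] in integral. *)
Lemma RInt_le_of_steps (F : R -> R) (L : R) : ex_RInt F 0 1 ->
  (forall phi : StepFun 0 1, (forall t, 0 <= t <= 1 -> phi t <= F t) -> RiemannInt_SF phi <= L) ->
  RInt F 0 1 <= L.
Proof.
  intros HF H. apply le_epsilon. intros e He. assert (He2 : 0 < e / 2) by lra.
  destruct (ex_RInt_Reals_0 _ _ _ HF (mkposreal _ He2)) as (phi & psi & H1 & H2).
  rewrite Rmin_left, Rmax_right in H1 by lra. simpl in H2. apply Rabs_def2 in H2.
  specialize (H (mkStepFun (StepFun_P28 (-1) phi psi))). rewrite StepFun_P30 in H.
  assert (A : RiemannInt_SF phi + -1 * RiemannInt_SF psi <= L).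
  { apply H. intros t Ht. simpl. specialize (H1 t Ht). apply Rabs_le_between in H1. lra. }
  assert (B : RInt F 0 1 <= RiemannInt_SF phi + 1 * RiemannInt_SF psi).
  { rewrite <- StepFun_P30, <- RInt_step. apply RInt_le; auto; [lra | apply ex_RInt_step |].
    intros t Ht. simpl. specialize (H1 t ltac:(lra)). apply Rabs_le_between in H1. lra. }
  lra.
Qed.

Lemma C1_curve_iff (U : Cx -> Prop) (gam gam' : R -> C) (p q : C) : C1_curve U gam gam' p q <->
  (forall t, Rderiv gam t (gam' t)) /\ (forall t, curve_cont gam' t) /\ gam 0 = p /\ gam 1 = q /\
  (forall t, 0 <= t <= 1 -> U (gam t)).
Proof.
  unfold C1_curve. split.
  - intros (H1 & H2 & H3 & H4 & H5 & H6 & H7). split; [|split; [|auto]].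
    + intro t. split; apply is_derive_Reals; auto.
    + intro t. split; apply continuity_pt_filterlim; auto.
  - intros (H1 & H2 & H5 & H6 & H7). split; [|split; [|split; [|split; [|auto]]]]; intro t.
    + apply is_derive_Reals, H1.
    + apply is_derive_Reals, H1.
    + apply continuity_pt_filterlim, H2.
    + apply continuity_pt_filterlim, H2.
Qed.

Definition poincare_density (z : C) : R := 2 / (1 - Cmod z ^ 2).

Lemma poincare_density_pos (z : C) : Cmod z < 1 -> 0 < poincare_density z.
Proof. intro H. pose proof (Cmod_ge_0 z). apply Rdiv_lt_0_compat; nra. Qed.

Lemma continuous_poincare_density (c : R -> C) (t : R) : curve_cont c t -> Cmod (c t) < 1 ->
  continuous (fun s => poincare_density (c s)) t.
Proof.
  intros Hc Hd. pose proof (Cmod_ge_0 (c t)). unfold poincare_density.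
  apply (continuous_comp (fun s => Cmod (c s)) (fun r => 2 / (1 - r ^ 2))).
  - now apply curve_cont_Cmod.
  - apply (@ex_derive_continuous R_AbsRing R_NormedModule). auto_derive. nra.
Qed.

Lemma continuous_mult_R (f g : R -> R) (t : R) : continuous f t -> continuous g t -> continuous (fun s => f s * g s) t.
Proof. intros; now apply (continuous_mult (K := R_AbsRing)). Qed.

Lemma ex_RInt_cont_on (F : R -> R) (a b : R) : a <= b -> (forall t, a <= t <= b -> continuous F t) -> ex_RInt F a b.
Proof.
  intros Hab H. apply (ex_RInt_continuous (V := R_CompleteNormedModule)).
  intros t. rewrite Rmin_left, Rmax_right by auto. apply H.
Qed.

Lemma poincare_le_elim (a b : C) (L : R) : poincare_le a b L -> exists s s',
  (forall t, Rderiv s t (s' t)) /\ (forall t, curve_cont s' t) /\ s 0 = a /\ s 1 = b /\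
  (forall t, 0 <= t <= 1 -> Cmod (s t) < 1) /\
  RInt (fun t => poincare_density (s t) * Cmod (s' t)) 0 1 <= L.
Proof.
  intros (s & s' & HC & HL). apply C1_curve_iff in HC. destruct HC as (H1 & H2 & H3 & H4 & H5).
  exists s, s'. split; [auto|]. split; [auto|]. split; [auto|]. split; [auto|]. split; [exact H5|].
  apply RInt_le_of_steps.
  - apply ex_RInt_cont_on; [lra|]. intros t Ht. apply continuous_mult_R.
    + apply continuous_poincare_density; [exact (Rderiv_cont _ _ _ (H1 t)) | now apply H5].
    + now apply curve_cont_Cmod.
  - intros phi Hphi. apply HL. intros t Ht. specialize (Hphi t Ht). split.
    + intro E. rewrite E in Hphi. change C0 with (RtoC 0) in Hphi. rewrite Cmod_0, Rmult_0_r in Hphi. auto.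
    + intros Hr. rewrite sqrt_poincare_coef by auto. exact Hphi.
Qed.

Lemma poincare_le_intro (s s' : R -> C) (L : R) :
  (forall t, Rderiv s t (s' t)) -> (forall t, curve_cont s' t) -> (forall t, 0 <= t <= 1 -> Cmod (s t) < 1) ->
  RInt (fun t => poincare_density (s t) * Cmod (s' t)) 0 1 <= L -> poincare_le (s 0) (s 1) L.
Proof.
  intros H1 H2 H3 H4. exists s, s'. split.
  - apply C1_curve_iff. auto.
  - intros phi Hphi. apply Rle_trans with (2 := H4). apply step_le_RInt.
    + apply ex_RInt_cont_on; [lra|]. intros t Ht. apply continuous_mult_R.
      * apply continuous_poincare_density; [exact (Rderiv_cont _ _ _ (H1 t)) | now apply H3].
      * now apply curve_cont_Cmod.
    + intros t Ht. destruct (Hphi t Ht) as [_ H]. specialize (H (H3 t Ht)).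
      rewrite sqrt_poincare_coef in H by (now apply H3). exact H.
Qed.

(** Stationary ends make concatenation of [C^1] curves smooth; the continuous majorant [G] of the
    length density turns lengths into genuine integrals. *)
Definition rest_curve (n : option nat) (p q : C) (L : R) : Prop :=
  exists (gam gam' : R -> C) (G : R -> R),
    (forall t, Rderiv gam t (gam' t)) /\ (forall t, curve_cont gam' t) /\ (forall t, continuous G t) /\
    (forall t, t <= 0 -> gam t = p /\ gam' t = 0 /\ G t = 0) /\
    (forall t, 1 <= t -> gam t = q /\ gam' t = 0 /\ G t = 0) /\
    (forall t, orb_dom n (gam t)) /\ (forall t, 0 <= G t) /\
    (forall t, gam' t = 0 \/ (omega_reg n (gam t) /\ sqrt (omega_coef n (gam t)) * Cmod (gam' t) <= G t)) /\
    RInt G 0 1 <= L.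

Lemma rest_curve_length (n : option nat) (p q : C) (L : R) : rest_curve n p q L ->
  length_set (omega_reg n) (omega_coef n) (orb_dom n) p q L.
Proof.
  intros (gam & gam' & G & H1 & H2 & H3 & H4 & H5 & H6 & H7 & H8 & H9). exists gam, gam'. split.
  - apply C1_curve_iff. split; [auto|]. split; [auto|]. split; [|split; [|intros; apply H6]].
    + apply (H4 0). lra.
    + apply (H5 1). lra.
  - intros phi Hphi. apply Rle_trans with (2 := H9). apply step_le_RInt.
    + apply ex_RInt_cont_on; [lra | auto].
    + intros t Ht. destruct (Hphi t Ht) as [A B]. destruct (H8 t) as [E|[Hr E]].
      * specialize (A E). specialize (H7 t). lra.
      * specialize (B Hr). change (Cnorm (gam' t)) with (Cmod (gam' t)) in B. lra.
Qed.

Lemma rest_curve_weaken (n : option nat) (p q : C) (L L' : R) : L <= L' -> rest_curve n p q L -> rest_curve n p q L'.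
Proof.
  intros HL (gam & gam' & G & H1 & H2 & H3 & H4 & H5 & H6 & H7 & H8 & H9).
  exists gam, gam', G. do 8 (split; [auto|]). lra.
Qed.

Lemma is_derive_affine (u v t : R) : is_derive (fun s => u * s + v) t u.
Proof. auto_derive; auto. ring. Qed.

Lemma continuous_affine (u v t : R) : continuous (fun s => u * s + v) t.
Proof. apply (@ex_derive_continuous R_AbsRing R_NormedModule). eexists. apply is_derive_affine. Qed.

Lemma continuous_comp_affine (G : R -> R) (u v t : R) : (forall s, continuous G s) -> continuous (fun s => G (u * s + v)) t.
Proof. intro H. apply (continuous_comp (fun s => u * s + v) G); [apply continuous_affine | apply H]. Qed.

Lemma RInt_comp_affine (G : R -> R) (u v a b : R) : (forall s, continuous G s) ->
  RInt (fun t => u * G (u * t + v)) a b = RInt G (u * a + v) (u * b + v).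
Proof.
  intro H. apply (RInt_comp_lin (V := R_CompleteNormedModule) G u v a b).
  apply (ex_RInt_continuous (V := R_CompleteNormedModule)). auto.
Qed.

Lemma rest_curve_sym (n : option nat) (p q : C) (L : R) : rest_curve n p q L -> rest_curve n q p L.
Proof.
  intros (gam & gam' & G & H1 & H2 & H3 & H4 & H5 & H6 & H7 & H8 & H9).
  exists (fun t => gam (-1 * t + 1)), (fun t => RtoC (-1) * gam' (-1 * t + 1)%R)%C, (fun t => G (-1 * t + 1)).
  split; [|split; [|split; [|split; [|split; [|split; [|split; [|split]]]]]]]; auto.
  - intro t. apply (Rderiv_reparam gam (fun t => -1 * t + 1)); [apply is_derive_affine | apply H1].
  - intro t. apply (curve_cont_mul (fun _ => RtoC (-1))); [apply curve_cont_const|].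
    apply (curve_cont_reparam gam' (fun t => -1 * t + 1)); [apply continuous_affine | apply H2].
  - intro t. now apply continuous_comp_affine.
  - intros t Ht. destruct (H5 (-1 * t + 1)) as (-> & -> & ->); [lra|]. repeat split; ring.
  - intros t Ht. destruct (H4 (-1 * t + 1)) as (-> & -> & ->); [lra|]. repeat split; ring.
  - intro t. destruct (H8 (-1 * t + 1)) as [E|[Hr E]].
    + left. rewrite E. ring.
    + right. split; auto. rewrite Cmod_mult, Cmod_R, Rabs_left by lra. replace (- -1) with 1 by ring. rewrite Rmult_1_l. auto.
  - pose proof (RInt_comp_affine G (-1) 1 0 1 H3) as E.
    replace (-1 * 0 + 1) with 1 in E by ring. replace (-1 * 1 + 1) with 0 in E by ring.
    rewrite <- (opp_RInt_swap (V := R_CompleteNormedModule) G 0 1) in E by (apply (ex_RInt_continuous (V := R_CompleteNormedModule)); auto).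
    rewrite (RInt_scal (V := R_CompleteNormedModule) (fun t => G (-1 * t + 1))) in E.
    + unfold scal, opp in E; simpl in E; unfold mult in E; simpl in E. lra.
    + apply (ex_RInt_continuous (V := R_CompleteNormedModule)). intros; now apply continuous_comp_affine.
Qed.

Lemma RInt_zero_on (G : R -> R) (a b : R) : a <= b -> (forall t, a <= t <= b -> G t = 0) -> RInt G a b = 0.
Proof.
  intros Hab H. rewrite (RInt_ext _ (fun _ => 0)).
  - rewrite RInt_const. unfold scal; simpl; unfold mult; simpl. ring.
  - rewrite Rmin_left, Rmax_right by auto. intros; apply H; lra.
Qed.

(** The concatenation is the single formula [g (2 t) + k (2 t - 1) - q]. At each time one of the two
    curves rests at [q], so differentiability at the junction needs no case distinction. *)
Lemma rest_curve_trans (n : option nat) (p q r : C) (L1 L2 : R) :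
  rest_curve n p q L1 -> rest_curve n q r L2 -> rest_curve n p r (L1 + L2).
Proof.
  intros (g & g' & G & H1 & H2 & H3 & H4 & H5 & H6 & H7 & H8 & H9)
         (k & k' & K & J1 & J2 & J3 & J4 & J5 & J6 & J7 & J8 & J9).
  set (c := fun t => (g (2 * t + 0)%R + (k (2 * t + -1)%R + - q))%C).
  set (c' := fun t => (RtoC 2 * g' (2 * t + 0)%R + RtoC 2 * k' (2 * t + -1)%R)%C).
  assert (Hlo : forall t, t <= 1 / 2 -> c t = g (2 * t + 0) /\ c' t = (RtoC 2 * g' (2 * t + 0)%R)%C /\ K (2 * t + -1) = 0).
  { intros t Ht. destruct (J4 (2 * t + -1)) as (E1 & E2 & E3); [lra|]. unfold c, c'.
    rewrite E1, E2. repeat split; auto; ring. }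
  assert (Hhi : forall t, 1 / 2 <= t -> c t = k (2 * t + -1) /\ c' t = (RtoC 2 * k' (2 * t + -1)%R)%C /\ G (2 * t + 0) = 0).
  { intros t Ht. destruct (H5 (2 * t + 0)) as (E1 & E2 & E3); [lra|]. unfold c, c'.
    rewrite E1, E2. repeat split; auto; ring. }
  exists c, c', (fun t => 2 * G (2 * t + 0) + 2 * K (2 * t + -1)).
  assert (HC : forall t, orb_dom n (c t) /\ (c' t = 0 \/ (omega_reg n (c t) /\
    sqrt (omega_coef n (c t)) * Cmod (c' t) <= 2 * G (2 * t + 0) + 2 * K (2 * t + -1)))).
  { intro t. destruct (Rle_dec t (1/2)) as [Ht|Ht].
    - destruct (Hlo t Ht) as (-> & -> & ->). split; auto. destruct (H8 (2 * t + 0)) as [E|[Hr E]].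
      + left. rewrite E. ring.
      + right. split; auto. rewrite Cmod_mult, Cmod_R, Rabs_pos_eq by lra. lra.
    - destruct (Hhi t) as (-> & -> & ->); [lra|]. split; auto. destruct (J8 (2 * t + -1)) as [E|[Hr E]].
      + left. rewrite E. ring.
      + right. split; auto. rewrite Cmod_mult, Cmod_R, Rabs_pos_eq by lra. lra. }
  assert (CK : forall t, continuous (fun t => 2 * K (2 * t + -1)) t).
  { intro t. apply (continuous_mult_R (fun _ => 2)); [apply continuous_const | now apply continuous_comp_affine]. }
  assert (CG : forall t, continuous (fun t => 2 * G (2 * t + 0)) t).
  { intro t. apply (continuous_mult_R (fun _ => 2)); [apply continuous_const | now apply continuous_comp_affine]. }
  split; [|split; [|split; [|split; [|split; [|split; [|split; [|split]]]]]]].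
  - intro t. apply Rderiv_add.
    + apply (Rderiv_reparam g (fun t => 2 * t + 0)); [apply is_derive_affine | apply H1].
    + eapply Rderiv_eq; [|apply Rderiv_add; [apply (Rderiv_reparam k (fun t => 2 * t + -1)); [apply is_derive_affine | apply J1] | apply Rderiv_const]].
      ring.
  - intro t. apply curve_cont_add.
    + apply (curve_cont_mul (fun _ => RtoC 2)); [apply curve_cont_const|].
      apply (curve_cont_reparam g' (fun t => 2 * t + 0)); [apply continuous_affine | apply H2].
    + apply (curve_cont_mul (fun _ => RtoC 2)); [apply curve_cont_const|].
      apply (curve_cont_reparam k' (fun t => 2 * t + -1)); [apply continuous_affine | apply J2].
  - intro t. apply (continuous_plus (V := R_NormedModule)); auto.
  - intros t Ht. destruct (Hlo t) as (-> & -> & ->); [lra|]. destruct (H4 (2 * t + 0)) as (-> & -> & ->); [lra|].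
    repeat split; ring.
  - intros t Ht. destruct (Hhi t) as (-> & -> & ->); [lra|]. destruct (J5 (2 * t + -1)) as (-> & -> & ->); [lra|].
    repeat split; ring.
  - apply HC.
  - intro t. specialize (H7 (2 * t + 0)). specialize (J7 (2 * t + -1)). lra.
  - apply HC.
  - assert (ex : forall F : R -> R, (forall t, continuous F t) -> forall a b, ex_RInt F a b).
    { intros F HF a b. apply (ex_RInt_continuous (V := R_CompleteNormedModule)). auto. }
    rewrite (RInt_plus (V := R_CompleteNormedModule) (fun t => 2 * G (2 * t + 0)) (fun t => 2 * K (2 * t + -1))) by auto.
    rewrite !RInt_comp_affine by auto.
    replace (2 * 0 + 0) with 0 by ring. replace (2 * 1 + 0) with 2 by ring.
    replace (2 * 0 + -1) with (-1) by ring. replace (2 * 1 + -1) with 1 by ring.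
    rewrite <- (RInt_Chasles (V := R_CompleteNormedModule) G 0 1 2), <- (RInt_Chasles (V := R_CompleteNormedModule) K (-1) 0 1) by auto.
    rewrite (RInt_zero_on G 1 2), (RInt_zero_on K (-1) 0).
    + unfold plus; simpl. lra.
    + lra.
    + intros t Ht. now apply J4.
    + lra.
    + intros t Ht. now apply H5.
Qed.

Lemma rest_curve_refl (n : option nat) (p : C) : orb_dom n p -> rest_curve n p p 0.
Proof.
  intro Hp. exists (fun _ => p), (fun _ => RtoC 0), (fun _ => 0).
  split; [|split; [|split; [|split; [|split; [|split; [|split; [|split]]]]]]]; auto.
  - intro. apply Rderiv_const.
  - intro. apply curve_cont_const.
  - intro. apply continuous_const.
  - intros; lra.
  - rewrite RInt_zero_on; auto; lra.
Qed.

(** The disc curve is slowed down by [smooth] and pushed forward by [h]. Its Poincare length density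
    serves as the majorant [G]; it remains finite and continuous where [h] vanishes. *)
Lemma rest_curve_morphism (n : option nat) (h : C -> C) (a b : C) (L : R) :
  (forall m, n = Some m -> (1 <= m)%nat) -> orbifold_morphism false n h -> poincare_le a b L ->
  rest_curve n (h a) (h b) L.
Proof.
  intros Hn Hh HL. destruct (poincare_le_elim _ _ _ HL) as (s & s' & H1 & H2 & <- & <- & H5 & H6).
  assert (Hhol : holomorphic_on in_disc h) by apply Hh.
  assert (Hin : forall t, Cmod (s (smooth t)) < 1) by (intro t; apply H5, smooth_range).
  assert (Rs : forall t, Rderiv (fun t => s (smooth t)) t (bump t * s' (smooth t))).
  { intro t. apply Rderiv_reparam; [apply is_derive_smooth | apply H1]. }
  assert (Cs' : forall t, curve_cont (fun t => s' (smooth t)) t).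
  { intro t. apply curve_cont_reparam; [apply smooth_cont | apply H2]. }
  set (c' := fun t => (Cder h (s (smooth t)) * (bump t * s' (smooth t)))%C).
  set (F := fun t => poincare_density (s t) * Cmod (s' t)).
  assert (HG : forall t, 0 <= bump t * F (smooth t)).
  { intro t. unfold F. apply Rmult_le_pos; [apply bump_ge_0|]. apply Rmult_le_pos; [|apply Cmod_ge_0].
    left. now apply poincare_density_pos. }
  exists (fun t => h (s (smooth t))), c', (fun t => bump t * F (smooth t)).
  split; [|split; [|split; [|split; [|split; [|split; [|split; [|split]]]]]]]; auto.
  - intro t. apply (Rderiv_comp h (fun t => s (smooth t))); auto. now apply holo_Cder.
  - intro t. apply curve_cont_mul.
    + apply (curve_cont_comp (Cder h) (fun t => s (smooth t))); [exact (Rderiv_cont _ _ _ (Rs t)) | now apply Cder_cont].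
    + apply curve_cont_mul; auto. apply curve_cont_real, bump_cont.
  - intro t. apply continuous_mult_R; [apply bump_cont|]. unfold F. apply continuous_mult_R.
    + apply (continuous_poincare_density (fun t => s (smooth t))); auto. exact (Rderiv_cont _ _ _ (Rs t)).
    + apply (curve_cont_Cmod (fun t => s' (smooth t))); auto.
  - intros t Ht. unfold c'. rewrite (bump_out t), smooth_le_0 by auto. repeat split; auto; ring.
  - intros t Ht. unfold c'. rewrite (bump_out t), smooth_ge_1 by auto. repeat split; auto; ring.
  - intro t. destruct Hh as (_ & Hb & _ & Hz). split; [apply Hb, Hin|]. intros ->. apply Hz, Hin.
  - intro t. destruct (orbifold_Schwarz_Pick n h (s (smooth t)) (Cder h (s (smooth t)))) as [E|[Hr E]]; auto.
    + exact (Hin t).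
    + now apply holo_Cder.
    + left. unfold c'. rewrite E. ring.
    + right. split; auto. unfold c', F. rewrite !Cmod_mult, Cmod_R, Rabs_pos_eq by apply bump_ge_0.
      rewrite sqrt_poincare_coef in E by auto. fold (poincare_density (s (smooth t))) in E.
      pose proof (bump_ge_0 t). pose proof (Cmod_ge_0 (s' (smooth t))).
      assert (0 <= bump t * Cmod (s' (smooth t))) by now apply Rmult_le_pos. nra.
  - apply Rle_trans with (2 := H6). right.
    apply eq_trans with (RInt F (smooth 0) (smooth 1)); [|now rewrite smooth_0, smooth_1].
    apply (RInt_comp (V := R_CompleteNormedModule) F smooth bump 0 1).
    + intros t _. unfold F. apply continuous_mult_R.
      * apply continuous_poincare_density; [exact (Rderiv_cont _ _ _ (H1 _)) | auto].
      * now apply curve_cont_Cmod.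
    + intros t _. split; [apply is_derive_smooth | apply bump_cont].
Qed.

(** * Lifting curves to the disc *)

(** For [n = None], the Cayley map of the disc onto the left half-plane followed by [exp]. *)
Definition cover (n : option nat) (z : C) : C :=
  match n with Some m => (z ^ m)%C | None => Cexp ((z + 1) / (z - 1)) end.

Lemma sub_1_neq_0 (z : C) : fst z < 1 -> (z - 1)%C <> 0.
Proof. intros H E. apply (f_equal fst) in E. simpl in E. lra. Qed.

Lemma Cmod_lt_1_fst (z : C) : Cmod z < 1 -> fst z < 1.
Proof. intro H. pose proof (Rabs_fst_le z). pose proof (Rle_abs (fst z)). lra. Qed.

Lemma Cayley_fst (z : C) : (z - 1)%C <> 0 -> fst ((z + 1) / (z - 1))%C = (Cmod z ^ 2 - 1) / Cmod (z - 1) ^ 2.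
Proof.
  intro H. pose proof (Cmod_pos _ H) as P. pose proof (Cmod_sqr (z - 1)) as E. rewrite E, Cmod_sqr.
  assert (0 < Cmod (z - 1) ^ 2) by nra. rewrite E in H0. clear E P H. destruct z as [x y]. simpl in *.
  field. nra.
Qed.

Lemma Cayley_neg (z : C) : Cmod z < 1 -> fst ((z + 1) / (z - 1))%C < 0.
Proof.
  intro H. pose proof (sub_1_neq_0 z (Cmod_lt_1_fst z H)) as H1. rewrite Cayley_fst by auto.
  pose proof (Cmod_ge_0 z). apply Cmod_pos in H1.
  apply Rmult_lt_reg_r with (Cmod (z - 1) ^ 2); [nra|]. field_simplify; [nra | lra].
Qed.

Lemma Cderiv_Cayley (z : C) : (z - 1)%C <> 0 ->
  Cderiv (fun z => (z + 1) / (z - 1))%C z (- (2) / ((z - 1) * (z - 1))).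
Proof.
  intro H. eapply Cderiv_eq; [|apply (Cderiv_div (fun z => z + 1)%C (fun z => z - 1)%C z (1 + 0) (1 - 0))]; auto.
  - field. auto.
  - apply Cderiv_add; [apply Cderiv_id | apply Cderiv_const].
  - apply Cderiv_sub; [apply Cderiv_id | apply Cderiv_const].
Qed.

Lemma cover_morphism (n : option nat) : (forall m, n = Some m -> (1 <= m)%nat) ->
  orbifold_morphism true n (cover n).
Proof.
  intro Hn. destruct n as [m|].
  - specialize (Hn m eq_refl). simpl. split; [|split; [|split]].
    + intros z _. change (exists l, Cderiv (fun z => z ^ m)%C z l). eexists. apply Cderiv_pow, Cderiv_id.
    + intros z Hz. change (Cmod (z ^ m)%C < 1). change (Cmod z < 1) in Hz. rewrite Cmod_pow.
      pose proof (Cmod_ge_0 z). destruct m as [|m]; [lia|]. simpl.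
      assert (Cmod z ^ m <= 1) by (rewrite <- (pow1 m); apply pow_incr; lra).
      pose proof (pow_le _ m H). nra.
    + right. exists (RtoC (1/2)). split; [change (Cmod (1/2)%R < 1); rewrite Cmod_R, Rabs_pos_eq; lra|].
      apply Cpow_nz. intro E. apply RtoC_inj in E. lra.
    + intros z _ E. exists m. split; [|exists 1%nat; lia].
      destruct (Ceq_dec z 0) as [->|Hn0]; [|exfalso; now apply (Cpow_nz z m)].
      apply (vanishing_order_intro _ _ _ 1 (fun _ => RtoC 1)); [lra | | |].
      * intros w _. eexists. apply Cderiv_const.
      * intro X. apply RtoC_inj in X. lra.
      * intros w _. change ((w ^ m)%C = ((w - 0) ^ m * 1)%C). replace (w - 0)%C with w by ring. ring.
  - simpl. split; [|split; [|split]].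
    + intros z Hz. eexists. apply (Cderiv_comp Cexp (fun z => (z + 1) / (z - 1))%C).
      * apply Cderiv_Cayley, sub_1_neq_0, Cmod_lt_1_fst, Hz.
      * apply Cderiv_Cexp.
    + intros z Hz. change (Cmod (Cexp ((z + 1) / (z - 1))) < 1). rewrite Cmod_Cexp.
      pose proof (exp_increasing _ _ (Cayley_neg z Hz)) as X. now rewrite exp_0 in X.
    + right. exists (RtoC 0). split; [change (Cmod 0 < 1); rewrite Cmod_0; lra | apply Cexp_neq_0].
    + intros z _. apply Cexp_neq_0.
Qed.

Definition omega_density (n : option nat) (z : C) : R := sqrt (omega_coef n z).

Lemma omega_density_ge_0 (n : option nat) (z : C) : 0 <= omega_density n z.
Proof. apply sqrt_pos. Qed.

(** A logarithm [l] of [c] along the curve gives the lift [exp (l / m)], or the Cayley image of [l]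
    when [n = None]. Only the pointwise equality of the two length densities has to be checked,
    which is what [Red] isolates. *)
Lemma lift_curve (n : option nat) (c c' : R -> C) (L : R) : (forall m, n = Some m -> (1 <= m)%nat) ->
  (forall t, Rderiv c t (c' t)) -> (forall t, curve_cont c' t) -> (forall t, 0 < Cmod (c t) < 1) ->
  RInt (fun t => omega_density n (c t) * Cmod (c' t)) 0 1 <= L ->
  exists a b, Cmod a < 1 /\ Cmod b < 1 /\ cover n a = c 0 /\ cover n b = c 1 /\ poincare_le a b L.
Proof.
  intros Hn H1 H2 H3 HL.
  assert (Hc0 : forall t, c t <> 0) by (intro t; apply Cmod_gt_0, H3).
  destruct (polar (c 0) (Hc0 0)) as [c0 Ec0].
  destruct (ex_intro (fun l : R -> C => (forall t, Rderiv l t (c' t / c t)) /\ forall t, c t = Cexp (l t))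
    _ (exp_primitive c c' c0 H1 H2 Hc0 Ec0)) as (l & Dl & El).
  set (l' := fun t => (c' t / c t)%C).
  assert (Cl' : forall t, curve_cont l' t).
  { intro t. apply curve_cont_mul; auto. apply curve_cont_inv; auto. exact (Rderiv_cont _ _ _ (H1 t)). }
  assert (Hln : forall t, fst (l t) = ln (Cmod (c t))).
  { intro t. now rewrite (El t), Cmod_Cexp, ln_exp. }
  assert (Hneg : forall t, fst (l t) < 0).
  { intro t. rewrite Hln. pose proof (neg_ln_pos _ (H3 t)). lra. }
  assert (Red : forall s s' : R -> C, (forall t, Rderiv s t (s' t)) -> (forall t, curve_cont s' t) ->
    (forall t, Cmod (s t) < 1) -> (forall t, cover n (s t) = c t) ->
    (forall t, poincare_density (s t) * Cmod (s' t) = omega_density n (c t) * Cmod (c' t)) ->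
    exists a b, Cmod a < 1 /\ Cmod b < 1 /\ cover n a = c 0 /\ cover n b = c 1 /\ poincare_le a b L).
  { intros s s' S1 S2 S3 S4 S5. exists (s 0), (s 1). do 4 (split; auto).
    apply (poincare_le_intro s s'); auto. rewrite (RInt_ext _ (fun t => omega_density n (c t) * Cmod (c' t))); auto. }
  destruct n as [m|].
  - specialize (Hn m eq_refl). assert (Hm : 1 <= INR m) by (change 1 with (INR 1); now apply le_INR).
    assert (HmC : RtoC (INR m) <> 0) by (intro X; apply RtoC_inj in X; lra).
    set (s := fun t => Cexp (/ INR m * l t)).
    assert (Ms : forall t, Cmod (s t) = exp (ln (Cmod (c t)) / INR m)).
    { intro t. unfold s. rewrite Cmod_Cexp, <- RtoC_inv, <- Hln by lra. simpl. f_equal. field. lra. }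
    assert (Ms1 : forall t, Cmod (s t) < 1).
    { intro t. rewrite Ms, <- exp_0. apply exp_increasing. rewrite <- Hln. specialize (Hneg t).
      apply Rlt_div_l; lra. }
    assert (Ds : forall t, Rderiv s t (Cexp (/ INR m * l t) * (/ INR m * l' t))).
    { intro t. apply (Rderiv_comp Cexp (fun t => / INR m * l t)%C); [apply Rderiv_scal, Dl | apply Cderiv_Cexp]. }
    apply (Red s (fun t => s t * (/ INR m * l' t))%C); auto.
    + intro t. apply curve_cont_mul; [exact (Rderiv_cont _ _ _ (Ds t))|].
      apply (curve_cont_mul (fun _ => (/ INR m)%C)); [apply curve_cont_const | auto].
    + intro t. unfold s. simpl. rewrite <- Cexp_nat, El. f_equal. field. auto.
    + intro t. unfold omega_density. rewrite sqrt_omega_Some by auto.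
      unfold poincare_density. rewrite !Cmod_mult, Cmod_inv, Cmod_R, (Rabs_pos_eq (INR m)) by (auto; lra).
      unfold l'. rewrite Cmod_div by auto.
      assert (Es : sh2 (- ln (Cmod (c t)) / INR m) = / Cmod (s t) - Cmod (s t)).
      { rewrite Ms. unfold sh2. rewrite <- exp_Ropp. f_equal; [f_equal; field; lra | do 2 f_equal; field; lra]. }
      rewrite Es. pose proof (Cmod_pos _ (Cexp_neq_0 (/ INR m * l t))) as Ps. fold (s t) in Ps.
      specialize (Ms1 t). destruct (H3 t). field. repeat split; try lra; nra.
  - set (s := fun t => ((l t + 1) / (l t - 1))%C).
    assert (Hl1 : forall t, (l t - 1)%C <> 0) by (intro t; apply sub_1_neq_0; specialize (Hneg t); lra).
    assert (Ds : forall t, Rderiv s t (- (2) / ((l t - 1) * (l t - 1)) * l' t)).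
    { intro t. apply (Rderiv_comp (fun z => (z + 1) / (z - 1))%C l); [apply Dl | apply Cderiv_Cayley; auto]. }
    assert (Ms : forall t, 1 - Cmod (s t) ^ 2 = - 4 * fst (l t) / Cmod (l t - 1) ^ 2).
    { intro t. unfold s. rewrite Cmod_div by auto. pose proof (Cmod_pos _ (Hl1 t)) as P.
      unfold Rdiv at 1. rewrite Rpow_mult_distr, pow_inv.
      apply Rmult_eq_reg_r with (Cmod (l t - 1) ^ 2); [|nra]. field_simplify; [|lra|lra].
      rewrite !Cmod_sqr. simpl. ring. }
    assert (Ms1 : forall t, Cmod (s t) < 1).
    { intro t. pose proof (Cmod_pos _ (Hl1 t)) as P. specialize (Ms t). specialize (Hneg t).
      assert (0 < - 4 * fst (l t) / Cmod (l t - 1) ^ 2) by (apply Rdiv_lt_0_compat; nra).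
      pose proof (Cmod_ge_0 (s t)). apply Rnot_le_lt. intro. nra. }
    apply (Red s (fun t => - (2) / ((l t - 1) * (l t - 1)) * l' t)%C); auto.
    + intro t. apply curve_cont_mul; auto. apply curve_cont_mul; [apply curve_cont_const|].
      assert (K : curve_cont (fun t => l t - 1)%C t).
      { apply curve_cont_add; [exact (Rderiv_cont _ _ _ (Dl t)) | apply curve_cont_const]. }
      apply (curve_cont_inv (fun t => (l t - 1) * (l t - 1))%C); [now apply curve_cont_mul | now apply Cmult_neq_0].
    (* The Cayley map is an involution, so [cover] sends its value at [l t] back to [exp (l t)]. *)
    + intro t. rewrite El. unfold cover, s. f_equal. field. split; auto.
      replace (l t + 1 - (l t - 1))%C with (RtoC 2) by ring.
      intro X. apply RtoC_inj in X. lra.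
    + intro t. unfold omega_density. rewrite sqrt_omega_None, <- Hln by auto.
      unfold poincare_density. rewrite Ms, Cmod_mult, Cmod_div, Cmod_mult, Cmod_opp, Cmod_R, Rabs_pos_eq by (try lra; now apply Cmult_neq_0).
      unfold l'. rewrite Cmod_div by auto. pose proof (Cmod_pos _ (Hl1 t)). specialize (Hneg t). destruct (H3 t).
      field. repeat split; lra.
Qed.

Lemma continuous_omega_density (n : option nat) (c : R -> C) (t : R) : (forall m, n = Some m -> (1 <= m)%nat) ->
  curve_cont c t -> 0 < Cmod (c t) < 1 -> continuous (fun s => omega_density n (c s)) t.
Proof.
  intros Hn Hc Ht. pose proof (curve_cont_Cmod c t Hc) as CM.
  assert (Hloc : locally t (fun s => 0 < Cmod (c s) < 1)).
  { apply (CM (fun r => 0 < r < 1)). apply (open_and _ _ (open_gt 0) (open_lt 1)). exact Ht. }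
  destruct n as [m|].
  - specialize (Hn m eq_refl). assert (Hm : 1 <= INR m) by (change 1 with (INR 1); now apply le_INR).
    apply (continuous_ext_loc _ (fun s => 2 / (INR m * sh2 (- ln (Cmod (c s)) / INR m) * Cmod (c s)))).
    + apply filter_imp with (2 := Hloc). intros s Hs. unfold omega_density. now rewrite sqrt_omega_Some.
    + apply (continuous_comp (fun s => Cmod (c s)) (fun r => 2 / (INR m * sh2 (- ln r / INR m) * r))); auto.
      assert (0 < sh2 (- ln (Cmod (c t)) / INR m)).
      { apply sh2_pos, Rdiv_lt_0_compat; [now apply neg_ln_pos | lra]. }
      apply (@ex_derive_continuous R_AbsRing R_NormedModule). unfold sh2 in *. auto_derive.
      repeat split; try lra. unfold Rdiv, Rminus in *. 
      apply Rgt_not_eq. repeat apply Rmult_lt_0_compat; lra.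
  - apply (continuous_ext_loc _ (fun s => 1 / (Cmod (c s) * - ln (Cmod (c s))))).
    + apply filter_imp with (2 := Hloc). intros s Hs. unfold omega_density. now rewrite sqrt_omega_None.
    + apply (continuous_comp (fun s => Cmod (c s)) (fun r => 1 / (r * - ln r))); auto.
      pose proof (neg_ln_pos _ Ht).
      apply (@ex_derive_continuous R_AbsRing R_NormedModule). auto_derive. repeat split; try lra.
      apply Rgt_not_eq. apply Rmult_lt_0_compat; lra.
Qed.

(** Kobayashi chains whose links all come from [cover], with upper bounds on their costs. Symmetry,
    concatenation and weakening are constructors, so that properties of chains follow by rule
    induction. *)
Inductive chain (n : option nat) : C -> C -> R -> Prop :=
| chain_link a b L : in_disc a -> in_disc b -> poincare_le a b L -> chain n (cover n a) (cover n b) L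
| chain_sym p q L : chain n p q L -> chain n q p L
| chain_trans p q r L1 L2 : chain n p q L1 -> chain n q r L2 -> chain n p r (L1 + L2)
| chain_weaken p q L L' : L <= L' -> chain n p q L -> chain n p q L'.

Lemma morphism_orb_dom (cl : bool) (n : option nat) (h : C -> C) (z : C) :
  orbifold_morphism cl n h -> in_disc z -> orb_dom n (h z).
Proof. intros (_ & Hb & _ & Hz) H. split; [auto|]. intros ->. auto. Qed.

Lemma chain_rest_curve (n : option nat) (p q : C) (L : R) : (forall m, n = Some m -> (1 <= m)%nat) ->
  chain n p q L -> rest_curve n p q L.
Proof.
  intros Hn H. induction H.
  - apply rest_curve_morphism; auto. apply orbifold_morphism_weaken. now apply cover_morphism.
  - now apply rest_curve_sym.
  - now apply (rest_curve_trans n p q r).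
  - now apply (rest_curve_weaken n p q L).
Qed.

Lemma cover_morphism_any (cl : bool) (n : option nat) : (forall m, n = Some m -> (1 <= m)%nat) ->
  orbifold_morphism cl n (cover n).
Proof.
  intro Hn. pose proof (cover_morphism n Hn). destruct cl; auto. now apply orbifold_morphism_weaken.
Qed.

(** Membership of the end points is carried through the induction because the axioms of a
    pseudo-distance only hold for points of [orb_dom n]. *)
Lemma contracted_chain (cl : bool) (n : option nat) (d : Cx -> Cx -> R) (p q : C) (L : R) :
  (forall m, n = Some m -> (1 <= m)%nat) -> pseudo_distance_on (orb_dom n) d -> contracted cl n d ->
  chain n p q L -> orb_dom n p /\ orb_dom n q /\ d p q <= L.
Proof.
  intros Hn Hp Hc H. pose proof (cover_morphism_any cl n Hn) as Hm. induction H.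
  - split; [now apply (morphism_orb_dom cl)|]. split; [now apply (morphism_orb_dom cl)|]. now apply Hc.
  - destruct IHchain as (A & B & D). split; [auto|]. split; [auto|].
    destruct (Hp q p p B A A) as (_ & -> & _). auto.
  - destruct IHchain1 as (A & B & D). destruct IHchain2 as (_ & E & F). split; [auto|]. split; [auto|].
    destruct (Hp p q r A B E) as (_ & _ & T). lra.
  - destruct IHchain as (A & B & D). repeat split; try apply A; try apply B. lra.
Qed.

Lemma length_density_cont (n : option nat) (gam gam' : R -> C) (t : R) : (forall m, n = Some m -> (1 <= m)%nat) ->
  curve_cont gam t -> curve_cont gam' t -> 0 < Cmod (gam t) < 1 ->
  continuous (fun t => omega_density n (gam t) * Cmod (gam' t)) t.
Proof.
  intros Hn H1 H2 Ht. apply continuous_mult_R; [now apply continuous_omega_density | now apply curve_cont_Cmod].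
Qed.

(** [lift_curve] asks for a curve avoiding [0] at all real times, while [gam] is controlled on
    [[s, t]] only. The reparametrisation [g] maps the whole line into [[s, t]] and preserves the
    integral. *)
Lemma chain_segment (n : option nat) (gam gam' : R -> C) (s t : R) : (forall m, n = Some m -> (1 <= m)%nat) ->
  (forall t, Rderiv gam t (gam' t)) -> (forall t, curve_cont gam' t) ->
  s <= t -> (forall u, s <= u <= t -> gam u <> 0 /\ Cmod (gam u) < 1) ->
  let F := fun t => omega_density n (gam t) * Cmod (gam' t) in
  ex_RInt F s t /\ chain n (gam s) (gam t) (RInt F s t).
Proof.
  intros Hn H1 H2 Hst Hg F.
  assert (CF : forall u, s <= u <= t -> continuous F u).
  { intros u Hu. destruct (Hg u Hu). apply length_density_cont; auto; [exact (Rderiv_cont _ _ _ (H1 u))|].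
    split; auto. now apply Cmod_pos. }
  split; [now apply ex_RInt_cont_on|].
  set (g := fun u => (t - s) * smooth u + s).
  assert (Hg1 : forall u, s <= g u <= t).
  { intro u. unfold g. pose proof (smooth_range u). nra. }
  assert (Dg : forall u, is_derive g u ((t - s) * bump u)).
  { intro u. unfold g. apply (is_derive_ext (fun u => plus (scal (t - s) (smooth u)) s)); [reflexivity|].
    replace ((t - s) * bump u) with (plus (scal (t - s) (bump u)) (0 : R_NormedModule)) by (unfold plus, scal; simpl; unfold mult; simpl; ring).
    apply (is_derive_plus (V := R_NormedModule)); [apply (is_derive_scal smooth), is_derive_smooth | apply (is_derive_const (V := R_NormedModule))]. }
  assert (Cg : forall u, continuous g u).
  { intro u. apply (@ex_derive_continuous R_AbsRing R_NormedModule). eexists. apply Dg. }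
  assert (Cb : forall u, continuous (fun u => (t - s) * bump u) u).
  { intro u. apply continuous_mult_R; [apply continuous_const | apply bump_cont]. }
  destruct (lift_curve n (fun u => gam (g u)) (fun u => RtoC ((t - s) * bump u) * gam' (g u))%C (RInt F s t) Hn)
    as (a & b & Ha & Hb & Ea & Eb & HL).
  - intro u. apply Rderiv_reparam; auto.
  - intro u. apply curve_cont_mul; [now apply curve_cont_real|]. now apply curve_cont_reparam.
  - intro u. destruct (Hg (g u) (Hg1 u)). split; auto. now apply Cmod_pos.
  - right. apply eq_trans with (RInt F (g 0) (g 1)).
    2:{ unfold g. rewrite smooth_0, smooth_1. f_equal; ring. }
    rewrite <- (RInt_comp (V := R_CompleteNormedModule) F g (fun u => (t - s) * bump u) 0 1); auto.
    apply RInt_ext. intros u _. unfold F, scal; simpl; unfold mult; simpl.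
    rewrite Cmod_mult, Cmod_R, Rabs_pos_eq by (apply Rmult_le_pos; [lra | apply bump_ge_0]). ring.
  - assert (E0 : g 0 = s) by (unfold g; rewrite smooth_0; ring).
    assert (E1 : g 1 = t) by (unfold g; rewrite smooth_1; ring).
    rewrite E0 in Ea. rewrite E1 in Eb. rewrite <- Ea, <- Eb. now apply chain_link.
Qed.

Lemma first_zero (gam : R -> C) (z : R) : (forall t, curve_cont gam t) -> 0 <= z -> gam z = 0 ->
  exists t0, 0 <= t0 <= z /\ gam t0 = 0 /\ forall u, 0 <= u < t0 -> gam u <> 0.
Proof.
  intros H1 Hz Ez.
  destruct (classic (gam 0 = 0)) as [E0|E0].
  { exists 0. split; [lra|]. split; [auto|]. intros; lra. }
  (* The first zero is the supremum of the times before which none occurs. If [gam] were nonzero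
     there, continuity would extend the zero-free interval past the supremum or up to [z], where
     [gam] vanishes. *)
  set (E := fun s => 0 <= s <= z /\ forall u, 0 <= u <= s -> gam u <> 0).
  destruct (completeness E) as [t0 [U1 U2]].
  - exists z. intros s [Hs _]. lra.
  - exists 0. split; [lra|]. intros u Hu. now replace u with 0 by lra.
  - assert (T0 : 0 <= t0) by (apply U1; split; [lra|]; intros u Hu; now replace u with 0 by lra).
    assert (T1 : t0 <= z) by (apply U2; intros s [Hs _]; lra).
    assert (Hlt : forall u, 0 <= u < t0 -> gam u <> 0).
    { intros u Hu Eu. assert (t0 <= u); [|lra]. apply U2. intros s [Hs Hs']. apply Rnot_lt_le. intro.
      apply (Hs' u); auto. lra. }
    exists t0. repeat split; auto. destruct (Ceq_dec (gam t0) 0) as [|Hne]; auto. exfalso.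
    pose proof (proj1 (curve_cont_iff _ _) (H1 t0) _ (Cmod_pos _ Hne)) as (d & Pd & Qd).
    assert (Hnz : forall u, 0 <= u <= Rmin z (t0 + d / 2) -> gam u <> 0).
    { intros u Hu. destruct (Rlt_dec u t0); [apply Hlt; lra|]. intro Eu.
      pose proof (Rmin_r z (t0 + d / 2)). specialize (Qd u ltac:(rewrite Rabs_pos_eq; lra)).
      rewrite Eu, Cmod_minus_sym in Qd. replace (gam t0 - 0)%C with (gam t0) in Qd by ring. lra. }
    destruct (Rle_dec z (t0 + d / 2)).
    + rewrite Rmin_left in Hnz by auto. apply (Hnz z); auto. lra.
    + rewrite Rmin_right in Hnz by lra.
      assert (t0 + d / 2 <= t0); [|lra]. apply U1. split; auto. lra.
Qed.
Lemma root_exists (m : nat) (z : C) : (1 <= m)%nat -> exists b, (b ^ m)%C = z.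
Proof.
  intro Hm. destruct (Ceq_dec z 0) as [->|Hz].
  - exists (RtoC 0). destruct m; [lia|]. simpl. ring.
  - destruct (polar z Hz) as [c <-]. exists (Cexp (/ INR m * c)). rewrite <- Cexp_nat. f_equal.
    assert (INR m <> 0) by (apply not_0_INR; lia). field. intro X. apply RtoC_inj in X. auto.
Qed.

(** The segment from [0] to an [m]-th root [b] of [z] lies where the Poincare density is at most
    [4], as [|b| < 1/2], so its length is at most [4 * |b| <= e]. *)
Lemma chain_radial (m : nat) (e : R) : (1 <= m)%nat -> 0 < e ->
  exists d, 0 < d /\ forall z, Cmod z < d -> chain (Some m) 0 z e.
Proof.
  intros Hm He. set (eta := Rmin (1/2) (e / 4)). assert (P : 0 < eta) by (apply Rmin_pos; lra).
  assert (E1 := Rmin_l (1/2) (e / 4)). assert (E2 := Rmin_r (1/2) (e / 4)). fold eta in E1, E2. clearbody eta.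
  exists (eta ^ m). split; [now apply pow_lt|]. intros z Hz.
  destruct (root_exists m z Hm) as [b Eb]. rewrite <- Eb, Cmod_pow in Hz.
  pose proof (Cmod_ge_0 b) as Gb.
  assert (Hb : Cmod b < eta).
  { apply Rnot_le_lt. intro X. assert (eta ^ m <= Cmod b ^ m) by (apply pow_incr; lra). lra. }
  assert (E0 : cover (Some m) 0 = RtoC 0) by (simpl; destruct m; [lia|]; simpl; ring).
  rewrite <- Eb, <- E0. change (b ^ m)%C with (cover (Some m) b).
  apply chain_link; [change (Cmod 0 < 1); rewrite Cmod_0; lra | change (Cmod b < 1); lra |].
  assert (R0 : (0 * b)%C = RtoC 0) by ring. assert (R1 : (1 * b)%C = b) by ring.
  rewrite <- R0. rewrite <- R1 at 2.
  assert (Hin : forall t, 0 <= t <= 1 -> Cmod (t * b) <= 1 / 2).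
  { intros t Ht. pose proof (Cmod_real_scale t b Ht). lra. }
  apply (poincare_le_intro (fun t => RtoC t * b)%C (fun _ => b)).
  - intro t. apply Rderiv_id_mul.
  - intro t. apply curve_cont_const.
  - intros t Ht. specialize (Hin t Ht). lra.
  - apply Rle_trans with (RInt (fun _ => e) 0 1).
    + apply RInt_le; [lra | | apply ex_RInt_const |].
      * apply ex_RInt_cont_on; [lra|]. intros t Ht. apply continuous_mult_R; [|apply continuous_const].
        apply (continuous_poincare_density (fun t => RtoC t * b)%C); [exact (Rderiv_cont _ _ _ (Rderiv_id_mul b t))|].
        specialize (Hin t Ht). lra.
      * intros t Ht. specialize (Hin t ltac:(lra)). pose proof (Cmod_ge_0 (t * b)).
        assert (poincare_density (t * b) <= 4).
        { unfold poincare_density. apply Rle_div_l; nra. }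
        nra.
    + rewrite RInt_const. unfold scal; simpl; unfold mult; simpl. lra.
Qed.

(** The arc is left at a time [s] just before the first zero, where the density is still continuous
    on [[0, s]], and a radial curve of cost [e] replaces the rest. If the curve starts at [0], then
    [s = 0]. *)
Lemma chain_to_zero (m : nat) (gam gam' : R -> C) (z e : R) : (1 <= m)%nat ->
  (forall t, Rderiv gam t (gam' t)) -> (forall t, curve_cont gam' t) ->
  (forall t, 0 <= t <= 1 -> Cmod (gam t) < 1) -> 0 <= z <= 1 -> gam z = 0 -> 0 < e ->
  exists s, 0 <= s <= z /\ ex_RInt (fun t => omega_density (Some m) (gam t) * Cmod (gam' t)) 0 s /\
    chain (Some m) (gam 0) 0 (RInt (fun t => omega_density (Some m) (gam t) * Cmod (gam' t)) 0 s + e).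
Proof.
  intros Hm H1 H2 H3 Hz Ez He.
  destruct (first_zero gam z) as (t0 & Ht0 & E0 & Hlt); auto; [intro t; exact (Rderiv_cont _ _ _ (H1 t)) | lra |].
  destruct (chain_radial m e Hm He) as (d & Pd & Qd).
  destruct (Req_dec t0 0) as [->|Hn0].
  - exists 0. split; [lra|]. split; [apply ex_RInt_point|]. rewrite RInt_point, E0.
    unfold zero; simpl. rewrite Rplus_0_l. apply Qd. now rewrite Cmod_0.
  - destruct (proj1 (curve_cont_iff _ _) (Rderiv_cont _ _ _ (H1 t0)) d Pd) as (r & Pr & Qr).
    set (s := Rmax 0 (t0 - r / 2)).
    assert (Hs : 0 <= s < t0 /\ t0 - r < s).
    { unfold s. split; [split; [apply Rmax_l | apply Rmax_lub_lt; lra] |].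
      apply Rlt_le_trans with (2 := Rmax_r 0 (t0 - r / 2)). lra. }
    clearbody s. exists s. split; [lra|].
    destruct (chain_segment (Some m) gam gam' 0 s) as [I K]; auto; try lra.
    { intros m' Em. injection Em as <-. auto. }
    { intros u Hu. split; [apply Hlt; lra | apply H3; lra]. }
    split; [exact I|]. apply chain_trans with (gam s); [exact K|]. apply chain_sym, Qd.
    specialize (Qr s ltac:(rewrite Rabs_left; lra)). rewrite E0 in Qr.
    now replace (gam s - 0)%C with (gam s) in Qr by ring.
Qed.

Lemma RInt_reverse (F : R -> R) (s : R) : ex_RInt (fun t => F (-1 * t + 1)) 0 s ->
  ex_RInt F (1 - s) 1 /\ RInt F (1 - s) 1 = RInt (fun t => F (-1 * t + 1)) 0 s.
Proof.
  intro H. apply (RInt_correct (V := R_CompleteNormedModule)) in H. set (l := RInt _ 0 s) in *.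
  assert (I : is_RInt F (1 - s) 1 l).
  { replace 0 with (-1 * 1 + 1) in H by ring. replace s with (-1 * (1 - s) + 1) in H by ring.
    apply (is_RInt_comp_lin (V := R_NormedModule) (fun t => F (-1 * t + 1)) (-1) 1 1 (1 - s)) in H.
    apply is_RInt_swap, (is_RInt_scal (V := R_NormedModule) _ _ _ (-1)) in H.
    replace l with (scal (-1) (opp l)) by (unfold scal, opp; simpl; unfold mult; simpl; ring).
    apply (is_RInt_ext (V := R_NormedModule)) with (2 := H). intros t _. unfold scal; simpl; unfold mult; simpl.
    replace (-1 * (-1 * t + 1) + 1) with t by ring. ring. }
  split; [now eexists; apply I | now apply (@is_RInt_unique R_CompleteNormedModule)].
Qed.

(** Between its first and last zero a curve only adds to the length and is skipped; the remaining
    two arcs avoid [0] and lift to the disc. *)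
Lemma length_chain (n : option nat) (p q : C) (L e : R) : (forall m, n = Some m -> (1 <= m)%nat) -> 0 < e ->
  length_set (omega_reg n) (omega_coef n) (orb_dom n) p q L -> chain n p q (L + e).
Proof.
  intros Hn He (gam & gam' & HC & HL). apply C1_curve_iff in HC. destruct HC as (H1 & H2 & <- & <- & H5).
  assert (H3 : forall t, 0 <= t <= 1 -> Cmod (gam t) < 1) by (intros t Ht; apply (H5 t Ht)).
  set (F := fun t => omega_density n (gam t) * Cmod (gam' t)).
  assert (HF0 : forall t, 0 <= F t).
  { intro t. apply Rmult_le_pos; [apply omega_density_ge_0 | apply Cmod_ge_0]. }
  (* The length dominates the integral of the density restricted to any part of the curve: a step
     function below [F] where [K = F] and below [0] elsewhere is admissible in [length_le]. *)
  assert (Low : forall K : R -> R, ex_RInt K 0 1 -> (forall t, 0 <= t <= 1 -> K t = F t \/ K t = 0) -> RInt K 0 1 <= L).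
  { intros K HK HKF. apply RInt_le_of_steps; auto. intros phi Hphi. apply HL. intros t Ht.
    specialize (Hphi t Ht). destruct (HKF t Ht) as [E|E]; rewrite E in Hphi; split; intro X.
    - unfold F in Hphi. rewrite X in Hphi. change C0 with (RtoC 0) in Hphi. rewrite Cmod_0, Rmult_0_r in Hphi. auto.
    - exact Hphi.
    - auto.
    - apply Rle_trans with (1 := Hphi). apply HF0. }
  destruct (classic (exists z, 0 <= z <= 1 /\ gam z = RtoC 0)) as [[z [Hz Ez]]|Hno].
  2:{ destruct (chain_segment n gam gam' 0 1 Hn H1 H2) as [I K]; try lra.
      { intros u Hu. split; [intro E; apply Hno; now exists u | auto]. }
      apply chain_weaken with (2 := K). apply Rle_trans with L; [|lra]. apply Low; auto. }
  destruct n as [m|].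
  2:{ destruct (H5 z Hz) as [_ X]. exfalso. now apply X. }
  specialize (Hn m eq_refl).
  destruct (chain_to_zero m gam gam' z (e / 2) Hn H1 H2 H3 Hz Ez) as (s & Hs & I1 & K1); [lra|].
  (* The last zero is reached as the first zero of the reversed curve. *)
  destruct (chain_to_zero m (fun t => gam (-1 * t + 1)) (fun t => RtoC (-1) * gam' (-1 * t + 1)%R)%C (1 - z) (e / 2) Hn) as (s' & Hs' & I2 & K2).
  - intro t. apply (Rderiv_reparam gam (fun t => -1 * t + 1)); [apply is_derive_affine | apply H1].
  - intro t. apply (curve_cont_mul (fun _ => RtoC (-1))); [apply curve_cont_const|].
    apply (curve_cont_reparam gam' (fun t => -1 * t + 1)); [apply continuous_affine | apply H2].
  - intros t Ht. apply H3. lra.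
  - lra.
  - rewrite <- Ez. f_equal. ring.
  - lra.
  - replace (-1 * 0 + 1) with 1 in K2 by ring.
    assert (EF : forall t, omega_density (Some m) (gam (-1 * t + 1)) * Cmod (RtoC (-1) * gam' (-1 * t + 1)%R) = F (-1 * t + 1)).
    { intro t. unfold F. rewrite Cmod_mult, Cmod_R, Rabs_left by lra. ring. }
    assert (I2' : ex_RInt (fun t => F (-1 * t + 1)) 0 s') by (apply (ex_RInt_ext _ _ _ _ (fun t _ => EF t)); exact I2).
    destruct (RInt_reverse F s' I2') as [I3 E3].
    rewrite (RInt_ext _ (fun t => F (-1 * t + 1))), <- E3 in K2 by (intros; apply EF).
    apply chain_sym in K2.
    (* The density on the two outer arcs and [0] between them; the arcs do not overlap because
       [s <= z <= 1 - s']. The two losses of [e / 2] add up to [e]. *)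
    set (K := fun t => if Rlt_dec t s then F t else if Rlt_dec (1 - s') t then F t else 0).
    assert (IK : is_RInt K 0 1 (RInt F 0 s + (0 + RInt F (1 - s') 1))).
    { apply (is_RInt_Chasles (V := R_NormedModule)) with s; [|apply (is_RInt_Chasles (V := R_NormedModule)) with (1 - s')].
      - apply (is_RInt_ext F); [|now apply (RInt_correct (V := R_CompleteNormedModule))].
        intros t. rewrite Rmin_left, Rmax_right by lra. intro Ht. unfold K. destruct (Rlt_dec t s); auto. lra.
      - apply (is_RInt_ext (fun _ => 0)).
        + intros t. rewrite Rmin_left, Rmax_right by lra. intro Ht. unfold K.
          destruct (Rlt_dec t s); [lra|]. destruct (Rlt_dec (1 - s') t); auto. lra.
        + pose proof (@is_RInt_const R_NormedModule s (1 - s') 0) as Z.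
          rewrite (scal_zero_r (V := R_NormedModule)) in Z. exact Z.
      - apply (is_RInt_ext F); [|now apply (RInt_correct (V := R_CompleteNormedModule))].
        intros t. rewrite Rmin_left, Rmax_right by lra. intro Ht. unfold K.
        destruct (Rlt_dec t s); auto. destruct (Rlt_dec (1 - s') t); auto. lra. }
    assert (HL' : RInt K 0 1 <= L).
    { apply Low; [now eexists; apply IK|]. intros t _. unfold K.
      destruct (Rlt_dec t s); auto. destruct (Rlt_dec (1 - s') t); auto. }
    rewrite (@is_RInt_unique R_CompleteNormedModule _ _ _ _ IK) in HL'.
    apply chain_weaken with (2 := chain_trans _ _ _ _ _ _ K1 K2). fold F. lra.
Qed.

Theorem theorem3p3 (n : option nat) (Hn : forall m, n = Some m -> (1 <= m)%nat)
  (d : Cx -> Cx -> R)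
  (Hd : induced_distance (omega_reg n) (omega_coef n) (orb_dom n) d) :
  is_orbifold_kobayashi false n d /\ is_orbifold_kobayashi true n d.
Proof.
  assert (Hle : forall p q L, orb_dom n p -> orb_dom n q -> rest_curve n p q L -> d p q <= L).
  { intros p q L Hp Hq HL. apply (Hd p q Hp Hq). now apply rest_curve_length. }
  (* Lower bounds on the infimum need only be tested on chains, each curve being replaced by one at
     the expense of [e]. *)
  assert (Hge : forall p q c, orb_dom n p -> orb_dom n q ->
    (forall L e, 0 < e -> chain n p q (L + e) -> c <= L + e) -> c <= d p q).
  { intros p q c Hp Hq H. apply (Hd p q Hp Hq). intros L HL. apply le_epsilon. intros e He.
    apply H; auto. now apply length_chain. }
  (* The zero step function lies below every length density, so lengths are nonnegative. *)
  assert (Hpos : forall p q, orb_dom n p -> orb_dom n q -> 0 <= d p q).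
  { intros p q Hp Hq. apply (Hd p q Hp Hq). intros L (gam & gam' & _ & HL).
    specialize (HL (mkStepFun (StepFun_P4 0 1 0))). rewrite StepFun_P18, Rmult_0_l in HL. apply HL.
    intros t _. simpl. unfold fct_cte. split; [lra|]. intros _.
    apply Rmult_le_pos; [apply sqrt_pos | apply (Cmod_ge_0 (gam' t))]. }
  assert (Hsym : forall p q, orb_dom n p -> orb_dom n q -> d p q <= d q p).
  { intros p q Hp Hq. apply Hge; auto. intros L e _ HC. apply Hle; auto.
    apply rest_curve_sym. now apply chain_rest_curve. }
  assert (Hps : pseudo_distance_on (orb_dom n) d).
  { intros p q r Hp Hq Hr. split; [|split].
    - apply Rle_antisym; auto. apply Hle; auto. now apply rest_curve_refl.
    - apply Rle_antisym; auto.
    (* The terms are moved so that [d p q], and then [d q r], stands alone on the right, where [Hge]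
       replaces it by the cost of a chain; the two chains are then concatenated as rest curves. *)
    - apply Rplus_le_reg_r with (- d q r). replace (d p q + d q r + - d q r) with (d p q) by ring.
      apply Hge; auto. intros L1 e1 _ HC1. apply Rplus_le_reg_r with (d q r - (L1 + e1)).
      replace (L1 + e1 + (d q r - (L1 + e1))) with (d q r) by ring.
      apply Hge; auto. intros L2 e2 _ HC2.
      pose proof (Hle p r _ Hp Hr (rest_curve_trans n p q r _ _ (chain_rest_curve n p q _ Hn HC1) (chain_rest_curve n q r _ Hn HC2))).
      lra. }
  (* Contraction comes from the Schwarz-Pick inequality for all morphisms, and maximality from
     chains of [cover], which is a morphism of both kinds. *)
  assert (Hall : forall cl, is_orbifold_kobayashi cl n d).
  { intro cl. split; [exact Hps|]. split.
    - intros g Hg a b L Ha Hb HL. apply Hle; try now apply (morphism_orb_dom cl).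
      apply rest_curve_morphism; auto. destruct cl; auto. now apply orbifold_morphism_weaken.
    - intros d' Hp' Hc' p q Hp Hq. apply Hge; auto. intros L e _ HC.
      now apply (contracted_chain cl n d' p q). }
  auto.
Qed.
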